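(* Let $n\ge3$. If $\tau$ is an even, zonal measure on $\mathbb{S}^{n-1}$ such that $\tau(\mathbb{S}^{n-1})=\kappa_{n-1}$ and $L\in\mathcal{S}^n_o$, then for $1\le i\le n-1$, $$V_n(\Psi_i^\tau L)\le V_n(\mathrm{I}_iL)\le\frac{\kappa_{n-1}^n}{\kappa_n^{n-1}}\tilde A_{n-i}(L)^n.$$
   Context: $\mathcal{S}^n_o$ is the set of star bodies in $\mathbb{R}^n$: compact sets, starshaped with respect to the origin, with positive continuous radial function $\rho(L,u)=\max\{\lambda>0:\lambda u\in L\}$, $u\in\mathbb{S}^{n-1}$. $V_m$ is $m$-dimensional volume and $\kappa_m$ the volume of the unit ball in $\mathbb{R}^m$. All measures are finite non-negative Borel measures and non-trivial. Fix a pole $\bar e\in\mathbb{S}^{n-1}$ with stabilizer $\mathrm{SO}(n-1)\subset\mathrm{SO}(n)$; a measure on $\mathbb{S}^{n-1}$ is zonal if it is $\mathrm{SO}(n-1)$-invariant, and even if invariant under $u\mapsto-u$. For $f\in C(\mathbb{S}^{n-1})$ and a zonal measure $\sigma$, the convolution is $(f*\sigma)(\eta\bar e)=\int_{\mathbb{S}^{n-1}}f(\eta u)\,d\sigma(u)$, $\eta\in\mathrm{SO}(n)$. Let $\lambda_{\mathbb{S}^{n-1}\cap u^\perp}$ denote the uniform probability measure on the great subsphere $\mathbb{S}^{n-1}\cap u^\perp$. For an even zonal $\tau$, $1\le i\le n-1$ and $L\in\mathcal{S}^n_o$, the star bodies $\Psi_i^\tau L$ and $\mathrm{I}_iL$ (intersection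 body of order $i$) are defined by $$\rho(\Psi_i^\tau L,\cdot)=\rho(L,\cdot)^i*\tau*\lambda_{\mathbb{S}^{n-1}\cap\bar e^\perp},\qquad \rho(\mathrm{I}_iL,u)=\kappa_{n-1}\int_{\mathbb{S}^{n-1}}\rho(L,v)^i\,d\lambda_{\mathbb{S}^{n-1}\cap u^\perp}(v),$$ i.e. with $g=\rho(L,\cdot)^i*\tau$ one has $\rho(\Psi_i^\tau L,u)=\int g\,d\lambda_{\mathbb{S}^{n-1}\cap u^\perp}$. The dual affine quermassintegrals are, for $1\le i\le n-1$, $$\tilde A_{n-i}(L)=\frac{\kappa_n}{\kappa_i}\left(\int_{\mathrm{Gr}_{n,i}}V_i(L\cap E)^n\,d\nu_i(E)\right)^{1/n},$$ where $\mathrm{Gr}_{n,i}$ is the Grassmannian of $i$-dimensional linear subspaces of $\mathbb{R}^n$ and $\nu_i$ its Haar (rotation invariant) probability measure. *)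

(* Defs.v *)
(* Points of R^n are row vectors; all metric notions below are Euclidean, since
   the library norm `|x| on 'rV[R]_n is the sup norm (used only through its
   topology, which is the Euclidean one). *)
From HB Require Import structures.
From mathcomp Require Import all_boot all_order all_algebra.
From mathcomp Require Import all_classical all_reals all_analysis.
From mathcomp Require Import measurable_realfun.

Set Implicit Arguments.
Unset Strict Implicit.
Unset Printing Implicit Defensive.

Import Order.TTheory GRing.Theory Num.Theory.
Import numFieldNormedType.Exports.

Local Open Scope classical_set_scope.
Local Open Scope ring_scope.

Section Defs.
Variable R : realType.

Definition borel_mx (m n : nat) := g_sigma_algebraType (@open 'M[R]_(m, n)).

Section Euclidean.
Variable n : nat.

Definition dot (x y : 'rV[R]_n) : R := (x *m y^T) 0 0.
Definition enorm (x : 'rV[R]_n) : R := Num.sqrt (dot x x).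
Definition sphere : set 'rV[R]_n := [set u | enorm u = 1].
Definition unit_ball : set 'rV[R]_n := [set x | enorm x <= 1].
Definition orth (u : 'rV[R]_n) : set 'rV[R]_n := [set x | dot x u = 0].

Definition SO : set 'M[R]_n :=
  [set eta | eta *m eta^T = 1%:M /\ \det eta = 1].

(* (eta x)^T = x^T eta^T *)
Definition rotate (eta : 'M[R]_n) (x : 'rV[R]_n) : 'rV[R]_n := x *m eta^T.

End Euclidean.

(* m-dimensional Lebesgue measure, the m-fold product of Lebesgue measure on R
   computed as an iterated integral over slices (as the library does for the
   binary product measure); it is meant for Borel sets. *)
Fixpoint vol (m : nat) : set 'rV[R]_m -> \bar R :=
  match m with
  | 0 => fun A => (\1_A (0 : 'rV[R]_0))%:E
  | k.+1 => fun A =>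
      (\int[lebesgue_measure]_(x in [set: R])
         @vol k [set y : 'rV[R]_k | A (row_mx x%:M y)])%E
  end.

Definition kappa (m : nat) : R := fine (vol (@unit_ball m)).

Section Body.
Variable n : nat.
Implicit Types (L A : set 'rV[R]_n) (u v w : 'rV[R]_n) (P : 'M[R]_n).

(* The supremum is a maximum for a star body, see radial_max. *)
Definition radial L u : R := sup [set r : R | 0 < r /\ L (r *: u)].

Definition star_body L : Prop :=
  [/\ compact L,
      (forall x, L x -> forall t : R, 0 <= t <= 1 -> L (t *: x)),
      (forall u, sphere u -> 0 < radial L u) &
      {within @sphere n, continuous (radial L)}].

(* the star body with radial function r on the sphere, see radial_body_of *)
Definition body_of (r : 'rV[R]_n -> R) : set 'rV[R]_n :=
  [set x | exists u t, [/\ sphere u, 0 <= t <= r u & x = t *: u]].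

(* Measures on the sphere are Borel measures on R^n vanishing off the sphere. *)
Definition on_sphere (sigma : {measure set (borel_mx 1 n) -> \bar R}) : Prop :=
  sigma (~` @sphere n) = 0%E.

Definition even_measure (sigma : {measure set (borel_mx 1 n) -> \bar R}) :=
  forall A : set (borel_mx 1 n), measurable A ->
    sigma [set u : 'rV[R]_n | A (- u)] = sigma A.

Definition rot_fix_invariant w
    (sigma : {measure set (borel_mx 1 n) -> \bar R}) :=
  forall eta, SO eta -> rotate eta w = w ->
  forall A : set (borel_mx 1 n), measurable A ->
    sigma [set u : 'rV[R]_n | A (rotate eta u)] = sigma A.

Definition zonal (ebar : 'rV[R]_n) sigma := rot_fix_invariant ebar sigma.

(* The uniform probability measure on the great subsphere orthogonal to u is the
   one invariant under the rotations fixing u (unique for n >= 3, where these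
   act transitively on the subsphere). *)
Definition uniform_subsphere u (lam : probability (borel_mx 1 n) R) : Prop :=
  lam (@sphere n `&` orth u) = 1%E /\ rot_fix_invariant u lam.

(* (f * sigma)(w), with eta any rotation taking ebar to w; the value does not
   depend on the choice of eta when sigma is zonal, see sconvE. *)
Definition rotation_to (ebar w : 'rV[R]_n) : 'M[R]_n :=
  xget 1%:M [set eta | SO eta /\ rotate eta ebar = w].

Definition sconv (ebar : 'rV[R]_n) (f : 'rV[R]_n -> R)
    (sigma : {measure set (borel_mx 1 n) -> \bar R}) (w : 'rV[R]_n) : R :=
  (\int[sigma]_(u in @sphere n) f (rotate (rotation_to ebar w) u))%R.

Definition Psi (ebar : 'rV[R]_n)
    (lam : 'rV[R]_n -> probability (borel_mx 1 n) R)
    (tau : {measure set (borel_mx 1 n) -> \bar R}) (i : nat) L :=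
  body_of (sconv ebar (sconv ebar (fun u => radial L u ^+ i) tau) (lam ebar)).

Definition intersection_body
    (lam : 'rV[R]_n -> probability (borel_mx 1 n) R) (i : nat) L :=
  body_of (fun u =>
    kappa n.-1 * (\int[lam u]_(v in @sphere n) (radial L v ^+ i))%R).

(* A linear subspace is represented by the orthogonal projection onto it (of
   which it is the row space); this embeds the Grassmannian in 'M[R]_n, whence
   its Borel sets. *)
Definition Gr (i : nat) : set 'M[R]_n :=
  [set P | [/\ P^T = P, P *m P = P & \rank P = i]].

Definition subspace_of P : set 'rV[R]_n := [set x | (x <= P)%MS].

(* eta maps the subspace of P onto that of eta P eta^T *)
Definition haar_Gr (i : nat) (nu : probability (borel_mx n n) R) : Prop :=
  nu (Gr i) = 1%E /\
  forall eta, SO eta -> forall A : set (borel_mx n n), measurable A ->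
    nu [set P : 'M[R]_n | A (eta *m P *m eta^T)] = nu A.

(* the rows form an orthonormal basis of the subspace of P *)
Definition onbasis (i : nat) P : 'M[R]_(i, n) :=
  xget 0 [set B | B *m B^T = 1%:M /\ (B :=: P)%MS].

(* i-dimensional volume of a subset of the i-dimensional subspace of P, computed
   in orthonormal coordinates *)
Definition sub_vol (i : nat) P A : \bar R :=
  vol [set y : 'rV[R]_i | A (y *m onbasis i P)].

(* the dual affine quermassintegral of index n - i *)
Definition dual_affine_quermass (i : nat) (nu : probability (borel_mx n n) R) L
    : \bar R :=
  ((kappa n / kappa i)%:E *
   (\int[nu]_(P in Gr i) (sub_vol i P (L `&` subspace_of P)) ^+ n)
     `^ (n%:R^-1))%E.

End Body.
End Defs.

Section Sanity.
Variables (R : realType) (n : nat).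
Implicit Types (u v w : 'rV[R]_n).

Lemma dotE u v : dot u v = \sum_j u 0 j * v 0 j.
Proof. by rewrite /dot mxE; apply: eq_bigr => j _; rewrite mxE. Qed.

Lemma dotZ (a b : R) u v : dot (a *: u) (b *: v) = a * b * dot u v.
Proof. by rewrite /dot linearZ /= -scalemxAl -scalemxAr scalerA mxE. Qed.

Lemma enormZ (a : R) u : enorm (a *: u) = `|a| * enorm u.
Proof.
by rewrite /enorm dotZ sqrtrM ?sqr_ge0 -?expr2 ?sqr_ge0// sqrtr_sqr.
Qed.

Lemma rot_sphere (eta : 'M[R]_n) u :
  SO eta -> sphere (rotate eta u) <-> sphere u.
Proof.
move=> [/mulmx1C eK _].
by rewrite /sphere /= /enorm /dot /rotate trmx_mul trmxK mulmxA -(mulmxA u) eK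
  mulmx1.
Qed.

Lemma sphere_neq0 u : sphere u -> u != 0.
Proof.
move=> uS; apply/eqP => u0; move: uS; rewrite /sphere /= u0 /enorm /dot mul0mx.
by rewrite mxE sqrtr0 => /eqP; rewrite eq_sym oner_eq0.
Qed.

Lemma radial_body_of (r : 'rV[R]_n -> R) u :
  sphere u -> 0 < r u -> radial (body_of r) u = r u.
Proof.
move=> uS r0; rewrite /radial.
rewrite (_ : [set _ | _] = `]0, (r u)]%classic) ?sup_itv ?bnd_simp//.
apply/seteqP; split=> t /=; rewrite in_itv /=.
  move=> [t0 [v [s [vS /andP[s0 sr] tusv]]]]; rewrite t0 /=.
  have ts : t = s.
    have := congr1 (@enorm _ _) tusv; rewrite !enormZ vS uS !mulr1.
    by rewrite !ger0_norm// ltW.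
  move: tusv; rewrite -ts => /(scalerI (lt0r_neq0 t0)) uv.
  by rewrite ts uv.
by case/andP=> t0 tr; split=> //; exists u, t; rewrite (ltW t0).
Qed.

Lemma radial_max (L : set 'rV[R]_n) u : star_body L -> sphere u ->
  L (radial L u *: u) /\ (forall r : R, L (r *: u) -> r <= radial L u).
Proof.
move=> [cL stL posL _] uS; have ru := posL _ uS.
have clL : closed L by apply: compact_closed cL; exact: norm_hausdorff. 
set S := [set r : R | 0 < r /\ L (r *: u)].
have hS : has_sup S.
  split.
    apply/set0P/eqP => S0; move: ru; rewrite /radial -/S S0 sup0.
    by rewrite ltxx.
  have [M [_ LM]] := compact_bounded cL.
  have u0 : 0 < `|u| by rewrite normr_gt0; exact: sphere_neq0.
  exists ((M + 1) / `|u|) => r [r0 Lr].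
  rewrite ler_pdivlMr// -(ger0_norm (ltW r0)) -normrZ.
  have M1 : M < M + 1 by rewrite ltrDl.
  exact: (LM _ M1 _ Lr).
have le r : L (r *: u) -> r <= radial L u.
  have [r0 _|r0 Lr] := leP r 0; first exact: (le_trans r0 (ltW ru)).
  exact: sup_upper_bound.
split=> //.
have clS : closed [set r : R | L (r *: u)].
  by apply: (preimage_closed _ clL) => r _; exact: scalel_continuous.
apply: (clS (radial L u)) => B /nbhs_ballP[e /= e0 eB].
have [r [r0 Lr] rs] := sup_adherent e0 hS.
exists r; split=> //; apply: eB; rewrite /ball /=.
by rewrite ger0_norm ?subr_ge0 ?le// ltrBlDr -ltrBlDl.
Qed.

Lemma coord_le_norm u j : `|u 0 j| <= `|u|.
Proof.
rewrite [leRHS]/Num.norm /= mx_normrE.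
by apply/bigmax_geP; right; exists (0, j).
Qed.

Lemma rotate_continuous (eta : 'M[R]_n) : continuous (rotate eta).
Proof.
apply: (@bounded_linear_continuous R _ _
  (mulmxr eta^T : {linear 'rV[R]_n -> 'rV[R]_n})).
apply/linear_boundedP.
set C : R := \sum_j \sum_k `|eta^T k j|.
have C0 : 0 <= C by apply: sumr_ge0 => j _; apply: sumr_ge0.
exists C; split; first exact: ger0_real.
move=> r Cr u; apply: (@le_trans _ _ (C * `|u|)); last first.
  by rewrite ler_wpM2r// ltW.
rewrite [leLHS]/Num.norm /= mx_normrE; apply/bigmax_leP; split.
  exact: mulr_ge0.
case=> i j _ /=; rewrite ord1 mxE (le_trans (ler_norm_sum _ _ _))//.
rewrite /C [X in _ <= X * _](bigD1 j)//= mulrDl -[leLHS]addr0 lerD//;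
  last first.
  by apply: mulr_ge0 => //; apply: sumr_ge0 => k _; apply: sumr_ge0.
rewrite mulr_suml; apply: ler_sum => k _.
by rewrite normrM mulrC ler_wpM2l// coord_le_norm.
Qed.

Lemma sphere_closed : closed (@sphere R n).
Proof.
rewrite (_ : @sphere R n = (fun u : 'rV[R]_n => \sum_j u 0 j * u 0 j) @^-1`
    [set x : R | x = 1]); last first.
  apply/seteqP; split=> u; rewrite /sphere /enorm /= dotE.
    move=> h; have := congr1 (fun x => x ^+ 2) h.
    by rewrite sqr_sqrtr ?expr1n// sumr_ge0// => j _; rewrite -expr2 sqr_ge0.
  by move=> ->; rewrite sqrtr1.
apply: (preimage_closed _ (@closed_eq _ _)).
move=> u _; apply: continuous_big => [|j _]; first exact: add_continuous.
move=> x; apply: cvgM; first exact: nbhs_filter.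
  exact: (@coord_continuous R 1 n 0 j x).
exact: (@coord_continuous R 1 n 0 j x).
Qed.

Lemma rotate_measurable (eta : 'M[R]_n) :
  measurable_fun setT (rotate eta : borel_mx R 1 n -> borel_mx R 1 n).
Proof.
apply: measurability; first by [].
move=> _ [B oB <-].
rewrite setTI; apply: sub_sigma_algebra.
by move: B oB; apply/continuousP; exact: rotate_continuous.
Qed.

Lemma sphere_measurable : measurable (@sphere R n : set (borel_mx R 1 n)).
Proof.
rewrite -[X in measurable X]setCK; apply: measurableC.
by apply: sub_sigma_algebra; exact/closed_openC/sphere_closed.
Qed.

Lemma sconvE (ebar : 'rV[R]_n) (f : 'rV[R]_n -> R)
    (sigma : {measure set (borel_mx R 1 n) -> \bar R}) (eta : 'M[R]_n) :
  zonal ebar sigma -> measurable_fun (@sphere R n : set (borel_mx R 1 n)) f ->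
  SO eta ->
  sconv ebar f sigma (rotate eta ebar) =
    (\int[sigma]_(u in @sphere R n) f (rotate eta u))%R.
Proof.
move=> zs mf He; rewrite /sconv; set w := rotate eta ebar.
have [He' e'w] :
    SO (rotation_to ebar w) /\ rotate (rotation_to ebar w) ebar = w.
  exact: (xgetPex (P := [set e | SO e /\ rotate e ebar = w]) 1%:M
    (ex_intro _ eta (conj He erefl))).
move: (rotation_to ebar w) He' e'w => e' He' e'w.
pose z : 'M[R]_n := eta^T *m e'.
have rotM (a b : 'M[R]_n) u : rotate a (rotate b u) = rotate (a *m b) u.
  by rewrite /rotate trmx_mul mulmxA.
have [eeT de] := He; have [e'T de'] := He'.
have eTe := mulmx1C eeT; have e'Te := mulmx1C e'T.
have Hz : SO z.
  rewrite /z; split; last by rewrite det_mulmx det_tr de de' mulr1.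
  by rewrite trmx_mul trmxK mulmxA -(mulmxA eta^T) e'T mulmx1.
have zE : rotate z ebar = ebar.
  by rewrite -rotM e'w /w rotM eTe /rotate trmx1 mulmx1.
have e'E u : rotate e' u = rotate eta (rotate z u).
  by rewrite rotM /z mulmxA eeT mul1mx.
have zS : rotate z @^-1` (@sphere R n) = @sphere R n.
  by apply/seteqP; split=> u /=; rewrite rot_sphere.
pose g : borel_mx R 1 n -> R := fun u => f (rotate eta u).
have mg : measurable_fun (@sphere R n : set (borel_mx R 1 n)) g.
  apply: (@measurable_comp _ _ _ (borel_mx R 1 n) (borel_mx R 1 n) _
    (@sphere R n) f _ (rotate eta)) => //.
  - exact: sphere_measurable.
  - by move=> _ [u uS <-]; rewrite rot_sphere.
  - exact: measurable_funTS (rotate_measurable eta).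
have key (h : borel_mx R 1 n -> \bar R) :
    measurable_fun (@sphere R n : set (borel_mx R 1 n)) h ->
    (forall u, (0 <= h u)%E) ->
    (\int[sigma]_(u in @sphere R n) h (rotate z u) =
     \int[sigma]_(u in @sphere R n) h u)%E.
  move=> mh h0.
  have := @ge0_integral_pushforward _ _ _ _ R _ (rotate_measurable z) sigma
    (@sphere R n) h sphere_measurable mh (fun u _ => h0 u).
  rewrite zS => <-; apply: eq_measure_integral => [|mz A mA _].
    exact: rotate_measurable.
  exact: (zs _ Hz zE A mA).
rewrite /Rintegral; congr fine.
under eq_integral do rewrite e'E.
transitivity (\int[sigma]_(u in @sphere R n) ((EFin \o g) \o rotate z) u)%E.
  by [].
transitivity (\int[sigma]_(u in @sphere R n) (EFin \o g) u)%E; last by [].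
have mEg := (measurable_EFinP (@sphere R n : set (borel_mx R 1 n)) g).2 mg.
rewrite (@integralE _ _ _ sigma (@sphere R n) ((EFin \o g) \o rotate z)).
rewrite (@integralE _ _ _ sigma (@sphere R n) (EFin \o g)).
rewrite funepos_comp funeneg_comp; congr (_ - _)%E.
- exact: (key _ (measurable_funepos mEg) (funepos_ge0 _)).
- exact: (key _ (measurable_funeneg mEg) (funeneg_ge0 _)).
Qed.
End Sanity.

(* Main.v *)
Require Import Defs.
From HB Require Import structures.
From mathcomp Require Import all_boot all_order all_algebra.
From mathcomp Require Import all_classical all_reals all_analysis.
From mathcomp Require Import measurable_realfun.
From mathcomp Require Import ring lra.

Set Implicit Arguments.
Unset Strict Implicit.
Unset Printing Implicit Defensive.

Import Order.TTheory GRing.Theory Num.Theory.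
Import numFieldNormedType.Exports.

Local Open Scope classical_set_scope.
Local Open Scope ring_scope.

(** No Haar measure on SO(n) is needed.  If H is a group of rotations and a
    family of functions on H is bounded and equicontinuous, averaging over a
    finite net of H contracts oscillations, so finitely many elements of H
    average all members of the family to within eps of constants.  Integrals
    commute with finite averages, and the integral against any H-invariant
    measure is recovered from them up to eps.

    First inequality.  Some rotation exchanges two given unit vectors, so
    convolutions with zonal measures are self-adjoint with respect to rotation
    averages, and hence commute.  Thus the radial function of Psi is the
    convolution with tau of that of I_i L divided by kappa_{n-1}, and
    n a^(n-1) b <= (n-1) a^n + b^n bounds its n-th moment, which in polar
    coordinates is the volume.

    Second inequality.  The mean of rho^i over the subsphere orthogonal to u is
    the average, over the rotations k fixing u, of its means over the subspheres
    of k E for one fixed i-dimensional E orthogonal to u, and the latter are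
    V_i(L cap kE) / kappa_i.  Jensen's inequality for the n-th power and
    averaging over u give the bound. *)

(** * Rotations with prescribed values *)

Section Rotations.
Variables (R : realType) (n : nat).
Implicit Types (u v w x y z : 'rV[R]_n).

(** No surface measure is built. The integral of f over the sphere is replaced by that of f(x/|x|)
    over the punctured unit ball, which has mass kappa_n. Orthogonal invariance of Lebesgue measure
    then governs spherical means, and volumes of bodies appear directly. Volume is defined by
    iterated slices, so this invariance is not visible from the definition and must be derived.
    Every comparison is made up to a multiple of a free [e]. The list of rotations is fixed only
    once all functions to be averaged are known, so that one list serves them all, and [e] is then
    divided by the constant that collects the errors. Continuity is stated as equicontinuity along
    rotations: this is what the averaging argument consumes, and convolution preserves it. The
    sphere and the Grassmannian are treated as orbits of the compact rotation group, which also
    yields measurability. The condition n >= 3 enters through determinants: an orthogonal map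
    prescribed on two vectors can be corrected to a rotation when a third direction is left over. *)

Lemma dotC x y : dot x y = dot y x.
Proof. by rewrite !dotE; apply: eq_bigr => j _; rewrite mulrC. Qed.

Lemma dot_scalar x y : x *m y^T = (dot x y)%:M.
Proof. by rewrite [LHS]mx11_scalar. Qed.

Lemma dotDl x y z : dot (x + y) z = dot x z + dot y z.
Proof. by rewrite /dot mulmxDl mxE. Qed.

Lemma dotNl x y : dot (- x) y = - dot x y.
Proof. by rewrite /dot mulNmx mxE. Qed.

Lemma dotBl x y z : dot (x - y) z = dot x z - dot y z.
Proof. by rewrite dotDl dotNl. Qed.

Lemma dotZl a x z : dot (a *: x) z = a * dot x z.
Proof. by rewrite /dot -scalemxAl mxE. Qed.

Lemma dotBr x y z : dot z (x - y) = dot z x - dot z y.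
Proof. by rewrite dotC dotBl !(dotC z). Qed.

Lemma dot_ge0 x : 0 <= dot x x.
Proof. by rewrite dotE sumr_ge0// => j _; rewrite -expr2 sqr_ge0. Qed.

Lemma dot_eq0 x : (dot x x == 0) = (x == 0).
Proof.
apply/eqP/eqP => [|->]; last by rewrite /dot mul0mx mxE.
rewrite dotE => /eqP; rewrite psumr_eq0; last first.
  by move=> j _; rewrite -expr2 sqr_ge0.
move=> /allP h; apply/rowP => j; rewrite mxE.
by have := h j (mem_index_enum _); rewrite /= -expr2 sqrf_eq0 => /eqP.
Qed.

Lemma enorm_sqr x : enorm x ^+ 2 = dot x x.
Proof. by rewrite sqr_sqrtr// dot_ge0. Qed.

Lemma sphereP x : sphere x <-> dot x x = 1.
Proof.
rewrite /sphere /= -enorm_sqr; split => [->|]; first by rewrite expr1n.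
by move/eqP; rewrite sqrf_eq1 => /orP[/eqP//|/eqP e]; have := sqrtr_ge0 (dot x x);
  rewrite -/(enorm x) e lerNr oppr0 ler10.
Qed.

(** The reflection in the hyperplane orthogonal to [z]; it degenerates to the identity for
    [z = 0]. *)
Definition householder z : 'M[R]_n := 1%:M - (2 / dot z z) *: (z^T *m z).

Lemma mul_householder z x :
  x *m householder z = x - (2 / dot z z * dot x z) *: z.
Proof.
rewrite /householder mulmxBr mulmx1 -scalemxAr mulmxA dot_scalar mul_scalar_mx.
by rewrite scalerA.
Qed.

Lemma tr_householder z : (householder z)^T = householder z.
Proof.
by rewrite /householder linearB /= trmx1 linearZ /= trmx_mul trmxK.
Qed.

Lemma householderK z : householder z *m householder z = 1%:M.
Proof.
apply/row_matrixP => i; rewrite row_mul.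
have -> : row i (householder z) = row i 1%:M *m householder z.
  by rewrite -row_mul mul1mx.
set x := row i 1%:M; rewrite !mul_householder.
have [->|z0] := eqVneq z 0; first by rewrite !scaler0 !subr0.
have d0 : dot z z != 0 by rewrite dot_eq0.
rewrite dotBl dotZl -addrA -opprD -scalerDl -mulrDr.
set c := (X in X *: z); have -> : c = 0 by rewrite /c; field.
by rewrite scale0r subr0.
Qed.

(** Factoring one block matrix as lower times upper and as upper times lower triangular gives det(1
    - a z) = 1 - z a, and here z a = 2. *)
Lemma det_householder z : z != 0 -> \det (householder z) = -1.
Proof.
move=> z0; rewrite /householder scalemxAl.
set a := (2 / dot z z) *: z^T.
have e1 : block_mx (1%:M : 'M[R]_1) z a (1%:M : 'M[R]_n)
  = block_mx 1%:M 0 a 1%:M *m block_mx 1%:M z 0 (1%:M - a *m z).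
  by rewrite mulmx_block !mul1mx !mul0mx !mulmx1 !addr0 addrC subrK.
have e2 : block_mx (1%:M : 'M[R]_1) z a (1%:M : 'M[R]_n)
  = block_mx (1%:M - z *m a) z 0 1%:M *m block_mx 1%:M 0 a 1%:M.
  by rewrite mulmx_block !mul1mx !mul0mx !mulmx1 ?mulmx0 !add0r subrK.
have := congr1 (@determinant _ _) e1; rewrite {1}e2 !det_mulmx.
rewrite !det_ublock !det_lblock !det1 !mul1r !mulr1 => <-.
rewrite /a -scalemxAr dot_scalar det_mx11 !mxE eqxx !mulr1n mulfVK ?dot_eq0//.
lra.
Qed.

(* Row by row: the reflection exchanging the j-th rows fixes all previous rows,
   because the two Gram matrices agree. *)
Lemma gram_orthogonal m (A B : 'M[R]_(m, n)) : A *m A^T = B *m B^T ->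
  exists eta : 'M[R]_n, eta *m eta^T = 1%:M /\ A *m eta^T = B.
Proof.
move=> AB.
have gram (C : 'M[R]_(m, n)) i j : (C *m C^T) i j = dot (row i C) (row j C).
  by rewrite dotE mxE; apply: eq_bigr => k _; rewrite !mxE.
suff [eta [e1 e2]] : exists eta : 'M[R]_n, eta *m eta^T = 1%:M /\
    forall j : 'I_m, (j < m)%N -> row j (A *m eta^T) = row j B.
  by exists eta; split=> //; apply/row_matrixP => j; exact: e2.
suff : forall k, (k <= m)%N -> exists eta : 'M[R]_n, eta *m eta^T = 1%:M /\
    forall j : 'I_m, (j < k)%N -> row j (A *m eta^T) = row j B.
  by apply.
elim=> [_|k IH km]; first by exists 1%:M; rewrite trmx1 mulmx1.
have [eta [e1 e2]] := IH (ltnW km).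
pose i := Ordinal km; pose C := A *m eta^T.
have CB : C *m C^T = B *m B^T.
  by rewrite /C trmx_mul trmxK mulmxA -(mulmxA A) (mulmx1C e1) mulmx1.
pose v := row i C; pose w := row i B; pose z := v - w.
have vw : dot v v = dot w w by rewrite -!gram CB.
exists (householder z *m eta); split.
  by rewrite trmx_mul mulmxA -(mulmxA _ eta) e1 mulmx1 tr_householder householderK.
move=> j; rewrite trmx_mul tr_householder mulmxA row_mul -/C ltnS leq_eqVlt.
rewrite mul_householder => /orP[/eqP ji|jk].
  have -> : j = i by apply: val_inj.
  rewrite -/v -/w; have [/subr0_eq vw0|z0] := eqVneq z 0.
    by rewrite /z vw0 subrr scaler0 subr0.
  have d0 : dot z z != 0 by rewrite dot_eq0.
  (* Since v and w have equal length, [dot z z] is twice [dot v z], so the reflection sends v to v -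
     z = w. *)
  have -> : 2 / dot z z * dot v z = 1.
    apply: (mulfI d0); rewrite mulr1 mulrA mulrCA divff// mulr1.
    by rewrite /z !dotBl !dotBr vw (dotC v w); ring.
  by rewrite scale1r /z opprB addrC subrK.
rewrite e2//; have -> : dot (row j B) z = 0.
  by rewrite /z dotBr -[X in dot X v]e2// -!gram CB subrr.
by rewrite mulr0 scale0r subr0.
Qed.

Lemma exists_unit_orth m (B : 'M[R]_(m, n)) : (m < n)%N ->
  exists z, sphere z /\ B *m z^T = 0.
Proof.
move=> mn.
have : kermx B^T != 0.
  rewrite -mxrank_eq0 -lt0n mxrank_ker subn_gt0.
  by apply: leq_ltn_trans mn; rewrite mxrank_tr rank_leq_row.
move/rowV0Pn => [z /sub_kermxP zB z0].
have e0 : enorm z != 0.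
  by rewrite -sqrf_eq0 enorm_sqr dot_eq0.
exists ((enorm z)^-1 *: z); split.
  by rewrite /sphere /= enormZ ger0_norm ?invr_ge0 ?sqrtr_ge0// mulVf.
by rewrite linearZ -scalemxAr -[B *m _]trmxK trmx_mul trmxK zB trmx0 scaler0.
Qed.

(** If the orthogonal map has determinant -1, compose it with the reflection in a unit vector
    orthogonal to the rows of [B]: those rows stay fixed. Such a vector exists because m < n. *)
Lemma gram_rotation m (A B : 'M[R]_(m, n)) : (m < n)%N ->
  A *m A^T = B *m B^T -> exists eta : 'M[R]_n, SO eta /\ A *m eta^T = B.
Proof.
move=> mn /gram_orthogonal[eta [e1 e2]].
have : \det eta ^+ 2 == 1.
  by rewrite expr2 -{2}det_tr -det_mulmx e1 det1.
rewrite sqrf_eq1 => /orP[|] /eqP de; first by exists eta.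
have [z [/sphere_neq0 zS Bz]] := exists_unit_orth B mn.
exists (householder z *m eta); split; [split|].
- by rewrite trmx_mul mulmxA -(mulmxA _ eta) e1 mulmx1 tr_householder householderK.
- by rewrite det_mulmx de det_householder// mulrNN mulr1.
rewrite trmx_mul mulmxA e2 tr_householder /householder mulmxBr mulmx1.
by rewrite -scalemxAr mulmxA Bz mul0mx scaler0 subr0.
Qed.

Lemma SO1 : SO (1%:M : 'M[R]_n).
Proof. by split; rewrite ?trmx1 ?mulmx1 ?det1. Qed.

Lemma SOM (a b : 'M[R]_n) : SO a -> SO b -> SO (a *m b).
Proof.
move=> [a1 a2] [b1 b2]; split; last by rewrite det_mulmx a2 b2 mulr1.
by rewrite trmx_mul mulmxA -(mulmxA a) b1 mulmx1.
Qed.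

Lemma SOV (a : 'M[R]_n) : SO a -> SO a^T.
Proof. by move=> [/mulmx1C a1 a2]; split; rewrite ?trmxK ?det_tr. Qed.

Lemma rotateM (a b : 'M[R]_n) x : rotate (a *m b) x = rotate a (rotate b x).
Proof. by rewrite /rotate trmx_mul mulmxA. Qed.

Lemma rotate1 x : rotate 1%:M x = x.
Proof. by rewrite /rotate trmx1 mulmx1. Qed.

Lemma rotateK (a : 'M[R]_n) x : SO a -> rotate a^T (rotate a x) = x.
Proof. by move=> [/mulmx1C a1 _]; rewrite -rotateM a1 rotate1. Qed.

Lemma rotateVK (a : 'M[R]_n) x : SO a -> rotate a (rotate a^T x) = x.
Proof. by move=> [a1 _]; rewrite -rotateM a1 rotate1. Qed.

Lemma dot_rotate (a : 'M[R]_n) x y : SO a -> dot (rotate a x) (rotate a y) = dot x y.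
Proof.
move=> [/mulmx1C a1 _].
by rewrite /dot /rotate trmx_mul trmxK mulmxA -(mulmxA x) a1 mulmx1.
Qed.

Lemma rotate_sphere (a : 'M[R]_n) x : SO a -> sphere x -> sphere (rotate a x).
Proof. by move=> aS xS; apply/rot_sphere. Qed.

Lemma gram2 x y : col_mx x y *m (col_mx x y)^T =
  block_mx (dot x x)%:M (dot x y)%:M (dot y x)%:M (dot y y)%:M.
Proof. by rewrite tr_col_mx mul_col_row !dot_scalar. Qed.

(** The case of two rows; the spare direction needed for the determinant is where n >= 3 is used. *)
Lemma rotation_pair x y x' y' : (2 < n)%N -> dot x x = dot x' x' ->
  dot x y = dot x' y' -> dot y y = dot y' y' ->
  exists eta : 'M[R]_n, [/\ SO eta, rotate eta x = x' & rotate eta y = y'].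
Proof.
move=> n3 xx xy yy.
have [|eta [eS]] := @gram_rotation (1 + 1) (col_mx x y) (col_mx x' y') n3.
  by rewrite !gram2 xx xy yy (dotC y) xy (dotC y').
by rewrite mul_col_mx => /eq_col_mx[? ?]; exists eta.
Qed.

Lemma rotation_swap x y : (2 < n)%N -> sphere x -> sphere y ->
  exists eta : 'M[R]_n, [/\ SO eta, rotate eta x = y & rotate eta y = x].
Proof.
move=> n3 /sphereP xS /sphereP yS.
by apply: rotation_pair => //; rewrite ?xS ?yS// dotC.
Qed.

End Rotations.

(** * Averages over finite sets of rotations *)

Section MatrixNorm.
Variable R : realType.

Lemma mx_normP m n (A : 'M[R]_(m, n)) (c : R) :
  0 <= c -> (forall i j, `|A i j| <= c) -> `|A| <= c.
Proof.
move=> c0 h; rewrite [leLHS]/Num.norm /= mx_normrE; apply/bigmax_leP.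
by split=> // -[i j] _; exact: h.
Qed.

Lemma le_mx_norm m n (A : 'M[R]_(m, n)) i j : `|A i j| <= `|A|.
Proof.
rewrite [leRHS]/Num.norm /= mx_normrE.
by apply/bigmax_geP; right; exists (i, j).
Qed.

(** The sup norm is submultiplicative only up to the inner dimension; the factors [n] and [n.+1] in
    later moduli of continuity come from here. *)
Lemma mulmx_norm m n p (A : 'M[R]_(m, n)) (B : 'M[R]_(n, p)) :
  `|A *m B| <= n%:R * `|A| * `|B|.
Proof.
apply: mx_normP => [|i j]; first by rewrite !mulr_ge0.
rewrite mxE (le_trans (ler_norm_sum _ _ _))//.
rewrite -mulrA mulr_natl -[X in _ *+ X]card_ord -sumr_const.
by apply: ler_sum => k _; rewrite normrM ler_pM ?le_mx_norm.
Qed.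

Lemma dot_norm n (x y : 'rV[R]_n) : `|dot x y| <= n%:R * `|x| * `|y|.
Proof.
apply: le_trans (le_trans (le_mx_norm _ _ _) (mulmx_norm x y^T)) _.
rewrite ler_wpM2l ?mulr_ge0//; apply: mx_normP => // i j.
by rewrite mxE le_mx_norm.
Qed.

Lemma norm_le_enorm n (x : 'rV[R]_n) : `|x| <= enorm x.
Proof.
apply: mx_normP => [|i j]; first exact: sqrtr_ge0.
rewrite -ler_sqr ?nnegrE ?sqrtr_ge0// enorm_sqr dotE real_normK ?num_real// ?ord1.
rewrite (bigD1 j)//= -expr2 lerDl sumr_ge0// => k _.
by rewrite -expr2 sqr_ge0.
Qed.

Lemma enorm_le_norm n (x : 'rV[R]_n) : enorm x <= n%:R * `|x|.
Proof.
rewrite -ler_sqr ?nnegrE ?sqrtr_ge0 ?mulr_ge0// enorm_sqr.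
apply: le_trans (ler_norm _) (le_trans (dot_norm _ _) _).
rewrite exprMn -mulrA -expr2 ler_wpM2r ?sqr_ge0//.
by case: n {x} => [|n]; rewrite ?expr0n//= expr2 ler_peMl// ler1n.
Qed.

Lemma sphere_norm n (u : 'rV[R]_n) : sphere u -> `|u| <= 1.
Proof. by move=> uS; rewrite (le_trans (norm_le_enorm u))// uS. Qed.

Lemma SO_norm n (g : 'M[R]_n) : SO g -> `|g| <= 1.
Proof.
move=> [gg _]; apply: mx_normP => // i j.
have : dot (row i g) (row i g) = 1.
  have := congr1 (fun M : 'M[R]_n => M i i) gg; rewrite !mxE eqxx /= mulr1n => <-.
  by rewrite dotE; apply: eq_bigr => k _; rewrite !mxE.
move/sphereP/sphere_norm; apply: le_trans.
by have := le_mx_norm (row i g) 0 j; rewrite mxE.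
Qed.

Lemma SO_mul_norm n m (g : 'M[R]_n) (x : 'M[R]_(n, m)) : SO g ->
  `|g *m x| <= n%:R * `|x|.
Proof.
move=> /SO_norm g1; rewrite (le_trans (mulmx_norm _ _))// ler_wpM2r//.
by rewrite ler_piMr.
Qed.

Lemma SO_mulr_norm n m (g : 'M[R]_n) (x : 'M[R]_(m, n)) : SO g ->
  `|x *m g| <= n%:R * `|x|.
Proof.
move=> /SO_norm g1; rewrite (le_trans (mulmx_norm _ _))//.
by rewrite ler_piMr// mulr_ge0.
Qed.

Lemma rotate_dist n (g h : 'M[R]_n) x : sphere x ->
  `|rotate g x - rotate h x| <= n%:R * `|g - h|.
Proof.
move=> /sphere_norm x1; rewrite /rotate -mulmxBr -linearB/=.
rewrite (le_trans (mulmx_norm _ _))// -mulrA ler_wpM2l//.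
rewrite -[leRHS]mul1r ler_pM//; apply: mx_normP => // i j.
by rewrite mxE le_mx_norm.
Qed.

(** Heine-Borel is transported from row vectors: [vec_mx] does not increase the sup norm, so [A] is
    a continuous image of a closed bounded set of vectors. *)
Lemma compact_mx m n (A : set 'M[R]_(m, n)) : bounded_set A -> closed A -> compact A.
Proof.
move=> bA cA.
have nv (v : 'rV[R]_(m * n)) : `|vec_mx v| <= `|v|.
  apply: mx_normP => // i j; rewrite mxE; exact: le_mx_norm.
have cv : continuous (@vec_mx R m n).
  apply: (@bounded_linear_continuous R _ _
    (@vec_mx R m n : {linear 'rV[R]_(m * n) -> 'M[R]_(m, n)})).
  apply/linear_boundedP; exists 1; split=> // r r1 v.
  by rewrite (le_trans (nv v))// ler_peMl// ltW.
have -> : A = @vec_mx R m n @` [set v | A (vec_mx v)].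
  apply/seteqP; split=> [M AM|_ [v Av <-]//].
  by exists (mxvec M); rewrite /= mxvecK.
apply: continuous_compact; first exact: continuous_subspaceT.
apply: bounded_closed_compact; last first.
  by apply: (preimage_closed _ cA) => v _; exact: cv.
have [M [Mr AM]] := bA.
exists M; split=> // r Mr' v /= Av; apply: le_trans (AM r Mr' _ Av).
apply: mx_normP => // i j; rewrite ord1 -{1}[v]vec_mxK.
by case/mxvec_indexP: j => i' j'; rewrite mxvecE le_mx_norm.
Qed.

Lemma SO_compact n : compact (@SO R n).
Proof.
apply: compact_mx.
  exists 1; split=> // r r1 g gS; exact: le_trans (SO_norm gS) (ltW r1).
have -> : @SO R n = \bigcap_(p in [set: 'I_n * 'I_n])
     [set g : 'M[R]_n | \sum_k g p.1 k * g p.2 k = (1%:M : 'M[R]_n) p.1 p.2] `&`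
     [set g : 'M[R]_n | \det g = 1].
  apply/seteqP; split=> g.
    move=> [g1 g2]; split => // -[i j] _ /=; rewrite -g1 mxE.
    by apply: eq_bigr => k _; rewrite mxE.
  move=> [g1 g2]; split=> //; apply/matrixP => i j; rewrite mxE.
  rewrite -(g1 (i, j))//=.
  by apply: eq_bigr => k _; rewrite mxE.
have ccst (c : R) : closed [set x : R | x = c] by exact: closed_eq.
apply: closedI.
  apply: closed_bigI => -[i j] _ /=.
  apply: (@preimage_closed _ _ (fun g : 'M[R]_n => \sum_k g i k * g j k) [set x | x = _]) => //.
  move=> g _; apply: continuous_big => [|k _]; first exact: add_continuous.
  move=> x; apply: cvgM; first exact: nbhs_filter.
  - exact: coord_continuous.
  - exact: coord_continuous.
apply: (@preimage_closed _ _ (fun g : 'M[R]_n => \det g) [set x | x = _]) => //.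
move=> g _; apply: continuous_big => [|s _]; first exact: add_continuous.
move=> x.
have hx : (fun g : 'M[R]_n => \prod_i g i (perm.fun_of_perm s i)) g @[g --> x] -->
    \prod_i x i (perm.fun_of_perm s i).
  move: x; apply: continuous_big => [|k _]; first exact: mul_continuous.
  exact: coord_continuous.
exact: (cvgM (cvg_cst _) hx).
Qed.

End MatrixNorm.

(** * Finite nets and averages over groups of rotations *)

Section Averages.
Variables (R : realType) (n : nat).
Implicit Types (H : set 'M[R]_n) (s : seq 'M[R]_n).

(** Lists count with multiplicity, so averaging over all products of two lists iterates the two
    averages. The empty list averages to 0, whence the size hypotheses below. *)
Definition avg T (s : seq T) (f : T -> R) : R :=
  (size s)%:R^-1 * \sum_(g <- s) f g.

Lemma avgD T (s : seq T) (f h : T -> R) :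
  avg s (fun x => f x + h x) = avg s f + avg s h.
Proof. by rewrite /avg big_split mulrDr. Qed.

Lemma avgB T (s : seq T) (f h : T -> R) :
  avg s (fun x => f x - h x) = avg s f - avg s h.
Proof. by rewrite /avg sumrB mulrBr. Qed.

Lemma avgZ T (s : seq T) c (f : T -> R) :
  avg s (fun x => c * f x) = c * avg s f.
Proof. by rewrite /avg -mulr_sumr mulrCA. Qed.

Lemma avg_cst T (s : seq T) c : (0 < size s)%N -> avg s (fun=> c) = c.
Proof.
move=> s0; rewrite /avg big_const_seq count_predT iter_addr addr0.
by rewrite -[X in _ * X]mulr_natl mulrA mulVf ?mul1r// pnatr_eq0 -lt0n.
Qed.

Lemma ler_avg (T : eqType) (s : seq T) (f h : T -> R) :
  (forall g, g \in s -> f g <= h g) -> avg s f <= avg s h.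
Proof.
move=> fh; rewrite /avg ler_wpM2l ?invr_ge0// big_seq [leRHS]big_seq.
exact: ler_sum.
Qed.

Lemma eq_avg (T : eqType) (s : seq T) (f h : T -> R) :
  (forall g, g \in s -> f g = h g) -> avg s f = avg s h.
Proof. by move=> fh; rewrite /avg big_seq [in RHS]big_seq; congr *%R; apply: eq_bigr. Qed.

Lemma ler_norm_avg (T : eqType) (s : seq T) (f : T -> R) :
  `|avg s f| <= avg s (fun g => `|f g|).
Proof.
rewrite /avg normrM ger0_norm ?invr_ge0//.
by rewrite ler_wpM2l ?invr_ge0// ler_norm_sum.
Qed.

Lemma avg_dist (T : eqType) (s : seq T) (f h : T -> R) e : (0 < size s)%N ->
  (forall g, g \in s -> `|f g - h g| <= e) -> `|avg s f - avg s h| <= e.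
Proof.
move=> s0 fh; rewrite -avgB (le_trans (ler_norm_avg _ _))//.
by rewrite -[leRHS](avg_cst e s0); exact: ler_avg.
Qed.

Lemma avg_allpairs (T1 T2 : Type) T (m : T1 -> T2 -> T) (s : seq T1) (t : seq T2) (f : T -> R) :
  avg [seq m x y | x <- s, y <- t] f = avg s (fun x => avg t (fun y => f (m x y))).
Proof.
rewrite /avg size_allpairs natrM invfM -mulrA; congr *%R.
by rewrite big_allpairs_dep mulr_sumr; apply: eq_bigr.
Qed.

Lemma exchange_avg (T1 T2 : Type) (s : seq T1) (t : seq T2) (f : T1 -> T2 -> R) :
  avg s (fun x => avg t (f x)) = avg t (fun y => avg s (f ^~ y)).
Proof.
by rewrite /avg -!mulr_sumr exchange_big/= mulrCA.
Qed.

Definition rot_subgroup H : Prop :=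
  [/\ H `<=` @SO R n, H 1%:M, (forall a b, H a -> H b -> H (a *m b)) &
      (forall a, H a -> H a^T)].

Lemma SO_subgroup : rot_subgroup (@SO R n).
Proof. by split=> //; [exact: SO1|exact: SOM|exact: SOV]. Qed.

Lemma stab_subgroup (e : 'rV[R]_n) :
  rot_subgroup [set g | SO g /\ rotate g e = e].
Proof.
split=> /=; first by move=> g [].
- by split; [exact: SO1|rewrite rotate1].
- move=> a b [aS ae] [bS be]; split; first exact: SOM.
  by rewrite rotateM be ae.
- by move=> a [aS ae]; split; [exact: SOV|rewrite -{1}ae rotateK].
Qed.

(** The net must lie in H, which is not assumed closed. Cover the compact rotation group by balls of
    radius d / 2 and replace each centre by a point of H in its ball, or by the identity if there is
    none. *)
Lemma rot_net H d : H `<=` @SO R n -> H 1%:M -> 0 < d ->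
  exists s, (forall g, g \in s -> H g) /\
    forall x, H x -> exists2 g, g \in s & `|g - x| < d.
Proof.
move=> HS H1 d0; have d2 : 0 < d / 2 by rewrite divr_gt0.
have := SO_compact (R := R) (n := n); rewrite compact_cover.
move=> /(_ 'M[R]_n (@SO R n) (fun c => ball c (d / 2))).
case=> [c _|c cS|D DS cov]; first exact: ball_open.
  by exists c => //; exact: ballxx.
pose pk (c : 'M[R]_n) := xget 1%:M [set h | H h /\ `|c - h| < d / 2].
have pkP c h : H h -> `|c - h| < d / 2 -> H (pk c) /\ `|c - pk c| < d / 2.
  move=> Hh ch; exact: (xgetPex (P := [set h | H h /\ `|c - h| < d / 2]) 1%:M
    (ex_intro _ h (conj Hh ch))).
exists [seq pk c | c <- finmap.enum_fset D]; split.
  move=> g /mapP[c _ ->]; rewrite /pk; case: xgetP => [h _ []//|_]; exact: H1.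
move=> x Hx; have [c /= cD] := cov x (HS _ Hx).
rewrite -ball_normE /= => cx; exists (pk c); first by apply/mapP; exists c.
have [_ cp] := pkP _ _ Hx cx.
rewrite (_ : pk c - x = (c - x) - (c - pk c)); last by rewrite opprB [RHS]addrC subrKA.
rewrite (le_lt_trans (ler_normB _ _))// (splitr d).
by rewrite ltrD.
Qed.

(** A single modulus serves all indices [t], so one list of rotations can later serve a whole
    family. *)
Definition equicont H T (phi : T -> 'M[R]_n -> R) : Prop :=
  forall e, 0 < e -> exists2 d, 0 < d &
    forall t x y, H x -> H y -> `|x - y| < d -> `|phi t x - phi t y| <= e.

Lemma seq_argmin (T : eqType) (s : seq T) (f : T -> R) : (0 < size s)%N ->
  exists2 z, z \in s & forall z', z' \in s -> f z <= f z'.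
Proof.
elim: s => // a [|b s] IH _.
  by exists a; rewrite ?inE// => z'; rewrite inE => /eqP->.
have [//|z zs zmin] := IH.
have [za|/ltW az] := leP (f z) (f a).
  exists z; first by rewrite inE zs orbT.
  by move=> z'; rewrite inE => /predU1P[->//|]; exact: zmin.
exists a; first by rewrite inE eqxx.
move=> z'; rewrite inE => /predU1P[->//|/zmin]; exact: le_trans.
Qed.

(* Averaging over a fixed net of H contracts the oscillation: for any x, some
   net element moves x close to the point where f is almost minimal. *)
Lemma averaging H T (phi : T -> 'M[R]_n -> R) B e : rot_subgroup H ->
  equicont H phi -> (forall t x, H x -> `|phi t x| <= B) -> 0 < e ->
  exists s, [/\ (0 < size s)%N, (forall g, g \in s -> H g) &
    forall t x y, H x -> H y ->
    `|avg s (fun g => phi t (g *m x)) - avg s (fun g => phi t (g *m y))| <= e].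
Proof.
move=> [HS H1 HM HV] ephi bphi e0.
have e4 : 0 < e / 4 by rewrite divr_gt0.
have [d d0 hd] := ephi _ e4.
pose C : R := n.+1%:R; have C0 : 0 < C by rewrite ltr0n.
have C1 : 1 <= C by rewrite ler1n.
have nC : n%:R <= C by rewrite ler_nat.
(* This modulus is required after left translation by any element of H, so that averaged functions
   inherit it; [C] pays for the sup norm distortion of one multiplication. *)
pose md (f : 'M[R]_n -> R) := forall x y g, H x -> H y -> H g -> `|x - y| < d / C ->
  `|f (g *m x) - f (g *m y)| <= e / 4.
have dC2 : 0 < d / C / C by rewrite !divr_gt0 ?ltr_wpDl.
have [N [NH Nnet]] := rot_net HS H1 dC2.
have N0 : (0 < size N)%N by have [g] := Nnet _ H1; case: (N).
(* Among the |N| terms of an average, one is controlled by e / 2 and the others by the old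
   oscillation: the excess over e / 2 shrinks by the factor q. *)
pose q : R := 1 - (size N)%:R^-1.
have q0 : 0 <= q by rewrite subr_ge0 invf_le1 ?ltr0n// ler1n.
have q1 : q < 1 by rewrite ltrBlDr ltrDl invr_gt0 ltr0n.
have step f w : md f -> (forall x y, H x -> H y -> f x - f y <= w) ->
    forall x y, H x -> H y ->
    avg N (fun g => f (g *m x)) - avg N (fun g => f (g *m y)) <=
      (1 - q) * (e / 2) + q * w.
  move=> mf fw x y Hx Hy.
  have [z zN zmin] := seq_argmin f N0.
  (* [g0] moves x close to the minimizer z, whereas f at g0 y cannot lie much below f z because g0 y
     is close to some net point. *)
  have [g0 g0N g0z] := Nnet (z *m x^T) (HM _ _ (NH _ zN) (HV _ Hx)).
  have fg0 : f (g0 *m x) - f (g0 *m y) <= e / 2.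
    have h1 : `|f (1%:M *m (g0 *m x)) - f (1%:M *m z)| <= e / 4.
      apply: mf => //; [by apply: HM => //; exact: NH|exact: NH|].
      have -> : g0 *m x - z = (g0 - z *m x^T) *m x.
        by rewrite mulmxBl -mulmxA (mulmx1C (HS _ Hx).1) mulmx1.
      apply: le_lt_trans (SO_mulr_norm _ (HS _ Hx)) _.
      apply: (le_lt_trans (ler_wpM2r (normr_ge0 _) nC)).
      by rewrite -ltr_pdivlMl// mulrC.
    have Hgy : H (g0 *m y) by apply: HM => //; exact: NH.
    have [z' z'N z'y] := Nnet _ Hgy.
    have h2 : `|f (1%:M *m z') - f (1%:M *m (g0 *m y))| <= e / 4.
      apply: mf => //; first exact: NH.
      apply: lt_le_trans z'y _; rewrite ler_pdivrMr// ler_peMr//.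
      by rewrite divr_ge0// ltW.
    move: h1 h2; rewrite !mul1mx !ler_norml => /andP[_ h1] /andP[_ h2].
    by have := zmin _ z'N; lra.
  rewrite -avgB /avg (perm_big _ (perm_to_rem g0N)) big_cons /=.
  have s0 : 0 < (size N)%:R :> R by rewrite ltr0n.
  rewrite ler_pdivrMl//.
  have -> : (size N)%:R * ((1 - q) * (e / 2) + q * w) = e / 2 + (size N).-1%:R * w.
    rewrite -[(size N).-1]subn1 natrB// /q; field; exact: lt0r_neq0.
  rewrite lerD// -(size_rem g0N) mulr_natl -[X in _ *+ X]count_predT.
  rewrite -[leRHS]addr0 -iter_addr -big_const_seq big_seq [leRHS]big_seq.
  by apply: ler_sum => g /mem_rem gN; apply: fw; apply: HM => //; exact: NH.
have main k : exists s, [/\ (0 < size s)%N, (forall g, g \in s -> H g) &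
    forall t x y, H x -> H y ->
    avg s (fun g => phi t (g *m x)) - avg s (fun g => phi t (g *m y))
      <= e / 2 + q ^+ k * (B + B)].
  elim: k => [|k [s [s0 sH IH]]].
    exists [:: 1%:M]; split=> // [g|t x y Hx Hy].
      by rewrite inE => /eqP->.
    rewrite /avg/= !big_seq1 !mul1mx invr1 !mul1r.
    have := bphi t _ Hx; have := bphi t _ Hy.
    rewrite !ler_norml => /andP[? ?] /andP[? ?]; lra.
  (* With the factors in this order the new average is the average over [N] of the function already
     averaged over [s], to which [step] applies. *)
  exists [seq h *m g | g <- N, h <- s]; split.
  - by rewrite size_allpairs muln_gt0 N0.
  - by move=> _ /allpairsP[[g h]/= [gN hs ->]]; apply: HM; [exact: sH|exact: NH].
  move=> t x y Hx Hy; rewrite !avg_allpairs.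
  pose F z := avg s (fun h => phi t (h *m z)).
  have mF : md F.
    move=> x' y' g Hx' Hy' Hg xy; rewrite /F; apply: avg_dist => // h hs.
    have Hh := sH _ hs.
    apply: hd; [exact: (HM _ _ Hh (HM _ _ Hg Hx'))|exact: (HM _ _ Hh (HM _ _ Hg Hy'))|].
    rewrite -!mulmxBr mulmxA.
    apply: le_lt_trans (SO_mul_norm _ (HS _ (HM _ _ Hh Hg))) _.
    apply: (le_lt_trans (ler_wpM2r (normr_ge0 _) nC)).
    by rewrite -ltr_pdivlMl// mulrC.
  have := step F _ mF (IH t) x y Hx Hy.
  rewrite /F; under eq_avg do under eq_avg do rewrite mulmxA.
  under [X in _ - X <= _]eq_avg do under eq_avg do rewrite mulmxA.
  move=> /le_trans; apply.
  by rewrite exprS le_eqVlt; apply/orP; left; apply/eqP; field.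
have /cvgrPdist_lt /(_ (e / 2 / (`|B + B| + 1))) : q ^+ k @[k --> \oo] --> (0 : R).
  by apply: cvg_expr; rewrite ger0_norm.
have b0 : 0 < `|B + B| + 1 by rewrite ltr_wpDl.
case; first by rewrite !divr_gt0.
move=> k _ hk.
have [s [s0 sH hs]] := main k; exists s; split=> // t x y Hx Hy.
have qB : q ^+ k * (B + B) <= e / 2.
  have := hk k (leqnn k); rewrite sub0r normrN ltr_pdivlMr// => h.
  apply: le_trans (ler_norm _) (le_trans _ (ltW h)).
  by rewrite normrM ler_wpM2l// lerDl.
rewrite ler_norml lerNl opprB; have := hs t x y Hx Hy; have := hs t y x Hy Hx.
by move=> *; apply/andP; split; lra.
Qed.

End Averages.

(** * Lebesgue measure on row vectors *)

Section BorelMatrices.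
Variable R : realType.

Lemma measurable_coord m n i j :
  measurable_fun setT (fun A : borel_mx R m n => (A : 'M[R]_(m, n)) i j).
Proof.
apply: (measurability _ (RGenOpens.measurableE R)).
move=> _ [_ [a [b ->] <-]]; rewrite setTI; apply: sub_sigma_algebra.
apply: (@open_comp _ _ (fun A : 'M[R]_(m, n) => A i j)) => //.
by move=> A _; exact: coord_continuous.
Qed.

(** An open set of matrices is the union of the rational boxes contained in it. There are countably
    many of them, and the preimage of a box is a finite intersection of conditions on entries. *)
Lemma measurable_mx d (T : measurableType d) m n (f : T -> borel_mx R m n) :
  (forall i j, measurable_fun setT (fun t => (f t : 'M[R]_(m, n)) i j)) ->
  measurable_fun setT f.
Proof.
move=> mf; apply: measurability; first by [].
move=> _ [U oU <-]; rewrite setTI.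
pose box (p : 'M[rat]_(m, n) * nat) : set 'M[R]_(m, n) :=
  [set A | forall i j, `|A i j - ratr (p.1 i j)| < p.2.+1%:R^-1].
have -> : f @^-1` U = \bigcup_(p : 'M[rat]_(m, n) * nat)
    (if `[< box p `<=` U >] then f @^-1` box p else set0).
  apply/seteqP; split=> [t Ut|t [p _]]; last first.
    by case: asboolP => // pU /pU.
  have /nbhs_ballP[e /= e0 eU] : nbhs (f t : 'M[R]_(m, n)) U.
    exact: open_nbhs_nbhs.
  pose k := Num.bound (2 / e).
  have hk : k.+1%:R^-1 < e / 2.
    rewrite -[e / 2]invrK ltf_pV2 ?posrE ?invr_gt0 ?divr_gt0// invf_div.
    have : 2 / e < k%:R by rewrite archi_boundP// divr_ge0// ltW.
    by move=> /lt_trans; apply; rewrite ltr_nat.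
  have r i j : exists q : rat, `|(f t : 'M[R]_(m, n)) i j - ratr q| < k.+1%:R^-1.
    have : (f t : 'M[R]_(m, n)) i j - k.+1%:R^-1 < (f t : 'M[R]_(m, n)) i j + k.+1%:R^-1.
      by rewrite ltrD2l gtrN.
    move/rat_in_itvoo => [q]; rewrite in_itv/= => /andP[q1 q2].
    by exists q; rewrite ltr_distlC q1 q2.
  pose g i := projT1 (choice (r i)); have gP i := projT2 (choice (r i)).
  exists (\matrix_(i, j) g i j, k) => //.
  rewrite asboolT; first by move=> i j; rewrite mxE; exact: gP.
  move=> B hB; apply: eU; rewrite -ball_normE /=.
  apply: (@le_lt_trans _ _ (k.+1%:R^-1 + k.+1%:R^-1)); last first.
    by rewrite (splitr e) ltrD.
  apply: mx_normP => [|i j]; first by rewrite addr_ge0.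
  have := hB i j; have := gP i j; rewrite !mxE /= => h1 h2.
  rewrite (_ : _ - _ = ((f t : 'M[R]_(m, n)) i j - ratr (g i j)) - (B i j - ratr (g i j))).
    by rewrite (le_trans (ler_normB _ _))// lerD// ltW.
  ring.
apply: countable_bigcupT_measurable => [|p]; first exact: countableP.
case: asboolP => // _.
have -> : f @^-1` box p = \bigcap_(ij in [set: 'I_m * 'I_n])
    [set t | `|(f t : 'M[R]_(m, n)) ij.1 ij.2 - ratr (p.1 ij.1 ij.2)| < p.2.+1%:R^-1].
  apply/seteqP; split=> [t ft [i j] _|t ft i j]; first exact: ft.
  exact: (ft (i, j)).
apply: fin_bigcap_measurable => [|[i j] _ /=]; first exact: finite_finset.
rewrite -[X in measurable X]setTI.
apply: (@measurable_fun_ltr _ _ _ _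
  (fun t => `|(f t : 'M[R]_(m, n)) i j - ratr (p.1 i j)|)
  (fun=> p.2.+1%:R^-1)) => //.
apply: measurableT_comp; first exact: normr_measurable.
by apply: measurable_funB.
Qed.

Lemma measurable_dot d (T : measurableType d) n (f g : T -> borel_mx R 1 n) :
  measurable_fun setT f -> measurable_fun setT g ->
  measurable_fun setT (fun t => dot (f t : 'rV[R]_n) (g t : 'rV[R]_n)).
Proof.
move=> mf mg; under eq_fun do rewrite dotE.
apply: measurable_sum => j; apply: measurable_funM.
  exact: (measurableT_comp (@measurable_coord 1 n 0 j) mf).
exact: (measurableT_comp (@measurable_coord 1 n 0 j) mg).
Qed.

Lemma measurable_enorm n :
  measurable_fun setT (fun x : borel_mx R 1 n => enorm (x : 'rV[R]_n)).
Proof.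
apply: (@measurableT_comp _ _ _ _ _ _ (@Num.sqrt R)).
  by apply: continuous_measurable_fun; exact: sqrt_continuous.
by apply: measurable_dot; exact: measurable_id.
Qed.

End BorelMatrices.

Local Notation pushforward_measure :=
  measure_function_pushforward__canonical__measure_function_Measure.

(** An alias of [mu] that carries a proof of sigma-finiteness, so that product measures and Fubini
    can be applied to it. *)
Definition sigma_finite_copy d (T : measurableType d) (R : realType)
    (mu : {measure set T -> \bar R}) of sigma_finite setT mu : set T -> \bar R := mu.
HB.instance Definition _ d (T : measurableType d) (R : realType)
    (mu : {measure set T -> \bar R}) (sf : sigma_finite setT mu) :=
  Measure.copy (sigma_finite_copy sf) (Measure.sort mu).
HB.instance Definition _ d (T : measurableType d) (R : realType)
    (mu : {measure set T -> \bar R}) (sf : sigma_finite setT mu) :=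
  Measure_isSigmaFinite.Build _ _ _ (sigma_finite_copy sf) sf.

Section Volume.
Variable R : realType.

Definition box n (a : R) : set 'rV[R]_n := [set x | forall j, `|x 0 j| <= a].

Lemma vol_set0 n : vol (set0 : set 'rV[R]_n) = 0%E.
Proof.
by case: n => [|n] /=; rewrite ?indic0//; apply: integral0_eq => x _;
  elim: n => [|n IH] /=; rewrite ?indic0//; apply: integral0_eq.
Qed.

Lemma vol_box n (a : R) : 0 <= a -> vol (@box n a) = ((a *+ 2) ^+ n)%:E.
Proof.
move=> a0; elim: n => [|n IH] /=.
  by rewrite indicE mem_set// => -[].
pose D : set R := `[- a, a]%classic.
transitivity (\int[@lebesgue_measure R]_(x in D) ((a *+ 2) ^+ n)%:E)%E.
  rewrite [RHS]integral_mkcond; apply: eq_integral => x _ /=.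
  rewrite patchE mem_setE in_itv /= -ler_norml; case: ifPn => xa.
    rewrite -IH; congr vol; apply/seteqP; split=> y /= h j.
      by have := h (rshift 1 j); rewrite (row_mxEr x%:M y).
    rewrite -[j](@splitK 1 n); case: splitP => k _ /=.
      by rewrite (row_mxEl x%:M y) ord1 mxE eqxx.
    by rewrite (row_mxEr x%:M y).
  rewrite -[RHS](vol_set0 n); congr vol; rewrite -subset0 => y /= /(_ (lshift n (0 : 'I_1))).
  by rewrite (row_mxEl x%:M y) mxE eqxx; apply/negP.
rewrite integral_cst /=; last exact: measurable_itv.
rewrite lebesgue_measure_itv /= lte_fin exprSr EFinM.
case: ltP => h; first by rewrite -EFinB opprK mulr2n.
have -> : a = 0 by lra.
by rewrite mul0rn !mule0.
Qed.

Lemma box_measurable n a : measurable (@box n a : set (borel_mx R 1 n)).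
Proof.
have -> : @box n a = \bigcap_(j in [set: 'I_n]) [set x | `|x 0 j| <= a].
  by apply/seteqP; split=> x h j; [move=> _; exact: h|exact: (h j I)].
apply: fin_bigcap_measurable => [|j _]; first exact: finite_finset.
rewrite -[X in measurable X]setTI.
apply: (@measurable_fun_ler _ _ _ _ (fun x : borel_mx R 1 n => `|(x : 'rV[R]_n) 0 j|) (fun=> a)) => //.
apply: measurableT_comp; first exact: normr_measurable.
exact: measurable_coord.
Qed.

Lemma box_cover n : [set: 'rV[R]_n] = \bigcup_k box k%:R.
Proof.
apply/seteqP; split=> // x _.
exists (Num.bound `|x|) => // j; apply: le_trans (le_mx_norm x 0 j) _.
exact/ltW/archi_boundP.
Qed.

Lemma measurable_row_mx n : measurable_fun setT
  (fun p : measurableTypeR R * borel_mx R 1 n => row_mx p.1%:M p.2 : borel_mx R 1 n.+1).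
Proof.
apply: measurable_mx => i j; rewrite ord1 -[j](@splitK 1 n).
case: splitP => k _ /=.
  rewrite (_ : (fun _ => _) = fst); first exact: measurable_fst.
  by apply/funext => p; rewrite (row_mxEl p.1%:M (p.2 : 'rV_n)) ord1 mxE eqxx.
rewrite (_ : (fun _ => _) = fun p => (p.2 : 'rV[R]_n) 0 k).
  exact: (measurableT_comp (@measurable_coord R 1 n 0 k) measurable_snd).
by apply/funext => p; rewrite (row_mxEr p.1%:M (p.2 : 'rV_n)).
Qed.

Lemma sigma_finite_vol n : (exists mu : {measure set (borel_mx R 1 n) -> \bar R},
    forall A : set (borel_mx R 1 n), measurable A -> mu A = vol A) ->
  exists mu : {sigma_finite_measure set (borel_mx R 1 n) -> \bar R},
    forall A : set (borel_mx R 1 n), measurable A -> mu A = vol A.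
Proof.
move=> [mu muE]; have sf : sigma_finite setT mu.
  exists (fun k => box k%:R); first exact: box_cover.
  move=> k; split; first exact: box_measurable.
  by rewrite muE ?vol_box ?ltry//; exact: box_measurable.
by exists (sigma_finite_copy sf).
Qed.

(** One more coordinate means pushing the product of Lebesgue measure with the previous measure
    forward along [row_mx]. Sigma-finiteness, needed to form the product, comes from the exhaustion
    by cubes. *)
Lemma vol_measure n : exists mu : {sigma_finite_measure set (borel_mx R 1 n) -> \bar R},
  forall A : set (borel_mx R 1 n), measurable A -> mu A = vol A.
Proof.
elim: n => [|n [mu muE]].
  apply: sigma_finite_vol.
  by exists (@dirac _ (borel_mx R 1 0) (0 : 'rV[R]_0) R).
apply: sigma_finite_vol.
pose f (p : measurableTypeR R * borel_mx R 1 n) : borel_mx R 1 n.+1 := row_mx p.1%:M p.2.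
have mf : measurable_fun setT f by exact: measurable_row_mx.
exists (pushforward_measure
  ((@lebesgue_measure R) \x mu)%E mf) => A mA.
rewrite /= /pushforward /=.
have mfA : measurable (f @^-1` A) by rewrite -[X in measurable X]setTI; exact: mf.
rewrite /product_measure1; apply: eq_integral => x _ /=.
rewrite xsectionE muE; last first.
  rewrite -(xsectionE (f @^-1` A)); exact: measurable_xsection.
by [].
Qed.

Lemma leb_subproof n : {mu : {sigma_finite_measure set (borel_mx R 1 n) -> \bar R} |
    forall A : set (borel_mx R 1 n), measurable A -> mu A = vol A}.
Proof. exact/cid/vol_measure. Qed.

(** Agreement with [vol] is known on Borel sets only, so each passage between the two carries a
    measurability proof. *)
Definition leb n : {sigma_finite_measure set (borel_mx R 1 n) -> \bar R} :=
  sval (leb_subproof n).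

Lemma lebE n (A : set (borel_mx R 1 n)) : measurable A -> leb n A = vol A.
Proof. exact: (svalP (leb_subproof n)). Qed.

End Volume.

(** * Lebesgue measure under scaling, translation and orthogonal maps *)

Section AffineInvariance.
Variable R : realType.

Lemma measurable_affine (t z : R) :
  measurable_fun setT (fun x : measurableTypeR R => t * x + z : measurableTypeR R).
Proof.
by apply: measurable_funD => //; apply: measurable_funM => //.
Qed.

(** Lebesgue measure pushed forward along the affine map and multiplied by t agrees with Lebesgue
    measure on half-open intervals, hence on all Borel sets. *)
Lemma integral_affine (f : measurableTypeR R -> \bar R) (t z : R) : 0 < t ->
  measurable_fun setT f -> (forall x, 0 <= f x)%E ->
  (t%:E * \int[@lebesgue_measure R]_x f (t * x + z)%R =
   \int[@lebesgue_measure R]_x f x)%E.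
Proof.
move=> t0 mf f0.
have mphi := measurable_affine t z.
pose m := mscale (NngNum (ltW t0))
  (pushforward_measure
    (@lebesgue_measure R) mphi).
have mE A : measurable A -> lebesgue_measure A = m A.
  apply: (@lebesgue_measure_unique R [the measure _ _ of m]) => X [[a b] _ <-].
  rewrite /= /m /mscale /= /pushforward.
  have -> : (fun x : R => (t * x + z)%R) @^-1` `]a, b] =
      `]((a - z) / t)%R, ((b - z) / t)%R]%classic.
    apply/seteqP; split=> x /=; rewrite !in_itv /= ltr_pdivrMr// ler_pdivlMr//;
      by rewrite ltrBlDr lerBrDr (mulrC x).
  rewrite !lebesgue_measure_itv /= !lte_fin ltr_pM2r ?invr_gt0// ltrD2r.
  case: ifP => _; last by rewrite mule0.
  by rewrite -!EFinB -EFinM; congr EFin; field; exact: lt0r_neq0.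
rewrite [RHS](eq_measure_integral [the measure _ _ of m])//; last by move=> A mA _; exact: mE.
rewrite ge0_integral_mscale//=; congr (_ * _)%E.
by rewrite (@ge0_integral_pushforward _ _ _ _ R _ mphi)// preimage_setT.
Qed.

Lemma measurable_slice n (A : set (borel_mx R 1 n.+1)) : measurable A ->
  measurable [set p : measurableTypeR R * borel_mx R 1 n | A (row_mx p.1%:M p.2)].
Proof.
move=> mA; rewrite -[X in measurable X]setTI; exact: measurable_row_mx.
Qed.

Lemma measurable_vol_slice n (A : set (borel_mx R 1 n.+1)) : measurable A ->
  measurable_fun setT (fun x : measurableTypeR R =>
    vol [set y : 'rV[R]_n | A (row_mx x%:M y)]).
Proof.
move=> mA; have mB := measurable_slice mA.
have := measurable_fun_xsection (leb R n) mB.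
apply: eq_measurable_fun => x _ /=; rewrite lebE; last exact: measurable_xsection.
by rewrite xsectionE.
Qed.

Lemma vol_ge0 n (A : set 'rV[R]_n) : (0 <= vol A)%E.
Proof.
elim: n A => [|n IH] A /=; first by rewrite lee_fin.
by apply: integral_ge0 => x _; exact: IH.
Qed.

(** Slicing in the first coordinate reduces to one dimension and to the induction hypothesis on
    slices. The case t = 1 gives translation invariance, the case z = 0 the homogeneity used for
    cones. *)
Lemma vol_affine n (t : R) (z : 'rV[R]_n) (A : set (borel_mx R 1 n)) : 0 < t ->
  measurable A -> ((t ^+ n)%:E * vol [set x : 'rV[R]_n | A (t *: x + z)%R] = vol A)%E.
Proof.
move=> t0; elim: n z A => [|n IH] z A mA.
  rewrite expr0 mul1e; congr vol; apply/funext => x /=.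
  by rewrite (thinmx0 (_ + _)) [x]thinmx0.
move: (lsubmx (z : 'rV_(1 + n))) (rsubmx (z : 'rV_(1 + n)))
  (hsubmxK (z : 'rV_(1 + n))) => z1 z2 <-.
rewrite /= -(@integral_affine
  (fun x => vol [set y : 'rV[R]_n | A (row_mx x%:M y)]) t (z1 0 0))//; last 2 first.
- exact: measurable_vol_slice.
- by move=> x; exact: vol_ge0.
rewrite exprS EFinM -muleA; congr (_ * _)%E.
have t0n : 0 <= t ^+ n by rewrite exprn_ge0// ltW.
have sl x : measurable ([set y : 'rV[R]_n | A (row_mx x%:M y)] : set (borel_mx R 1 n)).
  by have := measurable_xsection x (measurable_slice mA); rewrite xsectionE.
have E x : vol [set y : 'rV[R]_n | A (row_mx (t * x + z1 0 0)%:M y)] =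
  ((t ^+ n)%:E * vol [set y : 'rV[R]_n | A (t *: row_mx x%:M y + row_mx z1 z2)%R])%E.
  rewrite -(IH z2 _ (sl _)); congr (_ * vol _)%E.
  apply/funext => y /=.
  have -> // : t *: row_mx x%:M y + row_mx z1 z2 = row_mx (t * x + z1 0 0)%:M (t *: y + z2).
  by rewrite scale_row_mx add_row_mx scale_scalar_mx raddfD /= -mx11_scalar.
under [RHS]eq_integral do rewrite E.
rewrite ge0_integralZl_EFin//; first by move=> x _; exact: vol_ge0.
have := measurable_vol_slice (A := [set x | A (t *: x + row_mx z1 z2)]).
apply; rewrite -[X in measurable X]setTI.
apply: measurable_mx => // i j; rewrite ord1.
under eq_fun do rewrite mxE mxE.
apply: measurable_funD => //; apply: measurable_funM => //.
exact: measurable_coord.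
Qed.

Lemma leb_translate n (z : 'rV[R]_n) (A : set (borel_mx R 1 n)) : measurable A ->
  leb R n [set x | A (x + z)] = leb R n A.
Proof.
move=> mA; have := vol_affine z ltr01 mA.
rewrite expr1n mul1e; under eq_set do rewrite scale1r.
rewrite !lebE// -[X in measurable X]setTI.
apply: measurable_mx => // i j; rewrite ord1.
under eq_fun do rewrite mxE.
by apply: measurable_funD => //; exact: measurable_coord.
Qed.

Lemma measurable_rmul n (B : 'M[R]_n) d (T : measurableType d) (f : T -> borel_mx R 1 n) :
  measurable_fun setT f ->
  measurable_fun setT (fun t => (f t : 'rV[R]_n) *m B : borel_mx R 1 n).
Proof.
move=> mf; apply: measurable_mx => i j.
under eq_fun do rewrite mxE.
apply: measurable_sum => k; apply: measurable_funM => //.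
exact: (measurableT_comp (@measurable_coord R 1 n i k) mf).
Qed.

Lemma measurable_addmx m n d (T : measurableType d) (f g : T -> borel_mx R m n) :
  measurable_fun setT f -> measurable_fun setT g ->
  measurable_fun setT (fun t => (f t : 'M[R]_(m, n)) + (g t : 'M[R]_(m, n)) : borel_mx R m n).
Proof.
move=> mf mg; apply: measurable_mx => i j.
under eq_fun do rewrite mxE.
apply: measurable_funD.
  exact: (measurableT_comp (@measurable_coord R m n i j) mf).
exact: (measurableT_comp (@measurable_coord R m n i j) mg).
Qed.

Lemma measurable_oppmx m n d (T : measurableType d) (f : T -> borel_mx R m n) :
  measurable_fun setT f ->
  measurable_fun setT (fun t => - (f t : 'M[R]_(m, n)) : borel_mx R m n).
Proof.
move=> mf; apply: measurable_mx => i j.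
under eq_fun do rewrite mxE.
apply: measurableT_comp => //.
exact: (measurableT_comp (@measurable_coord R m n i j) mf).
Qed.

Lemma unit_ball_measurable n : measurable (@unit_ball R n : set (borel_mx R 1 n)).
Proof.
rewrite -[X in measurable X]setTI.
apply: (@measurable_fun_ler _ _ _ _ (fun x : borel_mx R 1 n => enorm (x : 'rV[R]_n)) (fun=> 1)) => //.
exact: measurable_enorm.
Qed.

(** The ball lies between the cubes of half-side 1 / (n + 1) and 1; n + 1 instead of n covers
    dimension 0 too. *)
Lemma leb_unit_ball n : leb R n (@unit_ball R n) = (kappa R n)%:E /\ 0 < kappa R n.
Proof.
have mB := @unit_ball_measurable n.
have bE a : 0 <= a -> leb R n (@box R n a) = ((a *+ 2) ^+ n)%:E.
  by move=> a0; rewrite lebE ?vol_box//; exact: box_measurable.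
have up : (leb R n (@unit_ball R n) <= ((1 *+ 2) ^+ n)%:E)%E.
  rewrite -bE//; apply: le_measure; rewrite ?inE//; first exact: box_measurable.
  move=> x x1 j; apply: le_trans (le_mx_norm x 0 j) _.
  exact: le_trans (norm_le_enorm x) x1.
have lo : (((n.+1%:R^-1 *+ 2) ^+ n)%:E <= leb R n (@unit_ball R n))%E.
  rewrite -bE ?invr_ge0//; apply: le_measure; rewrite ?inE//; first exact: box_measurable.
  move=> x hx; apply: le_trans (enorm_le_norm x) _.
  apply: (@le_trans _ _ (n%:R * n.+1%:R^-1)).
    by rewrite ler_wpM2l// mx_normP ?invr_ge0// => i j; rewrite ord1.
  by rewrite ler_pdivrMr// mul1r ler_nat.
have fin : leb R n (@unit_ball R n) = (kappa R n)%:E.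
  rewrite /kappa -lebE// fineK// ge0_fin_numE//.
  exact: le_lt_trans up (ltry _).
split=> //; rewrite -lte_fin -fin; apply: lt_le_trans lo.
by rewrite lte_fin exprn_gt0// pmulrn_lgt0// invr_gt0.
Qed.

Lemma fubini_sets d1 d2 (T1 : measurableType d1) (T2 : measurableType d2)
    (m1 : {sigma_finite_measure set T1 -> \bar R})
    (m2 : {sigma_finite_measure set T2 -> \bar R}) (E : set (T1 * T2)) :
  measurable E ->
  (\int[m1]_x m2 [set y | E (x, y)] = \int[m2]_y m1 [set x | E (x, y)])%E.
Proof.
move=> mE.
have mf : measurable_fun setT (EFin \o \1_E : T1 * T2 -> \bar R).
  by apply/measurable_EFinP; exact: measurable_indic.
have f0 x : (0 <= (EFin \o \1_E : T1 * T2 -> \bar R) x)%E by rewrite lee_fin.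
have h := @fubini_tonelli _ _ _ _ R m1 m2 _ mf f0.
have s1 x : m2 [set y | E (x, y)] = (\int[m2]_y (EFin \o \1_E) (x, y))%E.
  have mx : measurable [set y | E (x, y)].
    by rewrite -[X in measurable X]xsectionE; exact: measurable_xsection.
  by have := integral_indic m2 measurableT mx; rewrite setIT => <-.
have s2 y : m1 [set x | E (x, y)] = (\int[m1]_x (EFin \o \1_E) (x, y))%E.
  have my : measurable [set x | E (x, y)].
    by rewrite -[X in measurable X]ysectionE; exact: measurable_ysection.
  by have := integral_indic m1 measurableT my; rewrite setIT => <-.
under eq_integral do rewrite s1; rewrite h.
by apply: eq_integral => y _; rewrite s2.
Qed.

(* Computing the measure of {(x, y) : x eta + y in A, |y| <= 1} in both orders
   gives leb (A eta^-1) * leb ball = leb A * leb ball. *)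
Lemma leb_orthogonal n (eta : 'M[R]_n) (A : set (borel_mx R 1 n)) :
  eta *m eta^T = 1%:M -> measurable A ->
  leb R n [set x : 'rV[R]_n | A (x *m eta)] = leb R n A.
Proof.
move=> ee mA; set B := @unit_ball R n.
have mB : measurable (B : set (borel_mx R 1 n)) := @unit_ball_measurable n.
have [kE k0] := leb_unit_ball n.
have pre (f : borel_mx R 1 n -> borel_mx R 1 n) (C : set (borel_mx R 1 n)) :
    measurable_fun setT f -> measurable C -> measurable [set x | C (f x)].
  by move=> mf mC; rewrite -[X in measurable X]setTI; exact: mf.
have pre2 (f : borel_mx R 1 n * borel_mx R 1 n -> borel_mx R 1 n) (C : set (borel_mx R 1 n)) :
    measurable_fun setT f -> measurable C -> measurable [set x | C (f x)].
  by move=> mf mC; rewrite -[X in measurable X]setTI; exact: mf.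
have mid := @measurable_id _ (borel_mx R 1 n) setT.
have mA' : measurable ([set x | A ((x : 'rV[R]_n) *m eta)] : set (borel_mx R 1 n)).
  by apply: pre mA; exact: measurable_rmul.
have isum (C : set (borel_mx R 1 n)) (c : \bar R) (h : borel_mx R 1 n -> \bar R) : measurable C ->
    (forall x, C x -> h x = c) -> (forall x, ~ C x -> h x = 0%E) ->
    (\int[leb R n]_x h x = c * leb R n C)%E.
  move=> mC h1 h0; rewrite -(integral_cst (leb R n) mC c) [RHS]integral_mkcond.
  apply: eq_integral => x _; rewrite patchE; case: ifPn; rewrite ?inE ?notin_setE => Cx.
    by rewrite h1.
  by rewrite h0.
have m1 := @measurable_fst _ _ (borel_mx R 1 n) (borel_mx R 1 n).
have m2 := @measurable_snd _ _ (borel_mx R 1 n) (borel_mx R 1 n).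
have e1 := @fubini_sets _ _ _ _ (leb R n) (leb R n)
  [set p | A ((p.1 : 'rV[R]_n) *m eta + (p.2 : 'rV[R]_n)) /\ B p.2].
have e2 := @fubini_sets _ _ _ _ (leb R n) (leb R n)
  [set p | A p.2 /\ B ((p.2 : 'rV[R]_n) - (p.1 : 'rV[R]_n) *m eta)].
have {}e1 := e1 (measurableI _ _
  (pre2 _ _ (measurable_addmx (measurable_rmul eta m1) m2) mA) (pre2 _ _ m2 mB)).
have {}e2 := e2 (measurableI _ _ (pre2 _ _ m2 mA)
  (pre2 _ _ (measurable_addmx m2 (measurable_oppmx (measurable_rmul eta m1))) mB)).
have r1 : (\int[leb R n]_y leb R n [set x | A ((x : 'rV[R]_n) *m eta + (y : 'rV[R]_n))%R /\ B y] =
    leb R n [set x | A ((x : 'rV[R]_n) *m eta)] * leb R n B)%E.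
  refine (isum B _ _ mB _ _) => [y By|y nBy].
    rewrite -(leb_translate (y *m eta^T) mA'); congr (leb R n _).
    apply/seteqP; split=> x /=; rewrite mulmxDl -(mulmxA y) (mulmx1C ee) mulmx1.
      by case.
    by move=> h; split.
  rewrite -[RHS](measure0 (leb R n)); congr (leb R n _).
  by rewrite -subset0 => x /= [_ /nBy].
have r2 : (\int[leb R n]_y leb R n [set x | A y /\ B ((y : 'rV[R]_n) - (x : 'rV[R]_n) *m eta)%R] =
    leb R n B * leb R n A)%E.
  refine (isum A _ _ mA _ _) => [y Ay|y nAy].
    rewrite -(leb_translate (- (y *m eta^T)) mB); congr (leb R n _).
    have nE x : enorm (y - x *m eta) = enorm (x - y *m eta^T).
      have -> : y - x *m eta = (-1) *: ((x - y *m eta^T) *m eta).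
        by rewrite scaleN1r mulmxBl -(mulmxA y) (mulmx1C ee) mulmx1 opprB.
      rewrite enormZ normrN1 mul1r /enorm /dot trmx_mul mulmxA.
      by rewrite -(mulmxA _ eta) ee mulmx1.
    have Bs x : B (y - x *m eta) = B (x - y *m eta^T).
      by rewrite /B /unit_ball /= nE.
    apply/seteqP; split=> x /=; first by case=> _; rewrite Bs.
    by move=> h; split; [exact: Ay|rewrite Bs; exact: h].
  rewrite -[RHS](measure0 (leb R n)); congr (leb R n _).
  by rewrite -subset0 => x /= [/nAy].
(* For fixed x the two slices are translates of each other by x eta. *)
have r3 : (\int[leb R n]_x leb R n [set y | A ((x : 'rV[R]_n) *m eta + (y : 'rV[R]_n))%R /\ B y] =
    \int[leb R n]_x leb R n [set y | A y /\ B ((y : 'rV[R]_n) - (x : 'rV[R]_n) *m eta)%R])%E.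
  apply: eq_integral => x _.
  rewrite -[RHS](leb_translate (x *m eta)).
    by congr (leb R n _); apply/seteqP; split=> y /=; rewrite addrK addrC => h; exact: h.
  apply: measurableI; first exact: mA.
  apply: (pre (fun y => (y : 'rV[R]_n) - (x : 'rV[R]_n) *m eta) B _ mB).
  apply: (measurable_addmx (g := fun=> - ((x : 'rV[R]_n) *m eta) : borel_mx R 1 n)).
    exact: mid.
  exact: measurable_cst.
have {e1 e2}e : ((kappa R n)%:E * leb R n [set x | A ((x : 'rV[R]_n) *m eta)] =
    (kappa R n)%:E * leb R n A)%E.
  by rewrite -kE muleC -r1 -e1 /= r3 e2 /= r2.
have kfin : (kappa R n)%:E \is a fin_num by [].
have k0' : (0 < (kappa R n)%:E)%E by rewrite lte_fin.
apply/eqP; rewrite eq_le -(lee_pmul2l kfin k0') e lexx /=.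
by rewrite -(lee_pmul2l kfin k0') e lexx.
Qed.

End AffineInvariance.

(** * Polar coordinates *)

Section Polar.
Variables (R : realType) (n : nat).
Implicit Types (x y : 'rV[R]_n).

Definition hat x : 'rV[R]_n := (enorm x)^-1 *: x.

(** The substitute for the sphere as a domain of integration: the origin is removed so that [hat]
    takes values in the sphere. *)
Definition punctured_ball : set 'rV[R]_n := [set x | 0 < enorm x <= 1].

Lemma enorm_ge0 x : 0 <= enorm x. Proof. exact: sqrtr_ge0. Qed.

Lemma enorm_gt0 x : (0 < enorm x) = (x != 0).
Proof. by rewrite lt0r enorm_ge0 andbT -sqrf_eq0 enorm_sqr dot_eq0. Qed.

Lemma enorm0 : enorm (0 : 'rV[R]_n) = 0.
Proof. by apply/eqP; rewrite -sqrf_eq0 enorm_sqr dot_eq0. Qed.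

Lemma hat_sphere x : 0 < enorm x -> sphere (hat x).
Proof.
move=> x0; rewrite /sphere /= enormZ ger0_norm ?invr_ge0 ?enorm_ge0//.
by rewrite mulVf// lt0r_neq0.
Qed.

Lemma hatK x : 0 < enorm x -> enorm x *: hat x = x.
Proof. by move=> x0; rewrite scalerA mulfV ?scale1r// lt0r_neq0. Qed.

Lemma hatZ t x : 0 < t -> hat (t *: x) = hat x.
Proof.
move=> t0; rewrite /hat enormZ gtr0_norm// scalerA invfM mulrAC.
by rewrite mulVf ?mul1r// lt0r_neq0.
Qed.

Lemma hat_orthogonal (eta : 'M[R]_n) x : eta *m eta^T = 1%:M ->
  hat (x *m eta) = hat x *m eta.
Proof.
move=> ee; rewrite /hat -scalemxAl /enorm /dot trmx_mul mulmxA.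
by rewrite -(mulmxA x) ee mulmx1.
Qed.

Lemma measurable_hat : measurable_fun setT (hat : borel_mx R 1 n -> borel_mx R 1 n).
Proof.
apply: measurable_mx => i j; under eq_fun do rewrite mxE.
apply: measurable_funM; last exact: measurable_coord.
under eq_fun do rewrite -powR_inv1 ?enorm_ge0//.
apply: (@measurableT_comp _ _ _ _ _ _ (fun y : R => y `^ (-1))); first exact: measurable_powR.
exact: measurable_enorm.
Qed.

Let P : set (borel_mx R 1 n) := [set x | 0 < enorm (x : 'rV[R]_n)].

Lemma enorm_gt0_measurable : measurable P.
Proof.
rewrite -[X in measurable X]setTI.
apply: (@measurable_fun_ltr _ _ _ _ (fun=> 0) (fun x : borel_mx R 1 n => enorm (x : 'rV[R]_n))) => //.
exact: measurable_enorm.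
Qed.

Let mP := enorm_gt0_measurable.

Lemma origin_measurable : measurable ([set (0 : 'rV[R]_n)] : set (borel_mx R 1 n)).
Proof.
rewrite (_ : [set (0 : 'rV[R]_n)] = ~` P); first exact: measurableC.
apply/seteqP; split=> x; rewrite /P /= enorm_gt0.
  by move=> ->; rewrite eqxx.
by move/negP; rewrite negbK => /eqP.
Qed.

Lemma punctured_ball_measurable : measurable (punctured_ball : set (borel_mx R 1 n)).
Proof.
have -> : punctured_ball = P `&` @unit_ball R n.
  by apply/seteqP; split=> x; rewrite /punctured_ball /= => /andP.
by apply: measurableI => //; exact: unit_ball_measurable.
Qed.

Lemma measurable_comp_hat (f : 'rV[R]_n -> R) :
  measurable_fun (@sphere R n : set (borel_mx R 1 n)) f ->
  measurable_fun P (f \o hat : borel_mx R 1 n -> R).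
Proof.
move=> mf; apply: (@measurable_comp _ _ _ (borel_mx R 1 n) (borel_mx R 1 n) _ (@sphere R n)).
- exact: sphere_measurable.
- by move=> _ [x Px <-]; exact: hat_sphere.
- exact: mf.
- by apply: measurable_funTS; exact: measurable_hat.
Qed.

Lemma punctured_ball_sub : punctured_ball `<=` P.
Proof. by move=> x /andP[]. Qed.

Hypothesis n0 : (0 < n)%N.

(** The origin is invariant under doubling, so its finite measure r satisfies r = 2^n r with n >
    0. *)
Lemma leb_origin : leb R n [set (0 : 'rV[R]_n)] = 0%E.
Proof.
have m0 := origin_measurable.
have := vol_affine 0 (ltr0n R 2) m0.
have -> : [set x : 'rV[R]_n | [set 0] (2%:R *: x + 0)] = [set 0].
  apply/seteqP; split=> x /=; rewrite addr0; last by move=> ->; rewrite scaler0.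
  by move/eqP; rewrite scaler_eq0 pnatr_eq0 => /eqP.
rewrite -lebE//.
have : (leb R n [set 0%R] <= leb R n (@unit_ball R n))%E.
  apply: le_measure; rewrite ?inE//; first exact: unit_ball_measurable.
  by move=> _ ->; rewrite /unit_ball /= enorm0 ler01.
rewrite (leb_unit_ball R n).1.
move=> h.
have fin : leb R n [set 0] \is a fin_num.
  by rewrite ge0_fin_numE// (le_lt_trans h)// ltry.
rewrite -(fineK fin); move: (fine _) => r /eqP; rewrite -EFinM eqe => /eqP rE.
congr EFin.
have : (2%:R ^+ n - 1) * r = 0 by rewrite mulrBl mul1r rE subrr.
move/eqP; rewrite mulf_eq0 => /orP[|/eqP//].
rewrite subr_eq0 => /eqP e; have := @exprn_egt1 R n 2.
by rewrite e ltxx -lt0n ltr1n n0 => /(_ isT).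
Qed.

Lemma leb_add_origin (A : set (borel_mx R 1 n)) : measurable A -> ~ A 0 ->
  leb R n (A `|` [set (0 : 'rV[R]_n)]) = leb R n A.
Proof.
move=> mA A0; rewrite measureU//.
- by rewrite [X in _ + X]leb_origin addr0.
- exact: origin_measurable.
- by rewrite -subset0 => x [Ax x0]; rewrite /= in x0; rewrite x0 in Ax.
Qed.

Lemma leb_punctured_ball : leb R n punctured_ball = (kappa R n)%:E.
Proof.
rewrite -(leb_unit_ball R n).1 -leb_add_origin.
- congr (leb R n _); apply/seteqP; split=> x.
    by case=> [/andP[_ h]|->]; [exact: h|rewrite /unit_ball /= enorm0 ler01].
  rewrite /unit_ball /= => x1; have [->|x0] := eqVneq x 0; first by right.
  by left; rewrite /punctured_ball /= enorm_gt0 x0 x1.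
- exact: punctured_ball_measurable.
- by rewrite /punctured_ball /= enorm0 ltxx.
Qed.

Section Cone.
Variable C : set (borel_mx R 1 n).
Hypotheses (mC : measurable C) (CP : C `<=` P)
  (coneC : forall t x, 0 < t -> C (t *: (x : 'rV[R]_n)) = C x).

(** For s > 0 the set is the part of the cone in the unit ball dilated by the n-th root of s, so
    homogeneity contributes the factor s. For s = 0 it is empty, because the cone avoids the
    origin. *)
Lemma leb_cone s : 0 <= s ->
  leb R n (C `&` [set x | enorm (x : 'rV[R]_n) ^+ n <= s]) =
  (s%:E * leb R n (C `&` @unit_ball R n))%E.
Proof.
rewrite le_eqVlt => /predU1P[<-|s0].
  rewrite mul0e -[RHS](measure0 (leb R n)); congr (leb R n _).
  rewrite -subset0 => x [/CP x0]; rewrite /= leNgt => /negP; apply.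
  by rewrite exprn_gt0.
pose t := s `^ n%:R^-1.
have t0 : 0 < t by rewrite powR_gt0.
have ts : t ^+ n = s.
  rewrite -powR_mulrn ?powR_ge0// -powRrM mulVf ?powRr1 ?ltW//.
  by rewrite pnatr_eq0 -lt0n.
have mS : measurable (C `&` [set x | enorm (x : 'rV[R]_n) ^+ n <= s]).
  apply: measurableI => //; rewrite -[X in measurable X]setTI.
  apply: (@measurable_fun_ler _ _ _ _ (fun x : borel_mx R 1 n => enorm (x : 'rV[R]_n) ^+ n) (fun=> s)) => //.
  by apply: measurable_funX; exact: measurable_enorm.
rewrite (lebE mS) -(vol_affine 0 t0 mS) ts; congr (_ * _)%E.
rewrite lebE; last by apply: measurableI => //; exact: unit_ball_measurable.
congr vol; apply/seteqP; split=> x /=; rewrite addr0 coneC// enormZ gtr0_norm//.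
  move=> [Cx]; rewrite exprMn ts ger_pMr// => h; split; first exact: Cx.
  by rewrite /unit_ball /= -(@expr_le1 _ n)// enorm_ge0.
move=> [Cx x1]; split; first exact: Cx.
rewrite exprMn ts ger_pMr// expr_le1//; exact: enorm_ge0.
Qed.

(** Squeezing [F] between constants encloses the volume of the radial region and the integral of [F]
    in the same interval, so they differ by at most (hi - lo) times the measure of the cone in the
    ball. *)
Lemma leb_cone_between (F : borel_mx R 1 n -> R) lo hi : 0 <= lo -> lo <= hi ->
  measurable_fun C F -> (forall x, C x -> lo <= F x <= hi) ->
  let a := leb R n (C `&` [set x | enorm (x : 'rV[R]_n) ^+ n <= F x]) in
  let b := (\int[leb R n]_(x in C `&` @unit_ball R n) (F x)%:E)%E in
  let c := leb R n (C `&` @unit_ball R n) in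
  (lo%:E * c <= a <= hi%:E * c)%E /\ (lo%:E * c <= b <= hi%:E * c)%E.
Proof.
move=> lo0 lohi mF FC /=.
have mn : measurable_fun C (fun x : borel_mx R 1 n => enorm (x : 'rV[R]_n) ^+ n).
  by apply: measurable_funTS; apply: measurable_funX; exact: measurable_enorm.
have mI (g : borel_mx R 1 n -> R) : measurable_fun C g ->
    measurable (C `&` [set x | enorm (x : 'rV[R]_n) ^+ n <= g x]).
  by move=> mg; exact: (measurable_fun_ler mn mg).
have mCB : measurable (C `&` @unit_ball R n).
  by apply: measurableI => //; exact: unit_ball_measurable.
have F0 x : C x -> 0 <= F x by move=> /FC/andP[h _]; exact: le_trans h.
split.
  rewrite -!leb_cone//; last exact: le_trans lohi.
  apply/andP; split; apply: le_measure; rewrite ?inE.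
  - by apply: mI; exact: measurable_cst.
  - exact: mI.
  - move=> x [Cx /= h]; split; first exact: Cx.
    by apply: le_trans h _; have /andP[] := FC _ Cx.
  - exact: mI.
  - by apply: mI; exact: measurable_cst.
  - move=> x [Cx /= h]; split; first exact: Cx.
    by apply: le_trans h _; have /andP[] := FC _ Cx.
have mFE : measurable_fun (C `&` @unit_ball R n) (EFin \o F).
  by apply/measurable_EFinP; apply: (measurable_funS mC) mF => x [].
rewrite -!(integral_cst (leb R n) mCB); apply/andP; split; apply: ge0_le_integral.
- exact: mCB.
- by move=> x _; rewrite lee_fin.
- exact: measurable_cst.
- exact: mFE.
- by move=> x [Cx _]; rewrite lee_fin; have /andP[] := FC _ Cx.
- exact: mCB.
- by move=> x [Cx _]; rewrite lee_fin; exact: F0.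
- exact: mFE.
- exact: measurable_cst.
- by move=> x [Cx _]; rewrite lee_fin; have /andP[] := FC _ Cx.
Qed.

End Cone.

(** Cut the punctured space into the cones on which F lies in [N e, (N + 1) e). Each contributes an
    error of at most e times its measure in the ball, and finitely many suffice because F is
    bounded. *)
Lemma polar_approx (F : borel_mx R 1 n -> R) M e : measurable_fun P F ->
  (forall t x, 0 < t -> F (t *: (x : 'rV[R]_n)) = F x) ->
  (forall x, P x -> 0 <= F x <= M) -> 0 < e ->
  let a := leb R n (P `&` [set x | enorm (x : 'rV[R]_n) ^+ n <= F x]) in
  let b := (\int[leb R n]_(x in punctured_ball) (F x)%:E)%E in
  (a <= b + e%:E * (kappa R n)%:E /\ b <= a + e%:E * (kappa R n)%:E)%E.
Proof.
move=> mF hF FM e0 /=.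
have mn : measurable_fun setT (fun x : borel_mx R 1 n => enorm (x : 'rV[R]_n) ^+ n).
  by apply: measurable_funX; exact: measurable_enorm.
have mX C : measurable C -> C `<=` P ->
    measurable (C `&` [set x | enorm (x : 'rV[R]_n) ^+ n <= F x]).
  move=> mC CP; have mFC : measurable_fun C F by exact: (measurable_funS mP CP).
  exact: (measurable_fun_ler (measurable_funS measurableT (@subsetT _ C) mn) mFC).
pose al (C : set (borel_mx R 1 n)) := leb R n (C `&` [set x | enorm (x : 'rV[R]_n) ^+ n <= F x]).
pose be (C : set (borel_mx R 1 n)) := (\int[leb R n]_(x in C `&` @unit_ball R n) (F x)%:E)%E.
pose ga (C : set (borel_mx R 1 n)) := leb R n (C `&` @unit_ball R n).
have mBu := @unit_ball_measurable R n.
have alU A B : measurable A -> measurable B -> A `<=` P -> B `<=` P -> A `&` B = set0 ->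
    al (A `|` B) = (al A + al B)%E.
  move=> mA mB AP BP AB; rewrite /al setIUl measureU//; [exact: mX|exact: mX|].
  by rewrite setIACA AB set0I.
have gaU A B : measurable A -> measurable B -> A `&` B = set0 ->
    ga (A `|` B) = (ga A + ga B)%E.
  move=> mA mB AB; rewrite /ga setIUl measureU//; [exact: measurableI|exact: measurableI|].
  by rewrite setIACA AB set0I.
have beU A B : measurable A -> measurable B -> A `<=` P -> B `<=` P -> A `&` B = set0 ->
    be (A `|` B) = (be A + be B)%E.
  move=> mA mB AP BP AB; rewrite /be setIUl ge0_integral_setU//.
  - exact: measurableI.
  - exact: measurableI.
  - apply/measurable_EFinP; apply: (measurable_funS mP) mF => x [[/AP//]|[/BP//]].
  - move=> x [[/AP/FM/andP[h _] _]|[/BP/FM/andP[h _] _]]; rewrite lee_fin; exact: h.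
  - by apply/disj_setPS; rewrite setIACA AB set0I.
pose CN (N : nat) : set (borel_mx R 1 n) := P `&` [set x | F x < N%:R * e].
pose SN (N : nat) : set (borel_mx R 1 n) := P `&` [set x | N%:R * e <= F x < N.+1%:R * e].
have mCN N : measurable (CN N).
  exact: (measurable_fun_ltr mF (measurable_cst _)).
have SNE N : SN N = CN N.+1 `\` CN N.
  apply/seteqP; split=> x.
    by move=> [Px /andP[h1 h2]]; split; [split|move=> [_ /=]; rewrite ltNge h1].
  move=> [[Px h2] h]; split=> //=; rewrite h2 andbT leNgt; apply/negP => h1.
  by apply: h; split.
have CNS N : CN N.+1 = CN N `|` SN N.
  rewrite SNE setDUK// => x [Px h]; split=> //=; apply: lt_le_trans h _.
  by rewrite ler_pM2r// ler_nat.
have mSN N : measurable (SN N) by rewrite SNE; exact: measurableD.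
have CP N : CN N `<=` P by move=> x [].
have SP N : SN N `<=` P by move=> x [].
have dis N : CN N `&` SN N = set0 by rewrite SNE setDIK.
have slice N : (al (SN N) <= be (SN N) + e%:E * ga (SN N) /\
    be (SN N) <= al (SN N) + e%:E * ga (SN N))%E.
  have coneS t x : 0 < t -> SN N (t *: (x : 'rV[R]_n)) = SN N x.
    by move=> t0; rewrite /SN /P /= hF// enormZ gtr0_norm// pmulr_rgt0.
  have lo0 : 0 <= N%:R * e by rewrite mulr_ge0// ltW.
  have lohi : N%:R * e <= N.+1%:R * e by rewrite ler_pM2r// ler_nat.
  have mFS : measurable_fun (SN N) F by exact: (measurable_funS mP (SP N)).
  have FS x : SN N x -> N%:R * e <= F x <= N.+1%:R * e.
    by move=> [_ /andP[h1 h2]]; rewrite h1 ltW.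
  have [/andP[a1 a2] /andP[b1 b2]] := leb_cone_between (mSN N) (SP N) coneS lo0 lohi mFS FS.
  have E : ((N.+1%:R * e)%:E * ga (SN N) = (N%:R * e)%:E * ga (SN N) + e%:E * ga (SN N))%E.
    by rewrite -ge0_muleDl ?lee_fin// ?ltW// -EFinD -natr1 mulrDl mul1r.
  rewrite -/(al _) -/(be _) -/(ga _) E in a1 a2 b1 b2 *.
  split; [apply: (le_trans a2)|apply: (le_trans b2)]; exact: leeD2r.
have main N : (al (CN N) <= be (CN N) + e%:E * ga (CN N) /\
    be (CN N) <= al (CN N) + e%:E * ga (CN N))%E.
  elim: N => [|N [IH1 IH2]].
    have -> : CN 0%N = set0.
      rewrite -subset0 => x [Px /=]; rewrite mul0r ltNge.
      by have /andP[-> _] := FM _ Px.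
    by rewrite /al /be /ga !set0I measure0 integral_set0 mule0 adde0.
  have [s1 s2] := slice N.
  rewrite CNS alU// beU// gaU// ge0_muleDr//.
  split; rewrite [leRHS]addeACA; exact: leeD.
pose N := Num.bound (M / e).
have CNP : CN N = P.
  apply/seteqP; split=> [x []//|x Px]; split=> //=.
  have /andP[F0 h] := FM _ Px; apply: le_lt_trans (h) _.
  rewrite -ltr_pdivrMr// archi_boundP// divr_ge0 ?(ltW e0)//.
  exact: le_trans F0 h.
have PB : P `&` @unit_ball R n = punctured_ball.
  by apply/seteqP; split=> x; rewrite /punctured_ball /= => /andP.
by have := main N; rewrite CNP /al /be /ga PB leb_punctured_ball.
Qed.

(** Up to the null origin the body is the region |x|^n <= f(x/|x|)^n, so this is the polar formula
    for volume. It follows by letting the slice width tend to 0. *)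
Lemma vol_body_of (f : 'rV[R]_n -> R) b :
  measurable_fun (@sphere R n : set (borel_mx R 1 n)) f ->
  (forall u, sphere u -> 0 <= f u <= b) ->
  vol (body_of f) = (\int[leb R n]_(x in punctured_ball) (f (hat x) ^+ n)%:E)%E.
Proof.
move=> mf fb; pose F (x : borel_mx R 1 n) := f (hat x) ^+ n.
have mF : measurable_fun P F by apply: measurable_funX; exact: measurable_comp_hat.
have FM x : P x -> 0 <= F x <= b ^+ n.
  move=> /hat_sphere/fb/andP[f0 fb']; rewrite exprn_ge0//=.
  by rewrite lerXn2r ?nnegrE// (le_trans f0).
have hF t x : 0 < t -> F (t *: (x : 'rV[R]_n)) = F x by move=> t0; rewrite /F hatZ.
set A := P `&` [set x | enorm (x : 'rV[R]_n) ^+ n <= F x].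
have mA : measurable A.
  have mn : measurable_fun P (fun x : borel_mx R 1 n => enorm (x : 'rV[R]_n) ^+ n).
    by apply: measurable_funTS; apply: measurable_funX; exact: measurable_enorm.
  exact: (measurable_fun_ler mn mF).
have bodyE : body_of f = A `|` [set (0 : 'rV[R]_n)].
  apply/seteqP; split=> x.
    move=> [u [t [uS /andP[t0 tf] xE]]]; have [->|x0] := eqVneq x 0; first by right.
    have tE : enorm x = t by rewrite xE enormZ uS mulr1 ger0_norm.
    have t1 : 0 < t by rewrite -tE enorm_gt0.
    left; split; first by rewrite /P /= enorm_gt0.
    rewrite /= /F tE xE hatZ// /hat uS invr1 scale1r lerXn2r ?nnegrE//.
    exact: le_trans tf.
  case=> [[Px /= h]|->].
    exists (hat x), (enorm x); split; [exact: hat_sphere|rewrite enorm_ge0/=|by rewrite hatK].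
    have /andP[f0 _] := fb _ (hat_sphere Px).
    by rewrite -(@ler_pXn2r _ n)// nnegrE enorm_ge0.
  (* The origin belongs to the body only through some unit vector, which exists since n > 0. *)
  have [z [zS _]] := exists_unit_orth (0 : 'M[R]_(0, n)) n0.
  by exists z, 0; split=> //; [have /andP[-> _] := fb _ zS; rewrite lexx|rewrite scale0r].
have mO := origin_measurable.
rewrite -lebE; last by rewrite bodyE; exact: measurableU.
rewrite bodyE leb_add_origin//; last by move=> [+ _]; rewrite /P /= enorm0 ltxx.
have k0 := (leb_unit_ball R n).2.
apply/eqP; rewrite eq_le; apply/andP; split; apply/lee_addgt0Pr => e e0.
  have [h _] := polar_approx mF hF FM (divr_gt0 e0 k0).
  by move: h; rewrite -EFinM divfK// lt0r_neq0.
have [_ h] := polar_approx mF hF FM (divr_gt0 e0 k0).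
by move: h; rewrite -EFinM divfK// lt0r_neq0.
Qed.

End Polar.

(** * Integrals of bounded measurable functions on sets of finite measure *)

Section BoundedIntegrals.
Context d (T : measurableType d) (R : realType).
Variables (m : {measure set T -> \bar R}) (D : set T).
Hypotheses (mD : measurable D) (finD : (m D < +oo)%E).

Definition bmeas (f : T -> R) : Prop :=
  measurable_fun D f /\ exists B, forall x, D x -> `|f x| <= B.

Lemma bmeas_integrable f : bmeas f -> m.-integrable D (EFin \o f).
Proof.
move=> [mf [B fB]]; apply: measurable_bounded_integrable => //.
exists B; split; first exact: num_real.
by move=> r Br x Dx; apply: le_trans (fB _ Dx) (ltW Br).
Qed.

Lemma bmeas_cst c : bmeas (fun=> c).
Proof. by split; [exact: measurable_cst|exists `|c|]. Qed.

Lemma bmeasD f h : bmeas f -> bmeas h -> bmeas (fun x => f x + h x).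
Proof.
move=> [mf [B fB]] [mh [C hC]]; split; first exact: measurable_funD.
exists (B + C) => x Dx; rewrite (le_trans (ler_normD _ _))// lerD//.
- exact: fB.
- exact: hC.
Qed.

Lemma bmeasM f h : bmeas f -> bmeas h -> bmeas (fun x => f x * h x).
Proof.
move=> [mf [B fB]] [mh [C hC]]; split; first exact: measurable_funM.
exists (B * C) => x Dx; rewrite normrM ler_pM//; [exact: fB|exact: hC].
Qed.

Lemma bmeas_sum (I : eqType) (s : seq I) (f : I -> T -> R) :
  (forall i, i \in s -> bmeas (f i)) -> bmeas (fun x => \sum_(i <- s) f i x).
Proof.
elim: s => [|i s IH] h.
  by under eq_fun do rewrite big_nil; exact: bmeas_cst.
under eq_fun do rewrite big_cons; apply: bmeasD.
  by apply: h; rewrite inE eqxx.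
by apply: IH => j js; apply: h; rewrite inE js orbT.
Qed.

Lemma bmeas_avg (I : eqType) (s : seq I) (f : I -> T -> R) :
  (forall i, i \in s -> bmeas (f i)) -> bmeas (fun x => avg s (f ^~ x)).
Proof. by move=> h; apply: bmeasM; [exact: bmeas_cst|exact: bmeas_sum]. Qed.

Lemma Rint_avg (I : eqType) (s : seq I) (f : I -> T -> R) :
  (forall i, i \in s -> bmeas (f i)) ->
  (\int[m]_(x in D) avg s (f ^~ x))%R = avg s (fun i => \int[m]_(x in D) f i x)%R.
Proof.
move=> h; rewrite /avg RintegralZl//; last exact/bmeas_integrable/bmeas_sum.
congr *%R; elim: s h => [|i s IH] h.
  rewrite big_nil (@eq_Rintegral _ _ _ _ _ (fun=> 0)); last first.
    by move=> x _; rewrite big_nil.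
  by rewrite Rintegral_cst// mul0r.
rewrite big_cons -IH; last by move=> j js; apply: h; rewrite inE js orbT.
rewrite -RintegralD//.
- by apply: eq_Rintegral => x _; rewrite big_cons.
- by apply: bmeas_integrable; apply: h; rewrite inE eqxx.
- by apply: bmeas_integrable; apply: bmeas_sum => j js; apply: h; rewrite inE js orbT.
Qed.

Lemma Rint_le f h : bmeas f -> bmeas h -> (forall x, D x -> f x <= h x) ->
  \int[m]_(x in D) f x <= \int[m]_(x in D) h x.
Proof. by move=> bf bh; apply: le_Rintegral => //; exact: bmeas_integrable. Qed.

Lemma Rint_dist f h e : bmeas f -> bmeas h ->
  (forall x, D x -> `|f x - h x| <= e) ->
  `|\int[m]_(x in D) f x - \int[m]_(x in D) h x| <= e * fine (m D).
Proof.
move=> bf bh fh.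
have key f' h' : bmeas f' -> bmeas h' -> (forall x, D x -> `|f' x - h' x| <= e) ->
    \int[m]_(x in D) f' x <= \int[m]_(x in D) h' x + e * fine (m D).
  move=> bf' bh' fh'; rewrite -Rintegral_cst// -RintegralD//.
  - apply: Rint_le => //; first by apply: bmeasD => //; exact: bmeas_cst.
    by move=> x Dx; have := fh' x Dx; rewrite ler_norml => /andP[_]; lra.
  - exact: bmeas_integrable.
  - by apply: bmeas_integrable; exact: bmeas_cst.
have := key _ _ bf bh fh.
have hf x : D x -> `|h x - f x| <= e by rewrite distrC; exact: fh.
have := key _ _ bh bf hf; move=> h1 h2; rewrite ler_norml; apply/andP; split; lra.
Qed.

Lemma Rint_const_dist f c e : bmeas f -> (forall x, D x -> `|f x - c| <= e) ->
  `|\int[m]_(x in D) f x - c * fine (m D)| <= e * fine (m D).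
Proof. by move=> bf fc; rewrite -Rintegral_cst//; apply: Rint_dist => //; exact: bmeas_cst. Qed.

Lemma Rint_norm_le f B : bmeas f -> (forall x, D x -> `|f x| <= B) ->
  `|\int[m]_(x in D) f x| <= B * fine (m D).
Proof.
move=> bf fB; have := @Rint_const_dist f 0 B bf; rewrite mul0r subr0; apply.
by move=> x Dx; rewrite subr0; exact: fB.
Qed.

Lemma int_bmeas f : bmeas f -> (forall x, D x -> 0 <= f x) ->
  (\int[m]_(x in D) (f x)%:E = (\int[m]_(x in D) f x)%:E)%E.
Proof. by move=> bf f0; rewrite /Rintegral fineK//; exact/integrable_fin_num/bmeas_integrable. Qed.

(** The way invariance of a measure is exploited: the [F i] are rotated copies of f with the same
    integral, and their average is nearly the constant [a], so the integral of f is nearly [a] times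
    the mass. *)
Lemma Rint_of_average (I : eqType) (s : seq I) (f : T -> R) (F : I -> T -> R) a e :
  (0 < size s)%N -> (forall i, i \in s -> bmeas (F i)) ->
  (forall i, i \in s -> \int[m]_(x in D) F i x = \int[m]_(x in D) f x) ->
  (forall x, D x -> `|avg s (F ^~ x) - a| <= e) ->
  `|\int[m]_(x in D) f x - a * fine (m D)| <= e * fine (m D).
Proof.
move=> s0 bF iF Fa.
have <- : avg s (fun i => \int[m]_(x in D) F i x)%R = \int[m]_(x in D) f x.
  by rewrite (eq_avg iF) avg_cst.
by rewrite -Rint_avg//; apply: Rint_const_dist => //; exact: bmeas_avg.
Qed.

End BoundedIntegrals.

Lemma Rint_pushforward d (T : measurableType d) (R : realType)
    (m : {measure set T -> \bar R}) (D : set T) (p : T -> T) (f : T -> R) :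
  measurable D -> measurable_fun setT p -> p @^-1` D = D ->
  (forall A, measurable A -> m (p @^-1` A) = m A) ->
  measurable_fun D f -> (forall x, D x -> 0 <= f x) ->
  \int[m]_(x in D) f (p x) = \int[m]_(x in D) f x.
Proof.
move=> mD mp pD mm mf f0; congr fine.
have := @ge0_integral_pushforward _ _ _ _ R _ mp m D (EFin \o f) mD.
rewrite pD => <-; first last.
- by move=> x; rewrite inE lee_fin; exact: f0.
- exact/measurable_EFinP.
apply: eq_measure_integral => A mA _; exact: mm.
Qed.

(** * Functions continuous along rotations *)

Section RotationContinuity.
Variables (R : realType) (n : nat).
Hypothesis n1 : (1 < n)%N.
Implicit Types (f : 'rV[R]_n -> R) (g h : 'M[R]_n).

Lemma sphere_transitive (e x : 'rV[R]_n) : sphere e -> sphere x ->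
  exists2 g, SO g & rotate g e = x.
Proof.
move=> /sphereP eS /sphereP xS.
have [|g [gS gx]] := @gram_rotation R n 1 e x n1; first by rewrite !dot_scalar eS xS.
by exists g.
Qed.

Lemma sphere_nonempty : exists e : 'rV[R]_n, sphere e.
Proof.
have [z [zS _]] := exists_unit_orth (0 : 'M[R]_(0, n)) (ltnW n1).
by exists z.
Qed.

Lemma lipschitz_within p q (Phi : 'M[R]_n -> 'M[R]_(p, q)) C :
  (forall g h, SO g -> SO h -> `|Phi g - Phi h| <= C * `|g - h|) ->
  {within @SO R n, continuous Phi}.
Proof.
move=> lip; apply/subspace_continuousP => g gS.
apply/cvgrPdist_le => e e0; rewrite near_withinE; apply/nbhs_ballP.
have C0 : 0 < `|C| + 1 by rewrite ltr_wpDl.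
exists (e / (`|C| + 1)); first by rewrite /= divr_gt0.
move=> h; rewrite -ball_normE /= => gh hS; apply: le_trans (lip _ _ gS hS) _.
apply: (@le_trans _ _ ((`|C| + 1) * `|g - h|)).
  by rewrite ler_wpM2r// (le_trans (ler_norm _))// lerDl.
by rewrite mulrC -ler_pdivlMr// ltW.
Qed.

(* Level sets in an orbit are images of closed subsets of the compact group. *)
Lemma measurable_orbit p q (Phi : 'M[R]_n -> 'M[R]_(p, q)) C (F : 'M[R]_(p, q) -> R) :
  (forall g h, SO g -> SO h -> `|Phi g - Phi h| <= C * `|g - h|) ->
  equicont (@SO R n) (fun _ : unit => F \o Phi) ->
  measurable_fun (Phi @` @SO R n : set (borel_mx R p q)) F.
Proof.
move=> lip eF.
have cl (A : set 'M[R]_n) : A `<=` @SO R n -> closed A -> closed (Phi @` A).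
  move=> AS cA; apply: compact_closed; first exact: norm_hausdorff.
  apply: continuous_compact.
    exact: (continuous_subspaceW AS (lipschitz_within lip)).
  exact: (subclosed_compact cA (@SO_compact R n) AS).
have cSO : closed (@SO R n).
  by apply: compact_closed; [exact: norm_hausdorff|exact: SO_compact].
move=> mO; apply: (measurability _ (RGenCInfty.measurableE R)) => // _ [_ [c ->] <-].
have -> : Phi @` @SO R n `&` F @^-1` `[c, +oo[%classic =
    Phi @` (@SO R n `&` [set g | c <= F (Phi g)]).
  apply/seteqP; split=> [_ [[g gS <-] /=]|_ [g [gS /= cF] <-]].
    by rewrite in_itv/= andbT => cF; exists g.
  by split; [exists g|rewrite /= in_itv/= andbT].
have cA : closed (Phi @` (@SO R n `&` [set g | c <= F (Phi g)])).
  apply: cl => [g []//|g clg].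
  have gS : SO g by apply: cSO => B /clg[h [[hS _] Bh]]; exists h.
  split=> //=; rewrite leNgt; apply/negP => Fc.
  have e0 : 0 < (c - F (Phi g)) / 2 by rewrite divr_gt0// subr_gt0.
  have [d d0 hd] := eF _ e0.
  have [h [[hS /= ch]]] := clg _ (nbhsx_ballx g d d0).
  rewrite -ball_normE /= => gh.
  have := hd tt _ _ gS hS gh; rewrite /= ler_norml => /andP[h1 _].
  by move: h1 ch Fc; lra.
rewrite -[X in measurable X]setCK; apply: measurableC.
by apply: sub_sigma_algebra; exact: closed_openC.
Qed.

(** Uniform continuity on the sphere, phrased along rotations so that it is literally the
    equicontinuity hypothesis of [averaging]. *)
Definition rot_cont f : Prop :=
  equicont (@SO R n) (fun (x : {x : 'rV[R]_n | sphere x}) g => f (rotate g (sval x))).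

Lemma rot_contP f : rot_cont f <-> forall e, 0 < e -> exists2 d, 0 < d &
  forall g h x, SO g -> SO h -> sphere x -> `|g - h| < d ->
    `|f (rotate g x) - f (rotate h x)| <= e.
Proof.
split=> fc e e0; have [d d0 hd] := fc _ e0; exists d => //.
  by move=> g h x gS hS xS; exact: (hd (exist _ x xS)).
by move=> [x xS] g h gS hS; exact: hd.
Qed.

Lemma rot_cont_comp f k : SO k -> rot_cont f -> rot_cont (f \o rotate k).
Proof.
move=> kS /rot_contP fc; apply/rot_contP => e e0; have [d d0 hd] := fc _ e0.
exists (d / n.+1%:R); first by rewrite divr_gt0.
move=> g h x gS hS xS gh; rewrite /= -!rotateM; apply: hd => //; try exact: SOM.
rewrite -mulmxBr; apply: le_lt_trans (SO_mul_norm _ kS) _.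
apply: (@le_lt_trans _ _ (n.+1%:R * `|g - h|)); first by rewrite ler_wpM2r// ler_nat.
by rewrite mulrC -ltr_pdivlMr.
Qed.

(** Every point of the sphere is a rotated copy of one point, and a finite net of rotations gives
    all values up to 1. *)
Lemma rot_cont_bounded f : rot_cont f ->
  exists2 B, 0 <= B & forall x, sphere x -> `|f x| <= B.
Proof.
move=> /rot_contP fc; have [d d0 hd] := fc 1 ltr01.
have [e eS] := sphere_nonempty.
have [s [sS net]] := rot_net (fun g (gS : SO g) => gS) (SO1 R n) d0.
exists (\sum_(g <- s) `|f (rotate g e)| + 1); first by rewrite addr_ge0// sumr_ge0.
move=> x xS; have [g gS <-] := sphere_transitive eS xS.
have [h hs hg] := net g gS.
have := hd h g e (sS _ hs) gS eS hg.
have : `|f (rotate h e)| <= \sum_(g <- s) `|f (rotate g e)|.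
  rewrite (perm_big _ (perm_to_rem hs)) big_cons lerDl sumr_ge0//.
move=> h1 h2; rewrite -[f (rotate g e)](subrK (f (rotate h e))).
rewrite (le_trans (ler_normD _ _))// addrC lerD// distrC.
exact: h2.
Qed.

Lemma rotate_orbit (e : 'rV[R]_n) : sphere e -> (fun g => rotate g e) @` @SO R n = @sphere R n.
Proof.
move=> eS; apply/seteqP; split=> [_ [g gS <-]|x xS]; first exact: rotate_sphere.
by have [g gS gx] := sphere_transitive eS xS; exists g.
Qed.

Lemma rot_cont_measurable f : rot_cont f ->
  measurable_fun (@sphere R n : set (borel_mx R 1 n)) f.
Proof.
move=> /rot_contP fc; have [e eS] := sphere_nonempty.
rewrite -(rotate_orbit eS); apply: (@measurable_orbit _ _ _ n%:R).
  by move=> g h _ _; exact: rotate_dist.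
move=> eps eps0; have [d d0 hd] := fc _ eps0; exists d => // _ g h gS hS gh.
exact: hd.
Qed.

Lemma rot_cont_bmeas f : rot_cont f ->
  @bmeas _ (borel_mx R 1 n) R (@sphere R n) f.
Proof.
move=> fc; split; first exact: rot_cont_measurable.
by have [B _ fB] := rot_cont_bounded fc; exists B.
Qed.

Lemma rot_cont_cst c : rot_cont (fun=> c).
Proof. by move=> e e0; exists 1 => // t x y _ _ _; rewrite subrr normr0 ltW. Qed.

Lemma rot_contM f1 f2 : rot_cont f1 -> rot_cont f2 -> rot_cont (fun x => f1 x * f2 x).
Proof.
move=> c1 c2; have [B1 B10 h1] := rot_cont_bounded c1.
have [B2 B20 h2] := rot_cont_bounded c2.
move/rot_contP: c1 => c1; move/rot_contP: c2 => c2.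
apply/rot_contP => e e0.
have p1 : 0 < B1 + B2 + 1 by rewrite ltr_wpDl// addr_ge0.
have e1 : 0 < e / (B1 + B2 + 1) by rewrite divr_gt0.
have [d1 d10 hd1] := c1 _ e1; have [d2 d20 hd2] := c2 _ e1.
exists (Num.min d1 d2); first by rewrite lt_min d10.
move=> g h x gS hS xS; rewrite lt_min => /andP[gh1 gh2].
have := hd1 g h x gS hS xS gh1; have := hd2 g h x gS hS xS gh2.
have := h1 _ (rotate_sphere gS xS); have := h2 _ (rotate_sphere hS xS).
move: (f1 (rotate g x)) (f1 (rotate h x)) (f2 (rotate g x)) (f2 (rotate h x)) => a b c d Hd Ha Hcd Hab.
rewrite (_ : a * c - b * d = a * (c - d) + (a - b) * d); last by ring.
apply: le_trans (ler_normD _ _) _; rewrite !normrM.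
apply: (@le_trans _ _ (B1 * (e / (B1 + B2 + 1)) + (e / (B1 + B2 + 1)) * B2)).
  by rewrite lerD// ler_pM.
rewrite (_ : _ + _ = (B1 + B2) / (B1 + B2 + 1) * e); last by ring.
by rewrite ler_piMl ?(ltW e0)// ler_pdivrMr// mul1r lerDl.
Qed.

Lemma rot_contX f k : rot_cont f -> rot_cont (fun x => f x ^+ k).
Proof.
move=> fc; elim: k => [|k IH]; first exact: rot_cont_cst.
by under eq_fun do rewrite exprS; exact: (rot_contM fc IH).
Qed.

(** Heine-Cantor on the compact sphere, combined with the fact that nearby rotations move a unit
    vector to nearby points. *)
Lemma continuous_rot_cont f : {within @sphere R n, continuous f} -> rot_cont f.
Proof.
move=> /subspace_continuousP fc.
have S_compact : compact (@sphere R n).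
  apply: compact_mx; last exact: (@sphere_closed R n).
  exists 1; split; first exact: num_real.
  by move=> r r1 x xS; apply: le_trans (sphere_norm xS) (ltW r1).
suff uc : forall e, 0 < e -> exists2 d, 0 < d & forall x y, sphere x -> sphere y ->
    `|x - y| < d -> `|f x - f y| <= e.
  apply/rot_contP => e e0; have [d d0 hd] := uc e e0.
  exists (d / n.+1%:R); first by rewrite divr_gt0.
  move=> g h x gS hS xS gh; apply: hd; try exact: rotate_sphere.
  apply: le_lt_trans (rotate_dist g h xS) _.
  apply: (@le_lt_trans _ _ (n.+1%:R * `|g - h|)); first by rewrite ler_wpM2r// ler_nat.
  by rewrite mulrC -ltr_pdivlMr.
move=> e e0; have e2 : 0 < e / 2 by rewrite divr_gt0.
have loc x : sphere x -> exists2 r, 0 < r & forall y, sphere y -> `|x - y| < r ->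
    `|f x - f y| <= e / 2.
  move=> xS; have /cvgrPdist_le/(_ _ e2) := fc x xS.
  rewrite near_withinE => /nbhs_ballP[r /= r0 hr]; exists r => // y yS xy.
  by apply: hr => //; rewrite -ball_normE.
pose P d x := sphere x -> forall y, sphere y -> `|x - y| < d -> `|f x - f y| <= e.
(* Compactness turns the local radii into one [d] valid at every point. *)
have cov : \forall d \near 0^'+, @sphere R n `<=` P d.
  move/compact_near_coveringP: S_compact; apply=> x xS.
  have [r r0 hr] := loc x xS.
  have r2 : 0 < r / 2 by rewrite divr_gt0.
  exists (ball x (r / 2), [set d | d < r / 2]).
    split; first exact: nbhsx_ballx.
    exact: nbhs_right_lt.
  move=> [x' d] [/=]; rewrite -ball_normE /= => xx' dr x'S y yS x'y.
  have h1 : `|f x - f x'| <= e / 2.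
    by apply: hr => //; apply: lt_trans xx' _; rewrite ltr_pdivrMr// ltr_pMr// ltr1n.
  have h2 : `|f x - f y| <= e / 2.
    apply: hr => //; rewrite -[x - y](subrKA x') (splitr r).
    by rewrite (le_lt_trans (ler_normD _ _))// ltrD// (lt_trans x'y).
  rewrite -[_ - _](subrKA (f x)) (splitr e) (le_trans (ler_normD _ _))// lerD//.
  by rewrite distrC.
have [d [hd d0]] := filter_ex (filterI cov (nbhs_right_gt 0)).
by exists d => // x y xS yS; exact: hd.
Qed.

(** A finite family has a common modulus. Membership is [List.In] because functions carry no
    decidable equality. *)
Lemma rot_cont_list (ps : seq ('rV[R]_n -> R)) :
  (forall p, List.In p ps -> rot_cont p) ->
  forall e, 0 < e -> exists2 d, 0 < d & forall p, List.In p ps ->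
    forall g h x, SO g -> SO h -> sphere x -> `|g - h| < d ->
    `|p (rotate g x) - p (rotate h x)| <= e.
Proof.
elim: ps => [|q ps IH] psc e e0; first by exists 1.
have [d1 d10 h1] := IH (fun p pps => psc p (or_intror pps)) e e0.
have /rot_contP qc := psc q (or_introl erefl); have [d2 d20 h2] := qc _ e0.
exists (Num.min d1 d2); first by rewrite lt_min d10.
move=> p /= [<-|pps] g h x gS hS xS; rewrite lt_min => /andP[gh1 gh2].
  exact: h2.
exact: (h1 p pps).
Qed.

Lemma rot_cont_list_bounded (ps : seq ('rV[R]_n -> R)) :
  (forall p, List.In p ps -> rot_cont p) ->
  exists2 B, 0 <= B & forall p, List.In p ps -> forall x, sphere x -> `|p x| <= B.
Proof.
elim: ps => [|q ps IH] psc; first by exists 0.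
have [B1 B10 h1] := IH (fun p pps => psc p (or_intror pps)).
have [B2 B20 h2] := rot_cont_bounded (psc q (or_introl erefl)).
exists (B1 + B2); first exact: addr_ge0.
move=> p /= [<-|pps] x xS.
  by rewrite (le_trans (h2 _ xS))// lerDr.
by rewrite (le_trans (h1 _ pps _ xS))// lerDl.
Qed.

(* s averages products p(gx) q(gy) as Haar measure would, up to e. *)
Definition pair_average (ps : seq ('rV[R]_n -> R)) e (s : seq 'M[R]_n) : Prop :=
  [/\ (0 < size s)%N, (forall g, g \in s -> SO g) &
    forall p q x y g h, List.In p ps -> List.In q ps -> sphere x -> sphere y ->
      SO g -> SO h ->
    `|avg s (fun k => p (rotate k (rotate g x)) * q (rotate k (rotate g y))) -
      avg s (fun k => p (rotate k (rotate h x)) * q (rotate k (rotate h y)))| <= e].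

(** The products, over all pairs from the list and all pairs of points, form one bounded
    equicontinuous family, to which [averaging] over the whole rotation group applies. *)
Lemma pair_averaging (ps : seq ('rV[R]_n -> R)) e :
  (forall p, List.In p ps -> rot_cont p) -> 0 < e ->
  exists s, pair_average ps e s.
Proof.
move=> psc e0.
pose T := ({p | List.In p ps} * {p | List.In p ps} *
  ({x : 'rV[R]_n | sphere x} * {x : 'rV[R]_n | sphere x}))%type.
pose phi (t : T) (g : 'M[R]_n) := sval t.1.1 (rotate g (sval t.2.1)) * sval t.1.2 (rotate g (sval t.2.2)).
have [B B0 hB] := rot_cont_list_bounded psc.
have phiB t g : SO g -> `|phi t g| <= B * B.
  move: t => [[[p pps] [q qps]] [[x xS] [y yS]]] gS; rewrite /phi /= normrM.
  by apply: ler_pM => //; apply: hB => //; exact: rotate_sphere.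
have phic : equicont (@SO R n) phi.
  move=> e1 e10; have p1 : 0 < B + B + 1 by rewrite ltr_wpDl// addr_ge0.
  have e2 : 0 < e1 / (B + B + 1) by rewrite divr_gt0.
  have [d d0 hd] := rot_cont_list psc e2; exists d => //.
  move=> [[[p pps] [q qps]] [[x xS] [y yS]]] g h gS hS gh; rewrite /phi /=.
  have := hd p pps g h x gS hS xS gh; have := hd q qps g h y gS hS yS gh.
  have := hB p pps _ (rotate_sphere gS xS); have := hB q qps _ (rotate_sphere hS yS).
  move: (p (rotate g x)) (p (rotate h x)) (q (rotate g y)) (q (rotate h y)) => a b c k Hd Ha Hcd Hab.
  rewrite (_ : a * c - b * k = a * (c - k) + (a - b) * k); last by ring.
  apply: le_trans (ler_normD _ _) _; rewrite !normrM.
  apply: (@le_trans _ _ (B * (e1 / (B + B + 1)) + (e1 / (B + B + 1)) * B)).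
    by rewrite lerD// ler_pM.
  rewrite (_ : _ + _ = (B + B) / (B + B + 1) * e1); last by ring.
  by rewrite ler_piMl ?(ltW e10)// ler_pdivrMr// mul1r lerDl.
have [s [s0 sS hs]] := averaging (SO_subgroup R n) phic phiB e0.
exists s; split=> // p q x y g h pps qps xS yS gS hS.
have := hs ((exist _ p pps, exist _ q qps), (exist _ x xS, exist _ y yS)) g h gS hS.
rewrite /phi /=; under eq_avg do rewrite !rotateM.
by under [X in _ - X]eq_avg do rewrite !rotateM.
Qed.

Section Convolution.
Variable m : {measure set (borel_mx R 1 n) -> \bar R}.
Hypothesis finm : (m (@sphere R n) < +oo)%E.

Lemma Rint_rotate_cont f : rot_cont f -> forall e, 0 < e -> exists2 d, 0 < d &
  forall g h, SO g -> SO h -> `|g - h| < d ->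
  forall k, SO k -> `|\int[m]_(v in @sphere R n) f (rotate g (rotate k v)) -
    \int[m]_(v in @sphere R n) f (rotate h (rotate k v))| <= e.
Proof.
move=> fc e e0; have M0 : 0 < fine (m (@sphere R n)) + 1.
  by rewrite ltr_wpDl// fine_ge0.
have eM : 0 < e / (fine (m (@sphere R n)) + 1) by rewrite divr_gt0.
have /rot_contP/(_ _ eM)[d d0 hd] := fc.
exists d => // g h gS hS gh k kS.
have bm g' : SO g' -> @bmeas _ (borel_mx R 1 n) R (@sphere R n) (fun v => f (rotate g' (rotate k v))).
  move=> gS'; have := rot_cont_bmeas (rot_cont_comp (SOM gS' kS) fc).
  by rewrite (_ : _ \o _ = fun v => f (rotate g' (rotate k v)))//; apply/funext => v; rewrite /= rotateM.
apply: (le_trans (@Rint_dist _ _ R m _ (@sphere_measurable R n) finm _ _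
  (e / (fine (m (@sphere R n)) + 1)) (bm _ gS) (bm _ hS) _)).
  by move=> v vS; apply: hd => //; exact: rotate_sphere.
by rewrite mulrAC -mulrA ler_piMr ?(ltW e0)// ler_pdivrMr// mul1r lerDl.
Qed.

Variable ebar : 'rV[R]_n.
Hypotheses (hebar : sphere ebar) (zm : zonal ebar m).

Lemma sconv_rotate f g : rot_cont f -> SO g ->
  sconv ebar f m (rotate g ebar) = (\int[m]_(v in @sphere R n) f (rotate g v))%R.
Proof. by move=> fc gS; apply: sconvE => //; exact: rot_cont_measurable. Qed.

(** At g k [ebar] the convolution is the integral of f(g k v), whose dependence on g is controlled
    uniformly in k. *)
Lemma rot_cont_sconv f : rot_cont f -> rot_cont (sconv ebar f m).
Proof.
move=> fc; apply/rot_contP => e e0; have [d d0 hd] := Rint_rotate_cont fc e0.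
exists d => // g h x gS hS xS gh.
have [k kS <-] := sphere_transitive hebar xS.
rewrite -!rotateM !sconv_rotate//; try exact: SOM.
under eq_Rintegral do rewrite rotateM.
under [X in _ - X]eq_Rintegral do rewrite rotateM.
exact: hd.
Qed.

End Convolution.

End RotationContinuity.

(** * Convolutions with zonal measures *)

Section ConeMean.
Variables (R : realType) (n : nat).
Implicit Types (f : 'rV[R]_n -> R).

Lemma comp_hat_bmeas f : @bmeas _ (borel_mx R 1 n) R (@sphere R n) f ->
  @bmeas _ (borel_mx R 1 n) R (@punctured_ball R n) (f \o @hat R n).
Proof.
move=> [mf [B fB]]; split; last first.
  by exists B => x /andP[x0 _]; apply: fB; exact: hat_sphere.
have mP := @enorm_gt0_measurable R n.
exact: (measurable_funS mP (@punctured_ball_sub R n) (measurable_comp_hat mf)).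
Qed.

Lemma Rint_hat_orthogonal f (eta : 'M[R]_n) : eta *m eta^T = 1%:M ->
  measurable_fun (@sphere R n : set (borel_mx R 1 n)) f ->
  (forall x, sphere x -> 0 <= f x) ->
  \int[leb R n]_(x in @punctured_ball R n) f (hat x *m eta) =
  \int[leb R n]_(x in @punctured_ball R n) f (hat x).
Proof.
move=> ee mf f0.
have mphi : measurable_fun setT (fun x : borel_mx R 1 n => (x : 'rV[R]_n) *m eta : borel_mx R 1 n).
  exact: measurable_rmul.
have mP := @enorm_gt0_measurable R n.
rewrite -(@Rint_pushforward _ (borel_mx R 1 n) R (leb R n) (@punctured_ball R n)
  (fun x => (x : 'rV[R]_n) *m eta) (f \o @hat R n)).
- by apply: eq_Rintegral => x _; rewrite /= hat_orthogonal.
- exact: punctured_ball_measurable.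
- exact: mphi.
- apply/seteqP; split=> x; rewrite /punctured_ball /= /enorm /dot trmx_mul mulmxA;
    by rewrite -(mulmxA x) ee mulmx1.
- by move=> A mA; exact: leb_orthogonal.
- exact: (measurable_funS mP (@punctured_ball_sub R n) (measurable_comp_hat mf)).
- by move=> x /andP[x0 _]; apply: f0; exact: hat_sphere.
Qed.

End ConeMean.

Section ConvolutionCommutes.
Variables (R : realType) (n : nat).
Hypothesis n2 : (2 < n)%N.
Let n1 : (1 < n)%N := ltnW n2.
Implicit Types (f h p q : 'rV[R]_n -> R).

(** Weighted AM-GM. The inductive step multiplies the hypothesis by b and adds (m + 1) a^m (b - a)^2
    >= 0. *)
Lemma young_pow (a b : R) m : 0 <= a -> 0 <= b ->
  m.+1%:R * (a ^+ m * b) <= m%:R * a ^+ m.+1 + b ^+ m.+1.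
Proof.
move=> a0 b0; elim: m => [|m IH]; first by rewrite !expr0 !expr1 !mul1r mul0r add0r.
have h : 0 <= m.+1%:R * a ^+ m * (b - a) ^+ 2.
  by apply: mulr_ge0; [apply: mulr_ge0; [exact: ler0n|exact: exprn_ge0]|exact: sqr_ge0].
have := ler_wpM2l b0 IH; rewrite -subr_ge0 => h'.
rewrite -subr_ge0; have := addr_ge0 h h'; congr (_ <= _).
by rewrite -!natr1 !exprS expr0; ring.
Qed.

(** Take as second rotation one that exchanges x and y: a pair average is symmetric in its two
    points. This is the source of self-adjointness. *)
Lemma pair_average_swap ps e s p q x y : pair_average ps e s ->
  List.In p ps -> List.In q ps -> sphere x -> sphere y ->
  `|avg s (fun k => p (rotate k x) * q (rotate k y)) -
    avg s (fun k => p (rotate k y) * q (rotate k x))| <= e.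
Proof.
move=> [s0 sS hs] pps qps xS yS.
have [z [zS zx zy]] := rotation_swap n2 xS yS.
have := hs p q x y 1%:M z pps qps xS yS (SO1 R n) zS.
by rewrite !rotate1 zx zy.
Qed.

(** With the constant 1 as second factor, a pair average becomes the average of one function, so 1
    has to belong to the list. *)
Lemma pair_average_single ps e s p x y : pair_average ps e s ->
  List.In p ps -> List.In (fun=> 1) ps -> sphere x -> sphere y ->
  `|avg s (fun k => p (rotate k x)) - avg s (fun k => p (rotate k y))| <= e.
Proof.
move=> [s0 sS hs] pps ops xS yS.
have [z zS zx] := sphere_transitive n1 xS yS.
have := hs p (fun=> 1) x x 1%:M z pps ops xS xS (SO1 R n) zS.
rewrite !rotate1 zx; under eq_avg do rewrite mulr1.
by under [X in _ - X]eq_avg do rewrite mulr1.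
Qed.

(** Links the analytic and the finite mean: orthogonal invariance of [leb] lets the integral be
    computed from a list whose averages hardly depend on the point. *)
Lemma cone_mean_average p e s x : (0 < size s)%N -> (forall g, g \in s -> SO g) ->
  (forall y, sphere y ->
    `|avg s (fun k => p (rotate k y)) - avg s (fun k => p (rotate k x))| <= e) ->
  rot_cont p -> (forall y, sphere y -> 0 <= p y) ->
  `|\int[leb R n]_(y in @punctured_ball R n) p (hat y) -
    avg s (fun k => p (rotate k x)) * kappa R n| <= e * kappa R n.
Proof.
move=> s0 sS hs pc p0.
have lE := leb_punctured_ball R (ltnW n1) : leb R n (@punctured_ball R n) = _.
have fin : (leb R n (@punctured_ball R n) < +oo)%E by rewrite lE ltry.
have := @Rint_of_average _ (borel_mx R 1 n) R (leb R n) _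
  (@punctured_ball_measurable R n) fin _ s (p \o @hat R n)
  (fun k y => p (rotate k (hat y))) (avg s (fun k => p (rotate k x))) e s0.
rewrite [fine _](_ : _ = kappa R n); last by rewrite [X in fine X]lE.
apply.
- move=> k /sS kS; have := comp_hat_bmeas (rot_cont_bmeas n1 (rot_cont_comp kS pc)).
  exact.
- move=> k /sS kS; apply: (Rint_hat_orthogonal (eta := k^T)) => //.
  + by have [] := SOV kS.
  + exact: rot_cont_measurable.
- by move=> y /andP[y0 _]; apply: hs; exact: hat_sphere.
Qed.

Variables (ebar : 'rV[R]_n) (hebar : sphere ebar).

Section OneMeasure.
Variable m : {measure set (borel_mx R 1 n) -> \bar R}.
Hypotheses (finm : (m (@sphere R n) < +oo)%E) (zm : zonal ebar m).

Lemma rotate2_bmeas f g k : rot_cont f -> SO g -> SO k ->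
  @bmeas _ (borel_mx R 1 n) R (@sphere R n) (fun v => f (rotate g (rotate k v))).
Proof.
move=> fc gS kS; have := rot_cont_bmeas n1 (rot_cont_comp (SOM gS kS) fc).
by rewrite (_ : _ \o _ = fun v => f (rotate g (rotate k v)))//; apply/funext => v; rewrite /= rotateM.
Qed.

Lemma wavg_bmeas f s (c : 'M[R]_n -> R) k : rot_cont f -> SO k -> (forall g, g \in s -> SO g) ->
  @bmeas _ (borel_mx R 1 n) R (@sphere R n)
    (fun v => avg s (fun g => c g * f (rotate g (rotate k v)))).
Proof.
move=> fc kS sS; apply: (@bmeas_avg _ (borel_mx R 1 n) R _ _ s
  (fun g v => c g * f (rotate g (rotate k v)))).
move=> g /sS gS; apply: (@bmeasM _ (borel_mx R 1 n) R).
  exact: bmeas_cst.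
exact: rotate2_bmeas.
Qed.

(** The weight [c] absorbs the other factor of a product, so a product average involving a
    convolution becomes an integral of product averages. *)
Lemma avg_sconv f s (c : 'M[R]_n -> R) k : rot_cont f -> SO k -> (forall g, g \in s -> SO g) ->
  avg s (fun g => c g * sconv ebar f m (rotate g (rotate k ebar))) =
  \int[m]_(v in @sphere R n) avg s (fun g => c g * f (rotate g (rotate k v))).
Proof.
move=> fc kS sS.
rewrite (@Rint_avg _ (borel_mx R 1 n) R m _ (@sphere_measurable R n) finm _ s
  (fun g v => c g * f (rotate g (rotate k v)))); last first.
  move=> g /sS gS; apply: (@bmeasM _ (borel_mx R 1 n) R).
    exact: bmeas_cst.
  exact: rotate2_bmeas.
apply: eq_avg => g /sS gS.
rewrite -rotateM (sconv_rotate n1 zm)//; last exact: SOM.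
rewrite RintegralZl//.
- by congr *%R; apply: eq_Rintegral => v _; rewrite rotateM.
- exact: (@sphere_measurable R n).
- apply: (bmeas_integrable (@sphere_measurable R n)) => //; exact: rotate2_bmeas.
Qed.

Lemma avg_sconv1 f s (c : 'M[R]_n -> R) : rot_cont f -> (forall g, g \in s -> SO g) ->
  avg s (fun g => c g * sconv ebar f m (rotate g ebar)) =
  \int[m]_(v in @sphere R n) avg s (fun g => c g * f (rotate g v)).
Proof.
move=> fc sS; have := avg_sconv c fc (SO1 R n) sS.
rewrite rotate1 => ->; apply: eq_Rintegral => v _.
by apply: eq_avg => g _; rewrite rotate1.
Qed.

Lemma wavg1_bmeas f s (c : 'M[R]_n -> R) : rot_cont f -> (forall g, g \in s -> SO g) ->
  @bmeas _ (borel_mx R 1 n) R (@sphere R n)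
    (fun v => avg s (fun g => c g * f (rotate g v))).
Proof.
move=> fc sS; have := wavg_bmeas c fc (SO1 R n) sS.
by under eq_fun do under eq_avg do rewrite rotate1.
Qed.

End OneMeasure.

Variables m1 m2 : {measure set (borel_mx R 1 n) -> \bar R}.
Hypotheses (finm1 : (m1 (@sphere R n) < +oo)%E) (zm1 : zonal ebar m1).
Hypotheses (finm2 : (m2 (@sphere R n) < +oo)%E) (zm2 : zonal ebar m2).

Let M1 := fine (m1 (@sphere R n)).
Let M2 := fine (m2 (@sphere R n)).

(* Zonal convolutions are self-adjoint, because some rotation exchanges any two
   unit vectors; the composition of two of them is again of this kind, hence
   self-adjoint, and so the two convolutions commute. *)
Lemma sconv_commute f h e s :
  rot_cont f -> rot_cont h ->
  pair_average [:: f; h; sconv ebar f m1; sconv ebar h m2] e s ->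
  `|avg s (fun g => h (rotate g ebar) *
       sconv ebar (sconv ebar f m2) m1 (rotate g ebar)) -
    \int[m2]_(v in @sphere R n) avg s (fun g => h (rotate g ebar) *
       sconv ebar f m1 (rotate g v))| <= e * (M1 * M2 + M1 + M2).
Proof.
move=> fc hc hs; have [s0 sS _] := hs.
set f1 := sconv ebar f m1; set h2 := sconv ebar h m2; set f2 := sconv ebar f m2.
have f1c : rot_cont f1 by exact: rot_cont_sconv.
have f2c : rot_cont f2 by exact: rot_cont_sconv.
have h2c : rot_cont h2 by exact: rot_cont_sconv.
have mS := @sphere_measurable R n.
pose i1 := \int[m1]_(u in @sphere R n) avg s (fun g => h (rotate g ebar) * f2 (rotate g u)).
pose i2 := \int[m1]_(u in @sphere R n) avg s (fun g => f (rotate g ebar) * h2 (rotate g u)).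
pose i3 := \int[m1]_(u in @sphere R n) avg s (fun g => h2 (rotate g ebar) * f (rotate g u)).
pose i4 := \int[m2]_(v in @sphere R n) avg s (fun g => f1 (rotate g ebar) * h (rotate g v)).
pose i5 := \int[m2]_(v in @sphere R n) avg s (fun g => h (rotate g ebar) * f1 (rotate g v)).
have e1 : avg s (fun g => h (rotate g ebar) * sconv ebar f2 m1 (rotate g ebar)) = i1.
  exact: avg_sconv1.
(* Writing u = k ebar, exchange [ebar] with k v under both integrals: the composition of the two
   convolutions is symmetric. *)
have d12 : `|i1 - i2| <= e * M2 * M1.
  apply: Rint_dist => //; [exact: wavg1_bmeas|exact: wavg1_bmeas|].
  move=> u uS; have [k kS <-] := sphere_transitive n1 hebar uS.
  rewrite !avg_sconv//; apply: Rint_dist => //; [exact: wavg_bmeas|exact: wavg_bmeas|].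
  move=> v vS; have kvS := rotate_sphere kS vS.
  have := pair_average_swap (p := h) (q := f) hs _ _ hebar kvS.
  under [X in _ - X]eq_avg do rewrite mulrC.
  by apply; rewrite /=; tauto.
(* Convolution with [m1] alone moves from [h2] to [f]. *)
have d23 : `|i2 - i3| <= e * M1.
  apply: Rint_dist => //; [exact: wavg1_bmeas|exact: wavg1_bmeas|].
  move=> u uS; have := pair_average_swap (p := f) (q := h2) hs _ _ hebar uS.
  under [X in _ - X]eq_avg do rewrite mulrC.
  by apply; rewrite /=; tauto.
have e34 : i3 = i4.
  rewrite /i3 -avg_sconv1// /i4 -avg_sconv1//.
  by apply: eq_avg => g _; rewrite mulrC.
(* Convolution with [m2] moves from [h] back to [f1]; the two convolutions now act on f in the
   opposite order. *)
have d45 : `|i4 - i5| <= e * M2.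
  apply: Rint_dist => //; [exact: wavg1_bmeas|exact: wavg1_bmeas|].
  move=> u uS; have := pair_average_swap (p := f1) (q := h) hs _ _ hebar uS.
  under [X in _ - X]eq_avg do rewrite mulrC.
  by apply; rewrite /=; tauto.
rewrite e1 -/i5; rewrite e34 in d23.
move: d12 d23 d45; rewrite !ler_norml.
rewrite (_ : e * (M1 * M2 + M1 + M2) = e * M2 * M1 + e * M1 + e * M2); last by ring.
by move=> /andP[? ?] /andP[? ?] /andP[? ?]; apply/andP; split; lra.
Qed.

End ConvolutionCommutes.

(** * First inequality: the volume of a body whose radial function is a double convolution *)

Section ConvolutionVolume.
Variables (R : realType) (n : nat).
Hypothesis n2 : (2 < n)%N.
Let n1 : (1 < n)%N := ltnW n2.
Implicit Types (f h p q : 'rV[R]_n -> R).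

Lemma vol_body_rot_cont q : rot_cont q -> (forall x, sphere x -> 0 <= q x) ->
  vol (body_of q) = (\int[leb R n]_(x in @punctured_ball R n) (q (hat x) ^+ n))%:E.
Proof.
move=> qc q0; have [B _ qB] := rot_cont_bounded n1 qc.
rewrite (@vol_body_of R n (ltnW n1) q B); first last.
- by move=> u uS; rewrite q0//= (le_trans (ler_norm _)) ?qB.
- exact: rot_cont_measurable.
have bm := comp_hat_bmeas (rot_cont_bmeas n1 (rot_contX n1 n qc)).
have fin : (leb R n (@punctured_ball R n) < +oo)%E.
  by rewrite (leb_punctured_ball R (ltnW n1)) ltry.
apply: (@int_bmeas _ (borel_mx R 1 n) R (leb R n) _ (@punctured_ball_measurable R n) fin _ bm).
by move=> x /andP[x0 _]; rewrite exprn_ge0// q0//; exact: hat_sphere.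
Qed.

Lemma pair_average_sub (ps ps' : seq ('rV[R]_n -> R)) e s :
  (forall p, List.In p ps' -> List.In p ps) -> pair_average ps e s -> pair_average ps' e s.
Proof.
by move=> sub [s0 sS hs]; split=> // p q x y g g' /sub pps /sub qps; exact: hs.
Qed.

Variables (ebar : 'rV[R]_n) (hebar : sphere ebar).
Variables m1 m2 : {measure set (borel_mx R 1 n) -> \bar R}.
Hypotheses (finm1 : (m1 (@sphere R n) < +oo)%E) (zm1 : zonal ebar m1).
Hypotheses (finm2 : (m2 (@sphere R n) < +oo)%E) (zm2 : zonal ebar m2).

Let M1 := fine (m1 (@sphere R n)).
Let M2 := fine (m2 (@sphere R n)).

Lemma sconv_ge0 m f : zonal ebar m -> rot_cont f -> (forall x, sphere x -> 0 <= f x) ->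
  forall x, sphere x -> 0 <= sconv ebar f m x.
Proof.
move=> zm fc f0 x xS; have [g gS <-] := sphere_transitive n1 hebar xS.
rewrite (sconv_rotate n1 zm)//; apply: Rintegral_ge0 => v vS.
by apply: f0; exact: rotate_sphere.
Qed.

(** With q the double convolution and h = q^(n-1), commutation rewrites the mean of q^n = h q as an
    integral over [m2] of means of h(g ebar) F(g v). The power inequality bounds it by the means of
    q^n and of (M2 F)^n, and the former is absorbed on the left. *)
Lemma vol_sconv_le f : 0 < M2 -> rot_cont f -> (forall x, sphere x -> 0 <= f x) ->
  (vol (body_of (sconv ebar (sconv ebar f m2) m1)) <=
   vol (body_of (fun u => (M2 * sconv ebar f m1 u)%R)))%E.
Proof.
move=> M20 fc f0.
pose F := sconv ebar f m1; pose q := sconv ebar (sconv ebar f m2) m1.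
pose b (u : 'rV[R]_n) := M2 * F u.
pose h (u : 'rV[R]_n) := q u ^+ n.-1.
have M10 : 0 <= M1 by exact: fine_ge0.
have f2c := rot_cont_sconv n1 finm2 hebar zm2 fc.
have Fc : rot_cont F := rot_cont_sconv n1 finm1 hebar zm1 fc.
have qc : rot_cont q := rot_cont_sconv n1 finm1 hebar zm1 f2c.
have bc : rot_cont b by apply: (rot_contM n1) => //; exact: rot_cont_cst.
have hc : rot_cont h := rot_contX n1 n.-1 qc.
have F0 : forall x, sphere x -> 0 <= F x by exact: sconv_ge0.
have q0 : forall x, sphere x -> 0 <= q x.
  by apply: sconv_ge0 => //; exact: sconv_ge0.
have b0 x : sphere x -> 0 <= b x by move=> xS; rewrite mulr_ge0 ?F0// ltW.
rewrite -/q -/F -/b (vol_body_rot_cont qc q0) (vol_body_rot_cont bc b0) lee_fin.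
pose qn (u : 'rV[R]_n) := q u ^+ n; pose bn (u : 'rV[R]_n) := b u ^+ n.
have qnc : rot_cont qn := rot_contX n1 n qc.
have bnc : rot_cont bn := rot_contX n1 n bc.
have h2c := rot_cont_sconv n1 finm2 hebar zm2 hc.
have k0 := (leb_unit_ball R n).2.
pose c := M1 * M2 + M1 + M2.
have c0 : 0 <= c by rewrite !addr_ge0// ?mulr_ge0// ltW.
(* Two errors come from replacing ball integrals by averages, one from moving v to [ebar] in the
   mean of [bn], and the commutation error [e * c] is multiplied by n. *)
pose C := kappa R n * (3 + n%:R * c).
have C0 : 0 < C by rewrite mulr_gt0// ltr_wpDr// mulr_ge0.
apply/ler_addgt0Pr => eps eps0.
pose e := eps / C; have e0 : 0 < e by rewrite divr_gt0.
pose ps := [:: f; h; F; sconv ebar h m2; qn; bn; fun=> 1].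
have psc p : List.In p ps -> rot_cont p.
  by move=> /=; do 7![case=> [<-//|]]; first exact: rot_cont_cst.
have [s hs] : exists s, pair_average ps e s by exact: pair_averaging.
have [s0 sS _] := hs.
have ia : [/\ List.In qn ps, List.In bn ps & List.In (fun=> 1) ps] by split; rewrite /ps /=; tauto.
have [iq ib io] := ia.
have qn0 y : sphere y -> 0 <= qn y by move=> yS; rewrite exprn_ge0// q0.
have bn0 y : sphere y -> 0 <= bn y by move=> yS; rewrite exprn_ge0// b0.
have aq := cone_mean_average n2 s0 sS
  (fun y yS => pair_average_single n2 hs iq io yS hebar) qnc qn0.
have ab := cone_mean_average n2 s0 sS
  (fun y yS => pair_average_single n2 hs ib io yS hebar) bnc bn0.
set X := avg s (fun k => qn (rotate k ebar)) in aq.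
set Z := avg s (fun k => bn (rotate k ebar)) in ab.
have sub p : List.In p [:: f; h; F; sconv ebar h m2] -> List.In p ps by rewrite /ps /=; tauto.
have := sconv_commute n2 hebar finm1 zm1 finm2 zm2 fc hc (pair_average_sub sub hs).
rewrite -/q -/F -/M1 -/M2 -/c.
have nS : n = n.-1.+1 by rewrite prednK// (ltnW n1).
have -> : avg s (fun g => h (rotate g ebar) * q (rotate g ebar)) = X.
  by apply: eq_avg => g _; rewrite /qn /h -exprSr -nS.
have nn0 : 0 < n%:R :> R by rewrite ltr0n ltnW// ltnW.
set I := (\int[m2]_(v in _) _)%R => XI.
(* The power inequality applies to q and b = M2 F; the factor 1 / M2 left over cancels against the
   mass of [m2]. *)
have IK : n%:R * I <= n.-1%:R * X + Z + e.
  rewrite mulrC -ler_pdivlMr//.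
  have E : (n.-1%:R * X + Z + e) / n%:R = ((n.-1%:R * X + Z + e) / (n%:R * M2)) * M2.
    by field; rewrite !lt0r_neq0.
  rewrite E -(Rintegral_cst m2 (@sphere_measurable R n)).
  apply: (Rint_le (@sphere_measurable R n) finm2).
  - exact: (wavg1_bmeas n2).
  - exact: bmeas_cst.
  move=> v vS; rewrite ler_pdivlMr ?mulr_gt0// mulrC -avgZ.
  apply: (@le_trans _ _ (avg s (fun g => n.-1%:R * qn (rotate g ebar) + bn (rotate g v)))).
    apply: ler_avg => g /sS gS; have ge := rotate_sphere gS hebar.
    have gv := rotate_sphere gS vS.
    have := young_pow n.-1 (q0 _ ge) (b0 _ gv); rewrite -nS; congr (_ <= _).
    by rewrite /b /h; ring.
  rewrite avgD avgZ -addrA lerD2l.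
  have := pair_average_single n2 hs ib io vS hebar; rewrite -/Z.
  by rewrite ler_norml => /andP[_ ?]; lra.
have XZ : X <= Z + e + n%:R * (e * c).
  move: XI; rewrite ler_norml => /andP[_ XI].
  have {XI}XI : n%:R * X <= n%:R * I + n%:R * (e * c) by rewrite -mulrDr ler_pM2l//; lra.
  have nnE : n.-1%:R + 1 = n%:R :> R by rewrite natr1 -nS.
  have nX : n%:R * X = n.-1%:R * X + X by rewrite -[in LHS]nnE mulrDl mul1r.
  by move: XI; rewrite nX; lra.
have := ler_wpM2r (ltW k0) XZ.
move: aq ab; rewrite !ler_norml => /andP[_ aq] /andP[ab _].
have -> : eps = e * kappa R n * 3 + n%:R * (e * c) * kappa R n.
  rewrite (_ : eps = e * C); last by rewrite /e divfK// lt0r_neq0.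
  by rewrite /C; ring.
rewrite !mulrDl; move: aq ab; rewrite /qn /bn.
set t1 := \int[leb R n]_(x in _) _; set t2 := \int[leb R n]_(x in _) _.
by move=> aq ab h3; lra.
Qed.

End ConvolutionVolume.

(** * Uniform measures on great subspheres *)

Section Stabilizer.
Variables (R : realType) (n : nat).
Hypothesis n2 : (2 < n)%N.
Let n1 : (1 < n)%N := ltnW n2.
Implicit Types (f h p q : 'rV[R]_n -> R).

Lemma stab_transitive (e v w : 'rV[R]_n) : sphere e -> sphere v -> sphere w ->
  orth e v -> orth e w ->
  exists g, [/\ SO g, rotate g e = e & rotate g v = w].
Proof.
move=> eS /sphereP vS /sphereP wS ve we.
by apply: rotation_pair => //; rewrite ?vS ?wS// dotC ve dotC we.
Qed.

(** The index includes the outer rotation g, so the same list of stabilizer elements works for every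
    g. The averages agree because the stabilizer acts transitively on the unit vectors orthogonal to
    e. *)
Lemma stab_average (e : 'rV[R]_n) f eps : sphere e -> rot_cont f -> 0 < eps ->
  exists t, [/\ (0 < size t)%N, (forall k, k \in t -> SO k /\ rotate k e = e) &
    forall g v w, SO g -> sphere v -> sphere w -> orth e v -> orth e w ->
    `|avg t (fun k => f (rotate g (rotate k v))) -
      avg t (fun k => f (rotate g (rotate k w)))| <= eps].
Proof.
move=> eS fc eps0.
have [B B0 fB] := rot_cont_bounded n1 fc.
pose H : set 'M[R]_n := [set g | SO g /\ rotate g e = e].
pose phi (t : {g : 'M[R]_n | SO g} * {x : 'rV[R]_n | sphere x}) k :=
  f (rotate (sval t.1) (rotate k (sval t.2))).
have phic : equicont H phi.
  move=> e1 e10; have /rot_contP/(_ _ e10)[d d0 hd] := fc.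
  exists (d / n.+1%:R); first by rewrite divr_gt0.
  move=> [[g gS] [x xS]] k k' [kS _] [kS' _] kk'; rewrite /phi /= -!rotateM.
  apply: hd => //; try exact: SOM.
  rewrite -mulmxBr; apply: le_lt_trans (SO_mul_norm _ gS) _.
  apply: (@le_lt_trans _ _ (n.+1%:R * `|k - k'|)); first by rewrite ler_wpM2r// ler_nat.
  by rewrite mulrC -ltr_pdivlMr.
have phiB t k : H k -> `|phi t k| <= B.
  move: t => [[g gS] [x xS]] [kS _]; apply: fB.
  by apply: rotate_sphere => //; exact: rotate_sphere.
have [s [s0 sH hs]] := averaging (stab_subgroup e) phic phiB eps0.
exists s; split=> // g v w gS vS wS ve we.
have [z [zS ze zv]] := stab_transitive eS vS wS ve we.
have H1 : H 1%:M by split; [exact: SO1|rewrite rotate1].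
have := hs (exist _ g gS, exist _ v vS) 1%:M z H1 (conj zS ze).
rewrite /phi /=; under eq_avg do rewrite rotateM rotate1.
by under [X in _ - X]eq_avg do rewrite rotateM zv.
Qed.

Lemma orth_measurable (u : 'rV[R]_n) : measurable (orth u : set (borel_mx R 1 n)).
Proof.
rewrite -[X in measurable X]setTI.
have mf : measurable_fun setT (fun x : borel_mx R 1 n => dot (x : 'rV[R]_n) u).
  by apply: (@measurable_dot _ _ _ _ id (fun=> u)); [exact: measurable_id|exact: measurable_cst].
exact: (mf measurableT [set 0] (measurable_set1 0)).
Qed.

(** The rest of the sphere is null for [l], so the average has to be controlled only at v orthogonal
    to u; invariance under rotations fixing u gives all rotated copies the same integral. *)
Lemma uniform_average (u : 'rV[R]_n) (l : probability (borel_mx R 1 n) R) f g t a e :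
  uniform_subsphere u l -> rot_cont f -> (forall x, sphere x -> 0 <= f x) -> SO g ->
  (0 < size t)%N -> (forall k, k \in t -> SO k /\ rotate k u = u) ->
  (forall v, sphere v -> orth u v ->
     `|avg t (fun k => f (rotate g (rotate k v))) - a| <= e) ->
  `|\int[l]_(v in @sphere R n) f (rotate g v) - a| <= e.
Proof.
move=> [l1 linv] fc f0 gS t0 tS ha.
have mS := @sphere_measurable R n.
have mD : measurable (@sphere R n `&` orth u : set (borel_mx R 1 n)).
  by apply: measurableI => //; exact: orth_measurable.
have mN : measurable (@sphere R n `\` orth u : set (borel_mx R 1 n)).
  by apply: measurableD => //; exact: orth_measurable.
have N0 : l (@sphere R n `\` orth u) = 0%E.
  apply/eqP; rewrite eq_le measure_ge0 andbT.
  have <- : l (~` (@sphere R n `&` orth u)) = 0%E.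
    by rewrite probability_setC// [X in (_ - X)%E]l1 subee.
  apply: le_measure; rewrite ?inE//; first exact: measurableC.
  by move=> x [_ xu] [].
have fin : (l (@sphere R n `&` orth u) < +oo)%E by rewrite [X in (X < _)%E]l1 ltry.
have finS : (l (@sphere R n) < +oo)%E.
  by apply: le_lt_trans (probability_le1 l mS) (ltry _).
have SDE : @sphere R n `\` (@sphere R n `\` orth u) = @sphere R n `&` orth u.
  by rewrite setDD.
have red p : rot_cont p -> \int[l]_(v in @sphere R n) p v =
    \int[l]_(v in @sphere R n `&` orth u) p v.
  move=> pc; rewrite /Rintegral -SDE; congr fine; apply: negligible_integral => //.
  exact: (bmeas_integrable mS finS (rot_cont_bmeas n1 pc)).
have fgc k : SO k -> rot_cont (fun v => f (rotate g (rotate k v))).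
  move=> kS; have := rot_cont_comp (SOM gS kS) fc.
  by rewrite (_ : _ \o _ = fun v => f (rotate g (rotate k v)))//; apply/funext => v; rewrite /= rotateM.
have fg1 : rot_cont (fun v => f (rotate g v)) by exact: (rot_cont_comp gS fc).
have bmD p : rot_cont p -> @bmeas _ (borel_mx R 1 n) R (@sphere R n `&` orth u) p.
  move=> /(rot_cont_bmeas n1)[mp [B pB]]; split; last by exists B => x [] /pB.
  exact: (measurable_funS mS (@subIsetl _ _ _) mp).
have := @Rint_of_average _ (borel_mx R 1 n) R l _ mD fin _ t (fun v => f (rotate g v))
  (fun k v => f (rotate g (rotate k v))) a e t0.
rewrite [fine _](_ : _ = 1) ?mulr1 -?red//; last by rewrite [X in fine X]l1.
apply.
- by move=> k /tS[kS _]; exact/bmD/fgc.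
- move=> k /tS[kS ku]; rewrite -!red//; last exact: fgc.
  apply: (@Rint_pushforward _ (borel_mx R 1 n) R l _ (rotate k) (fun v => f (rotate g v))) => //.
  + exact: rotate_measurable.
  + by apply/seteqP; split=> x /=; rewrite rot_sphere.
  + by move=> A mA; exact: linv.
  + exact: rot_cont_measurable.
  + by move=> x xS; apply: f0; exact: rotate_sphere.
- by move=> v [vS vu]; exact: ha.
Qed.

Lemma exists_sphere_orth (e : 'rV[R]_n) : exists2 v, sphere v & orth e v.
Proof.
have [v [vS ev]] := exists_unit_orth e n1; exists v => //.
by rewrite /orth /= dotC /dot ev mxE.
Qed.

(** A uniqueness statement: both integrals are within eps / 2 of the same finite average, so the
    uniform measure at g e acts on f as the image under g of the one at e. *)
Lemma uniform_rotate (e : 'rV[R]_n) g f (l l' : probability (borel_mx R 1 n) R) :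
  sphere e -> SO g -> uniform_subsphere e l -> uniform_subsphere (rotate g e) l' ->
  rot_cont f -> (forall x, sphere x -> 0 <= f x) ->
  \int[l']_(v in @sphere R n) f v = \int[l]_(v in @sphere R n) f (rotate g v).
Proof.
move=> eS gS ul ul' fc f0; apply/eqP; rewrite -subr_eq0 -normr_le0.
apply/ler_addgt0Pr => eps eps0; rewrite add0r.
have eps2 : 0 < eps / 2 by rewrite divr_gt0.
have [t [t0 tS ht]] := stab_average eS fc eps2.
have [v0 v0S v0e] := exists_sphere_orth e.
pose a := avg t (fun k => f (rotate g (rotate k v0))).
have h1 : `|\int[l]_(v in @sphere R n) f (rotate g v) - a| <= eps / 2.
  by apply: (uniform_average ul fc f0 gS t0 tS) => v vS ve; exact: ht.
have h2 : `|\int[l']_(v in @sphere R n) f v - a| <= eps / 2.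
  have -> : \int[l']_(v in @sphere R n) f v = \int[l']_(v in @sphere R n) f (rotate 1%:M v).
    by apply: eq_Rintegral => v _; rewrite rotate1.
  (* Conjugation by g turns rotations fixing e into rotations fixing g e. *)
  apply: (uniform_average (t := [seq g *m k *m g^T | k <- t]) ul' fc f0 (SO1 R n)).
  - by rewrite size_map.
  - move=> _ /mapP[k /tS[kS ke] ->]; split.
      by apply: SOM; [exact: SOM|exact: SOV].
    by rewrite !rotateM rotateK// ke.
  - move=> v vS ve; rewrite /avg size_map big_map.
    have wS := rotate_sphere (SOV gS) vS.
    have we : orth e (rotate g^T v).
      by rewrite /orth /= -(dot_rotate _ _ gS) rotateVK.
    under eq_bigr do rewrite rotate1 !rotateM.
    exact: (ht g _ _ gS wS v0S we v0e).
rewrite -[X in `|X|](subrKA a) (splitr eps) (le_trans (ler_normD _ _))//.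
by rewrite lerD// distrC.
Qed.

Lemma body_of_ext (r r' : 'rV[R]_n -> R) : (forall u, sphere u -> r u = r' u) ->
  body_of r = body_of r'.
Proof.
move=> rr; apply/seteqP; split=> x [u [t [uS tr xE]]]; exists u, t; split=> //.
  by rewrite -rr.
by rewrite rr.
Qed.

End Stabilizer.

(** * Sections by subspaces *)

Section OrthonormalBases.
Variables (R : realType) (n : nat).

Lemma gram_schmidt m (A : 'M[R]_(m, n)) : row_free A ->
  exists B : 'M[R]_(m, n), B *m B^T = 1%:M /\ (B :=: A)%MS.
Proof.
elim: m A => [|m IH] A fA.
  by exists A; split => //; apply/matrixP => -[].
rewrite -[A](@vsubmxK _ 1 m) in fA *.
move: (@usubmx _ 1 m n A) (@dsubmx _ 1 m n A) fA => a A' fA {A}.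
have rA : \rank (col_mx a A') = m.+1 by exact/eqP.
have rs : \rank (a + A')%MS = m.+1 by rewrite addsmxE.
have fA' : row_free A'.
  rewrite /row_free eqn_leq rank_leq_row /=.
  have := mxrank_adds_leqif a A' => -[+ _]; rewrite rs => h.
  have := leq_trans h (leq_add (rank_leq_row a) (leqnn _)).
  by rewrite add1n ltnS.
have [B' [B1 B2]] := IH _ fA'.
(* The component of [a] orthogonal to the span already treated; it is nonzero because the rows are
   independent. *)
pose a' := a - a *m B'^T *m B'.
have a'B : a' *m B'^T = 0.
  by rewrite /a' mulmxBl -[a *m _ *m _ *m _]mulmxA B1 mulmx1 subrr.
have a'0 : a' != 0.
  apply/eqP => /subr0_eq aE.
  have : (a <= A')%MS by rewrite -B2 aE submxMl.
  move/addsmx_idPr => h; move: rs; rewrite h.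
  by move=> rA'; have := rank_leq_row A'; rewrite rA' ltnn.
have e0 : 0 < enorm a' by rewrite enorm_gt0.
pose e : 'rV[R]_n := hat a'.
have eS : e *m e^T = 1%:M.
  by rewrite dot_scalar; have /sphereP -> := hat_sphere e0.
have eB : e *m B'^T = 0 by rewrite /e /hat -scalemxAl a'B scaler0.
have BB : col_mx e B' *m (col_mx e B')^T = 1%:M.
  rewrite tr_col_mx mul_col_row eS B1 eB -[B' *m e^T]trmxK trmx_mul trmxK eB trmx0.
  by rewrite -scalar_mx_block.
exists (col_mx e B'); split; first exact: BB.
apply: (eqmx_trans (eqmx_sym (addsmxE e B'))).
apply: eqmx_trans (addsmxE a A').
apply/eqmxP/andP; split.
  rewrite addsmx_sub; apply/andP; split.
    rewrite /e /hat scalemx_sub// /a' addmx_sub ?addsmxSl//.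
    by rewrite eqmx_opp (submx_trans (submxMl _ _))// B2 addsmxSr.
  by rewrite B2 addsmxSr.
rewrite addsmx_sub; apply/andP; split; last by rewrite -B2 addsmxSr.
rewrite -[a](subrK (a *m B'^T *m B')) -/a' addmx_sub//.
  rewrite -(hatK e0) scalemx_sub// addsmxSl//.
by rewrite (submx_trans (submxMl _ _))// addsmxSr.
Qed.

Lemma onbasis_exists i (P : 'M[R]_n) : \rank P = i ->
  exists B : 'M[R]_(i, n), B *m B^T = 1%:M /\ (B :=: P)%MS.
Proof.
move=> <-; have [B [B1 B2]] := gram_schmidt (row_base_free P).
by exists B; split=> //; exact: eqmx_trans B2 (eq_row_base P).
Qed.

Lemma onbasisP i (P : 'M[R]_n) : Gr i P ->
  onbasis i P *m (onbasis i P)^T = 1%:M /\ (onbasis i P :=: P)%MS.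
Proof.
move=> [_ _ rP]; have [B hB] := onbasis_exists rP.
exact: (xgetPex (P := [set B | B *m B^T = 1%:M /\ (B :=: P)%MS]) 0 (ex_intro _ B hB)).
Qed.

Lemma Gr_projection i (P : 'M[R]_n) (B : 'M[R]_(i, n)) : Gr i P ->
  B *m B^T = 1%:M -> (B :=: P)%MS -> P = B^T *m B.
Proof.
move=> [PT PP _] BB BP.
have /submxP[X BE] : (B <= P)%MS by rewrite BP.
have /submxP[Y PE] : (P <= B)%MS by rewrite BP.
have h1 : B *m P = B by rewrite BE -mulmxA PP.
have h2 : P *m (B^T *m B) = P by rewrite {1}PE -!mulmxA (mulmxA B) BB mul1mx -PE.
have := congr1 trmx h2; rewrite !trmx_mul trmxK PT -mulmxA h1 => <-.
by [].
Qed.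

Lemma Gr_of_basis i (B : 'M[R]_(i, n)) : B *m B^T = 1%:M -> Gr i (B^T *m B).
Proof.
move=> BB; split.
- by rewrite trmx_mul trmxK.
- by rewrite -mulmxA (mulmxA B) BB mul1mx.
have fB : row_free B by apply/row_freeP; exists B^T.
apply: etrans (eqP fB); apply/eqP; rewrite eqn_leq; apply/andP; split; first exact: mxrankM_maxr.
by apply: mxrankS; rewrite -{1}[B]mul1mx -BB -mulmxA submxMl.
Qed.

Section Frame.
Variables (i : nat) (B0 : 'M[R]_(i, n)).
Hypotheses (hin : (i < n)%N) (BB0 : B0 *m B0^T = 1%:M).

(** The orthogonal projection onto the image under g of the row space of [B0], written as the
    conjugation action with respect to which [haar_Gr] is invariant. *)
Definition conj_proj (g : 'M[R]_n) : 'M[R]_n := g *m (B0^T *m B0) *m g^T.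

Lemma conj_projE g : conj_proj g = (B0 *m g^T)^T *m (B0 *m g^T).
Proof. by rewrite /conj_proj trmx_mul trmxK !mulmxA. Qed.

Lemma frame_orthonormal g : SO g -> B0 *m g^T *m (B0 *m g^T)^T = 1%:M.
Proof.
move=> [/mulmx1C gg _].
by rewrite trmx_mul trmxK mulmxA -(mulmxA B0) gg mulmx1.
Qed.

(** Orthonormal frames have equal Gram matrices, so a rotation carries one to another when i < n.
    Being one orbit, the Grassmannian is compact and falls under [measurable_orbit]. *)
Lemma Gr_orbit : @Gr R n i = conj_proj @` @SO R n.
Proof.
apply/seteqP; split=> [P GP|_ [g gS <-]]; last first.
  by rewrite conj_projE; apply: Gr_of_basis; exact: frame_orthonormal.
have [B1 B2] := onbasisP GP.
have [g [gS gB]] := gram_rotation hin (etrans BB0 (esym B1)).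
by exists g => //; rewrite conj_projE gB -(Gr_projection GP B1 B2).
Qed.

End Frame.

(** Rotate the first i coordinate vectors by a rotation taking some unit vector orthogonal to them
    to [e]. *)
Lemma frame_orth (e : 'rV[R]_n) i : (0 < i)%N -> (i < n)%N -> sphere e ->
  exists B0 : 'M[R]_(i, n), B0 *m B0^T = 1%:M /\ B0 *m e^T = 0.
Proof.
move=> i0 hin eS; pose B1 : 'M[R]_(i, n) := pid_mx i.
have B11 : B1 *m B1^T = 1%:M.
  by rewrite tr_pid_mx mul_pid_mx !minnn (minn_idPr (ltnW hin)) pid_mx_1.
have [z [zS Bz]] := exists_unit_orth B1 hin.
have n1 : (1 < n)%N by exact: leq_ltn_trans hin.
have [g gS ge] := sphere_transitive n1 zS eS.
exists (B1 *m g^T); split; first exact: frame_orthonormal.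
rewrite -ge /rotate trmx_mul trmxK mulmxA -(mulmxA B1).
by have [/mulmx1C -> _] := gS; rewrite mulmx1.
Qed.

End OrthonormalBases.

Section Sections.
Variables (R : realType) (n i : nat).
Hypotheses (n1 : (1 < n)%N) (i0 : (0 < i)%N).
Implicit Types (r : 'rV[R]_n -> R) (B : 'M[R]_(i, n)).

Lemma frame_sphere B (y : 'rV[R]_i) : B *m B^T = 1%:M -> sphere y -> sphere (y *m B).
Proof.
move=> BB /sphereP yS; apply/sphereP.
by rewrite /dot trmx_mul mulmxA -(mulmxA y) BB mulmx1.
Qed.

Lemma frame_bmeas r B : B *m B^T = 1%:M -> rot_cont r ->
  @bmeas _ (borel_mx R 1 i) R (@sphere R i) (fun y => r (y *m B)).
Proof.
move=> BB /(rot_cont_bmeas n1)[mr [M rM]]; split; last first.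
  by exists M => y yS; apply: rM; exact: frame_sphere.
apply: (@measurable_comp _ _ _ (borel_mx R 1 i) (borel_mx R 1 n) _ (@sphere R n) r
  (@sphere R i) (fun y => (y : 'rV[R]_i) *m B)).
- exact: sphere_measurable.
- by move=> _ [y yS <-]; exact: frame_sphere.
- exact: mr.
apply: measurable_funTS; apply: measurable_mx => a b.
under eq_fun do rewrite mxE.
apply: measurable_sum => k; apply: measurable_funM => //; exact: measurable_coord.
Qed.

Lemma section_body (L : set 'rV[R]_n) B : star_body L -> B *m B^T = 1%:M ->
  [set y : 'rV[R]_i | L (y *m B)] = body_of (fun y => radial L (y *m B)).
Proof.
move=> hL BB; have [cL stL posL _] := hL.
have [z [zS _]] := exists_unit_orth (0 : 'M[R]_(0, i)) i0.
apply/seteqP; split=> y.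
  move=> Ly; have [->|y0] := eqVneq y 0.
    exists z, 0; split=> //; last by rewrite scale0r.
    by rewrite lexx ltW// posL//; exact: frame_sphere.
  have y1 : 0 < enorm y by rewrite enorm_gt0.
  exists (hat y), (enorm y); split; [exact: hat_sphere| |by rewrite hatK].
  rewrite enorm_ge0 /=.
  apply: (radial_max hL (frame_sphere BB (hat_sphere y1))).2.
  by rewrite scalemxAl hatK.
move=> [u [t [uS /andP[t0 tr] ->]]] /=.
have uB := frame_sphere BB uS; have r0 := posL _ uB.
have := stL _ (radial_max hL uB).1 (t / radial L (u *m B)).
rewrite scalerA divfK ?lt0r_neq0// scalemxAl; apply.
by rewrite divr_ge0 ?(ltW r0)//= ler_pdivrMr// mul1r.
Qed.

(** For an orthonormal frame this is kappa_i times the mean of [r] over the unit sphere of its span;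
    for r the i-th power of the radial function it is the volume of the section. *)
Definition frame_int r B : R :=
  \int[leb R i]_(y in @punctured_ball R i) r (hat y *m B).

Lemma finDi : (leb R i (@punctured_ball R i) < +oo)%E.
Proof. by rewrite (leb_punctured_ball R i0) ltry. Qed.

Lemma fineDi : fine (leb R i (@punctured_ball R i)) = kappa R i.
Proof. by rewrite (leb_punctured_ball R i0). Qed.

Lemma frame_int_ge0 r B : B *m B^T = 1%:M -> (forall x, sphere x -> 0 <= r x) ->
  0 <= frame_int r B.
Proof.
move=> BB r0; apply: Rintegral_ge0 => y /andP[y0 _]; apply: r0.
by apply: frame_sphere => //; exact: hat_sphere.
Qed.

(** Frames of the same subspace differ by an orthogonal i by i matrix, which preserves [leb]. This
    makes the arbitrary choice in [onbasis] harmless. *)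
Lemma frame_int_orthogonal r B B' : B *m B^T = 1%:M -> B' *m B'^T = 1%:M ->
  B^T *m B = B'^T *m B' -> rot_cont r -> (forall x, sphere x -> 0 <= r x) ->
  frame_int r B = frame_int r B'.
Proof.
move=> BB BB' PP rc r0; pose O := B' *m B^T.
have BE : B' = O *m B by rewrite /O -mulmxA PP mulmxA BB' mul1mx.
have OO : O *m O^T = 1%:M.
  by rewrite /O trmx_mul trmxK mulmxA -(mulmxA B') PP mulmxA BB' mul1mx BB'.
rewrite /frame_int -(@Rint_hat_orthogonal _ _ (fun y => r (y *m B)) O OO).
- by apply: eq_Rintegral => y _; rewrite BE mulmxA.
- by have [] := frame_bmeas BB rc.
- by move=> y yS; apply: r0; exact: frame_sphere.
Qed.

Lemma frame_int_cont r B e : B *m B^T = 1%:M -> rot_cont r -> 0 < e ->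
  exists2 d, 0 < d & forall g h : 'M[R]_n, SO g -> SO h -> `|g - h| < d ->
    `|frame_int r (B *m g^T) - frame_int r (B *m h^T)| <= e.
Proof.
move=> BB rc e0; have k0 := (leb_unit_ball R i).2.
have /rot_contP/(_ _ (divr_gt0 e0 k0))[d d0 hd] := rc.
exists d => // g h gS hS gh.
rewrite -[leRHS](divfK (lt0r_neq0 k0)) -fineDi.
apply: (Rint_dist (@punctured_ball_measurable R i) finDi).
- exact: (comp_hat_bmeas (frame_bmeas (frame_orthonormal BB gS) rc)).
- exact: (comp_hat_bmeas (frame_bmeas (frame_orthonormal BB hS) rc)).
move=> y /andP[y0 _]; rewrite fineDi !mulmxA; apply: hd => //.
by apply: frame_sphere => //; exact: hat_sphere.
Qed.

Lemma frame_int_bounded r : rot_cont r -> exists2 M, 0 <= M &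
  forall B, B *m B^T = 1%:M -> `|frame_int r B| <= M.
Proof.
move=> rc; have [M M0 rM] := rot_cont_bounded n1 rc.
have k0 := (leb_unit_ball R i).2.
exists (M * kappa R i); first by rewrite mulr_ge0// ltW.
move=> B BB; rewrite -fineDi.
apply: (Rint_norm_le (@punctured_ball_measurable R i) finDi).
  exact: (comp_hat_bmeas (frame_bmeas BB rc)).
move=> y /andP[y0 _]; apply: rM; apply: frame_sphere => //; exact: hat_sphere.
Qed.

Lemma sub_vol_frame (L : set 'rV[R]_n) (P : 'M[R]_n) B : star_body L ->
  Gr i P -> B *m B^T = 1%:M -> P = B^T *m B ->
  sub_vol i P (L `&` subspace_of P) = (frame_int (fun x => radial L x ^+ i) B)%:E.
Proof.
move=> hL GP BB PE; have [C1 C2] := onbasisP GP; set C := onbasis i P in C1 C2.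
have [_ _ posL rcL] := hL.
have radc : rot_cont (radial L) := continuous_rot_cont rcL.
have [M _ rM] := rot_cont_bounded n1 radc.
have rad0 x : sphere x -> 0 <= radial L x by move=> /posL/ltW.
rewrite /sub_vol -/C.
have -> : [set y : 'rV[R]_i | (L `&` subspace_of P) (y *m C)] = [set y | L (y *m C)].
  apply/seteqP; split=> y /=; first by case.
  by move=> Ly; split=> //; rewrite /subspace_of /= -C2 submxMl.
rewrite section_body// (@vol_body_of R i i0 _ M); first last.
- move=> u uS; have uC := frame_sphere C1 uS.
  by rewrite rad0//= (le_trans (ler_norm _))// rM.
- by have [] := frame_bmeas C1 radc.
have ric : rot_cont (fun x => radial L x ^+ i) by exact: rot_contX.
rewrite (frame_int_orthogonal (B' := C))//; last first.
- by move=> x xS; rewrite exprn_ge0// rad0.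
- by rewrite -PE (Gr_projection GP C1 C2).
apply: (@int_bmeas _ (borel_mx R 1 i) R (leb R i) _ (@punctured_ball_measurable R i) finDi
  (fun y => radial L (hat y *m C) ^+ i)).
  exact: (comp_hat_bmeas (frame_bmeas C1 ric)).
move=> y /andP[y0 _]; rewrite exprn_ge0// rad0//.
by apply: frame_sphere => //; exact: hat_sphere.
Qed.

End Sections.

(** * Elementary inequalities for powers and averages *)

Section PowerMeans.
Variable R : realType.

(** The power inequality rearranges to a^(m+1) - b^(m+1) <= (m + 1) a^m (a - b), the tangent bound
    at a. *)
Lemma pow_lipschitz (x y M : R) m : 0 <= x <= M -> 0 <= y <= M ->
  `|x ^+ m.+1 - y ^+ m.+1| <= m.+1%:R * M ^+ m * `|x - y|.
Proof.
have key (a b : R) : 0 <= a <= M -> 0 <= b <= M ->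
    a ^+ m.+1 - b ^+ m.+1 <= m.+1%:R * M ^+ m * `|a - b|.
  move=> /andP[a0 aM] /andP[b0 bM].
  apply: (@le_trans _ _ (m.+1%:R * a ^+ m * (a - b))).
    have := young_pow m a0 b0; rewrite -subr_ge0 => h; rewrite -subr_ge0.
    move: h; congr (_ <= _); rewrite -!natr1 [a ^+ m.+1]exprS; ring.
  apply: (@le_trans _ _ (m.+1%:R * a ^+ m * `|a - b|)).
    by rewrite ler_wpM2l ?ler_norm// mulr_ge0// exprn_ge0.
  by rewrite ler_wpM2r// ler_wpM2l// lerXn2r ?nnegrE// (le_trans a0).
move=> hx hy; rewrite ler_norml lerNl opprB {1}distrC.
by rewrite !key.
Qed.

(** Average the power inequality with its first argument fixed at the mean: this is the tangent line
    argument for Jensen. *)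
Lemma jensen_avg (T : eqType) (s : seq T) (f : T -> R) m : (0 < size s)%N ->
  (forall g, g \in s -> 0 <= f g) -> avg s f ^+ m.+1 <= avg s (fun g => f g ^+ m.+1).
Proof.
move=> s0 f0; set x := avg s f.
have x0 : 0 <= x by rewrite -[0](@avg_cst R _ s 0 s0); exact: ler_avg.
have : avg s (fun g => m.+1%:R * x ^+ m * f g) <=
    avg s (fun g => m%:R * x ^+ m.+1 + f g ^+ m.+1).
  by apply: ler_avg => g /f0 fg; rewrite -mulrA; exact: young_pow.
rewrite avgZ avgD avg_cst// -/x -mulrA -exprSr -natr1 mulrDl mul1r.
by rewrite lerD2l.
Qed.

End PowerMeans.

(** * Second inequality: intersection bodies and sections by subspaces *)

Section IntersectionBodies.
Variables (R : realType) (n i : nat).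
Hypotheses (n2 : (2 < n)%N) (i0 : (0 < i)%N) (hin : (i < n)%N).
Let n1 : (1 < n)%N := ltnW n2.

Lemma measurable_conj (k : 'M[R]_n) :
  measurable_fun setT (fun P : borel_mx R n n => k *m (P : 'M[R]_n) *m k^T : borel_mx R n n).
Proof.
apply: measurable_mx => a b; under eq_fun do rewrite mxE.
apply: measurable_sum => c; apply: measurable_funM => //.
under eq_fun do rewrite mxE.
apply: measurable_sum => d; apply: measurable_funM => //; exact: measurable_coord.
Qed.

Variables (L : set 'rV[R]_n) (hL : star_body L).
Variables (ebar : 'rV[R]_n) (hebar : sphere ebar).
Variables (l : probability (borel_mx R 1 n) R) (hl : uniform_subsphere ebar l).
Variables (nu : probability (borel_mx R n n) R) (hnu : haar_Gr i nu).

Definition radial_pow (u : 'rV[R]_n) : R := radial L u ^+ i.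

Lemma radial_pow_ge0 u : sphere u -> 0 <= radial_pow u.
Proof. by have [_ _ pos _] := hL => /pos r0; rewrite exprn_ge0// ltW. Qed.

Lemma radial_pow_cont : rot_cont radial_pow.
Proof.
by have [_ _ _ cL] := hL; apply: (rot_contX n1); exact: continuous_rot_cont.
Qed.

Lemma finS (m : probability (borel_mx R 1 n) R) : (m (@sphere R n) < +oo)%E.
Proof. exact: le_lt_trans (probability_le1 m (@sphere_measurable R n)) (ltry _). Qed.

Definition section_vol (P : 'M[R]_n) : R :=
  fine (sub_vol i P (L `&` subspace_of P)).

Section Frame.
Variable B0 : 'M[R]_(i, n).
Hypotheses (BB0 : B0 *m B0^T = 1%:M).

(** The volume V_i of the section of L by gE, where E is the row space of [B0]. *)
Let a (g : 'M[R]_n) := frame_int radial_pow (B0 *m g^T).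

Lemma sub_vol_conj g : SO g ->
  sub_vol i (conj_proj B0 g) (L `&` subspace_of (conj_proj B0 g)) = (a g)%:E.
Proof.
move=> gS; apply: (sub_vol_frame n1 i0) => //.
- by rewrite (Gr_orbit hin BB0); exists g.
- exact: frame_orthonormal.
- exact: conj_projE.
Qed.

Lemma section_vol_conj g : SO g -> section_vol (conj_proj B0 g) = a g.
Proof. by move=> gS; rewrite /section_vol sub_vol_conj. Qed.

Lemma conj_proj_lipschitz g h : SO g -> SO h ->
  `|conj_proj B0 g - conj_proj B0 h| <=
    (n%:R * (n%:R * `|B0^T *m B0|) *+ 2) * `|g - h|.
Proof.
move=> gS hS; set P := B0^T *m B0; rewrite /conj_proj -/P.
have -> : g *m P *m g^T - h *m P *m h^T = g *m (P *m (g - h)^T) + (g - h) *m P *m h^T.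
  by rewrite linearB/= !mulmxBl !mulmxBr !mulmxA addrA subrK.
have nT : `|(g - h)^T| <= `|g - h|.
  by apply: mx_normP => // b c; rewrite mxE le_mx_norm.
rewrite mulr2n mulrDl (le_trans (ler_normD _ _))// lerD//.
  apply: le_trans (SO_mul_norm _ gS) _; rewrite -mulrA ler_wpM2l//.
  apply: le_trans (mulmx_norm _ _) _.
  by rewrite ler_wpM2l ?mulr_ge0.
apply: le_trans (SO_mulr_norm _ (SOV hS)) _; rewrite -mulrA ler_wpM2l//.
by apply: le_trans (mulmx_norm _ _) _; rewrite mulrAC.
Qed.

Lemma a_bounds : exists2 M, 0 <= M & forall g, SO g -> 0 <= a g <= M.
Proof.
have [M M0 hM] := frame_int_bounded n1 i0 radial_pow_cont.
exists M => // g gS; rewrite (frame_int_ge0 (frame_orthonormal BB0 gS) radial_pow_ge0)/=.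
by apply: le_trans (ler_norm _) (hM _ (frame_orthonormal BB0 gS)).
Qed.

Lemma a_pow_cont e : 0 < e -> exists2 d, 0 < d & forall g h, SO g -> SO h ->
  `|g - h| < d -> `|a g ^+ n - a h ^+ n| <= e.
Proof.
move=> e0; have [M M0 hM] := a_bounds.
have K0 : 0 < n%:R * M ^+ n.-1 + 1 by rewrite ltr_wpDl// mulr_ge0// exprn_ge0.
have [d d0 hd] := frame_int_cont n1 i0 BB0 radial_pow_cont (divr_gt0 e0 K0).
exists d => // g h gS hS gh; have nS : n.-1.+1 = n by rewrite prednK// ltnW.
have := pow_lipschitz n.-1 (hM _ gS) (hM _ hS); rewrite nS => /le_trans; apply.
apply: (@le_trans _ _ ((n%:R * M ^+ n.-1 + 1) * `|a g - a h|)).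
  by rewrite ler_wpM2r// lerDl.
by rewrite mulrC -ler_pdivlMr//; exact: hd.
Qed.

Lemma Gr_measurable : measurable (@Gr R n i : set (borel_mx R n n)).
Proof.
rewrite -[X in measurable X]setCK; apply: measurableC.
apply: sub_sigma_algebra; apply: closed_openC.
rewrite (Gr_orbit hin BB0); apply: compact_closed; first exact: norm_hausdorff.
apply: continuous_compact; last exact: SO_compact.
exact: lipschitz_within conj_proj_lipschitz.
Qed.

Lemma section_vol_bmeas : @bmeas _ (borel_mx R n n) R (@Gr R n i) (fun P => section_vol P ^+ n).
Proof.
have [M M0 hM] := a_bounds; rewrite (Gr_orbit hin BB0); split; last first.
  exists (M ^+ n) => _ [g gS <-]; rewrite section_vol_conj//.
  have /andP[a0 aM] := hM _ gS.
  by rewrite ger0_norm ?exprn_ge0// lerXn2r ?nnegrE.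
apply: (measurable_orbit (C := (n%:R * (n%:R * `|B0^T *m B0|) *+ 2))).
  exact: conj_proj_lipschitz.
move=> e e0; have [d d0 hd] := a_pow_cont e0; exists d => // _ g h gS hS gh.
by rewrite /= !section_vol_conj//; exact: hd.
Qed.

Lemma conj_conj_proj k g : k *m conj_proj B0 g *m k^T = conj_proj B0 (k *m g).
Proof. by rewrite /conj_proj trmx_mul !mulmxA. Qed.

Lemma section_vol_ge0 P : Gr i P -> 0 <= section_vol P.
Proof.
rewrite (Gr_orbit hin BB0) => -[g gS <-]; rewrite section_vol_conj//.
by have [M _ hM] := a_bounds; have /andP[] := hM _ gS.
Qed.

(** Invariance of [nu] under conjugation plays the role that orthogonal invariance plays for the
    ball: it recovers the integral over the Grassmannian from a finite average of [a]. *)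
Lemma section_vol_average s e : (0 < size s)%N -> (forall g, g \in s -> SO g) ->
  (forall g, SO g -> `|avg s (fun k => a (k *m g) ^+ n) - avg s (fun k => a k ^+ n)| <= e) ->
  `|\int[nu]_(P in @Gr R n i) (section_vol P ^+ n) - avg s (fun k => a k ^+ n)| <= e.
Proof.
move=> s0 sS hs; have [nu1 nuinv] := hnu.
have fin : (nu (@Gr R n i) < +oo)%E by rewrite [X in (X < _)%E]nu1 ltry.
have preGr k : SO k -> (fun P : 'M[R]_n => k *m P *m k^T) @^-1` (@Gr R n i) = @Gr R n i.
  move=> kS; rewrite (Gr_orbit hin BB0); apply/seteqP; split=> P /=.
    move=> [g gS gP]; exists (k^T *m g); first by apply: SOM => //; exact: SOV.
    rewrite -conj_conj_proj gP trmxK !mulmxA; have [/mulmx1C kk _] := kS.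
    by rewrite kk mul1mx -mulmxA kk mulmx1.
  by move=> [g gS <-]; rewrite conj_conj_proj; exists (k *m g) => //; exact: SOM.
have [mv [M hM]] := section_vol_bmeas.
have := @Rint_of_average _ (borel_mx R n n) R nu _ Gr_measurable fin _ s
  (fun P => section_vol P ^+ n) (fun k P => section_vol (k *m P *m k^T) ^+ n)
  (avg s (fun k => a k ^+ n)) e s0.
rewrite [fine _](_ : _ = 1) ?mulr1; last by rewrite [X in fine X]nu1.
apply.
- move=> k /sS kS; split; last first.
    by exists M => P GP; apply: hM; have := preGr k kS => /seteqP[_]; apply.
  apply: (@measurable_comp _ _ _ (borel_mx R n n) (borel_mx R n n) _ (@Gr R n i)
    (fun P => section_vol P ^+ n) (@Gr R n i) (fun P => k *m (P : 'M[R]_n) *m k^T)).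
  + exact: Gr_measurable.
  + by move=> _ [P GP <-]; have := preGr k kS => /seteqP[_]; apply.
  + exact: mv.
  + by apply: measurable_funTS; exact: measurable_conj.
- move=> k /sS kS.
  apply: (@Rint_pushforward _ (borel_mx R n n) R nu (@Gr R n i)
    (fun P => k *m (P : 'M[R]_n) *m k^T) (fun P => section_vol P ^+ n)).
  + exact: Gr_measurable.
  + exact: measurable_conj.
  + exact: preGr.
  + by move=> A mA; exact: nuinv.
  + exact: mv.
  + by move=> P GP; rewrite exprn_ge0// section_vol_ge0.
move=> P; rewrite {1}(Gr_orbit hin BB0) => -[g gS <-].
rewrite (eq_avg (h := fun k => a (k *m g) ^+ n)); first exact: hs.
by move=> k /sS kS; rewrite conj_conj_proj section_vol_conj//; exact: SOM.
Qed.

Hypothesis B0e : B0 *m ebar^T = 0.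

Let F := sconv ebar radial_pow l.

(* Averaging over the stabilizer of ebar turns the integral over one i-dimensional
   great subsphere orthogonal to ebar into the integral over S cap ebar^perp. *)
Lemma subsphere_mean e : 0 < e -> exists t, [/\ (0 < size t)%N,
    (forall k, k \in t -> SO k) & forall g, SO g ->
    `|kappa R i * F (rotate g ebar) - avg t (fun k => a (g *m k))| <= e].
Proof.
move=> e0; have k0 := (leb_unit_ball R i).2.
(* Two errors of this size occur, and each is multiplied by kappa_i. *)
have e1 : 0 < e / (2 * kappa R i) by rewrite divr_gt0// mulr_gt0.
have [t [t0 tS ht]] := stab_average n2 hebar radial_pow_cont e1.
exists t; split=> // [k /tS[]//|g gS].
have [v0 v0S v0e] := exists_sphere_orth n2 ebar.
pose c := avg t (fun k => radial_pow (rotate g (rotate k v0))).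
have h1 : `|F (rotate g ebar) - c| <= e / (2 * kappa R i).
  have zl : zonal ebar l := hl.2.
  rewrite /F (sconv_rotate n1 zl radial_pow_cont gS).
  apply: (uniform_average n2 hl radial_pow_cont radial_pow_ge0 gS t0 tS) => v vS ve.
  exact: ht.
have aE k : a (g *m k) = \int[leb R i]_(y in @punctured_ball R i)
    radial_pow (rotate g (rotate k (hat y *m B0))).
  by apply: eq_Rintegral => y _; rewrite /rotate trmx_mul !mulmxA.
have bm k : k \in t -> @bmeas _ (borel_mx R 1 i) R (@punctured_ball R i)
    (fun y => radial_pow (rotate g (rotate k (hat y *m B0)))).
  move=> /tS[kS _].
  have := comp_hat_bmeas (frame_bmeas n1 (frame_orthonormal BB0 (SOM gS kS)) radial_pow_cont).
  rewrite (_ : _ \o _ = (fun y => radial_pow (rotate g (rotate k (hat y *m B0)))))//.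
  by apply/funext => y; rewrite /= /rotate trmx_mul !mulmxA.
have h2 : `|avg t (fun k => a (g *m k)) - c * kappa R i| <= e / (2 * kappa R i) * kappa R i.
  under eq_avg do rewrite aE.
  rewrite -(@Rint_avg _ (borel_mx R 1 i) R (leb R i) _ (@punctured_ball_measurable R i)
    (finDi R i0) _ t (fun k y => radial_pow (rotate g (rotate k (hat y *m B0)))) bm).
  rewrite -(fineDi R i0).
  apply: (Rint_const_dist (@punctured_ball_measurable R i) (finDi R i0)).
    exact: (bmeas_avg bm).
  move=> y /andP[y0 _]; rewrite (fineDi R i0); apply: ht => //.
    by apply: frame_sphere => //; exact: hat_sphere.
  by rewrite /orth /= /dot -mulmxA B0e mulmx0 mxE.
have -> : kappa R i * F (rotate g ebar) - avg t (fun k => a (g *m k)) =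
    (F (rotate g ebar) - c) * kappa R i - (avg t (fun k => a (g *m k)) - c * kappa R i).
  by ring.
rewrite (le_trans (ler_normB _ _))// normrM (gtr0_norm k0).
have := ler_wpM2r (ltW k0) h1; move: h2.
have -> : e / (2 * kappa R i) * kappa R i = e / 2.
  by field; rewrite lt0r_neq0.
by move=> h2 h3; rewrite (splitr e) lerD.
Qed.

(** At each g [ebar] the convolution is nearly a mean of the volumes a(g k) over stabilizer elements
    k. After Jensen, averaging over g makes every k contribute the same amount, namely the mean of
    a^n over the Grassmannian. *)
Lemma power_mean_le :
  \int[leb R n]_(x in @punctured_ball R n) ((kappa R i * F (hat x)) ^+ n) <=
  kappa R n * \int[nu]_(P in @Gr R n i) (section_vol P ^+ n).
Proof.
have k0 := (leb_unit_ball R i).2; have kn0 := (leb_unit_ball R n).2.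
have zl : zonal ebar l := hl.2.
have Fc : rot_cont F := rot_cont_sconv n1 (finS l) hebar zl radial_pow_cont.
have F0 : forall x, sphere x -> 0 <= F x.
  exact: (sconv_ge0 n2 hebar zl radial_pow_cont radial_pow_ge0).
pose p (x : 'rV[R]_n) := (kappa R i * F x) ^+ n.
have p0 x : sphere x -> 0 <= p x.
  by move=> xS; rewrite exprn_ge0// mulr_ge0 ?F0// ltW.
have pc : rot_cont p.
  by apply: (rot_contX n1); apply: (rot_contM n1) => //; exact: rot_cont_cst.
have [M M0 hM] := a_bounds.
have nS : n.-1.+1 = n by rewrite prednK// ltnW.
pose K := n%:R * (M + 1) ^+ n.-1.
have K0 : 0 <= K by rewrite mulr_ge0// exprn_ge0// addr_ge0.
(* Three errors [e] arise: from the ball integral, from the integral against [nu], and from dropping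
   k; the Lipschitz bound for the n-th power adds [K * e]. *)
have C0 : 0 < kappa R n * (3 + K) by rewrite mulr_gt0// ltr_wpDr.
apply/ler_addgt0Pr => eps eps0.
(* Keeping e <= 1 confines [xb + e] to [0, M + 1], where [K] is a Lipschitz constant of the n-th
   power. *)
pose e := Num.min 1 (eps / (kappa R n * (3 + K))).
have e0 : 0 < e by rewrite lt_min ltr01 divr_gt0.
have e1 : e <= 1 by rewrite ge_min lexx.
have eC : e * (kappa R n * (3 + K)) <= eps.
  by rewrite -ler_pdivlMr// ge_min lexx orbT.
(* The index type joins the points of the sphere with one extra index for a^n, so that a single list
   [s] averages both kinds of functions. *)
pose phi (x : option {x : 'rV[R]_n | sphere x}) (g : 'M[R]_n) :=
  if x is Some y then p (rotate g (sval y)) else a g ^+ n.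
have [Bp Bp0 hBp] := rot_cont_bounded n1 pc.
have phic : equicont (@SO R n) phi.
  move=> e' e'0; have /rot_contP/(_ _ e'0)[d1 d10 h1] := pc.
  have [d2 d20 h2] := a_pow_cont e'0.
  exists (Num.min d1 d2); first by rewrite lt_min d10.
  move=> [[x xS]|] g h gS hS; rewrite lt_min => /andP[gh1 gh2] /=; first exact: h1.
  exact: h2.
have phiB x g : SO g -> `|phi x g| <= Bp + M ^+ n.
  move: x => [[x xS]|] gS /=.
    by rewrite (le_trans (hBp _ (rotate_sphere gS xS)))// lerDl exprn_ge0.
  have /andP[a0 aM] := hM _ gS.
  by rewrite ger0_norm ?exprn_ge0// -[leLHS]add0r lerD// lerXn2r ?nnegrE.
have [s [s0 sS hs]] := averaging (SO_subgroup R n) phic phiB e0.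
have dist_eq (u u' v v' : R) : `|u' - v'| <= e -> u' = u -> v' = v -> `|u - v| <= e.
  by move=> h <- <-.
have hsp y : sphere y -> `|avg s (fun k => p (rotate k y)) - avg s (fun k => p (rotate k ebar))| <= e.
  move=> yS; have [g gS <-] := sphere_transitive n1 hebar yS.
  pose x0 : option {x : 'rV[R]_n | sphere x} := Some (exist _ ebar hebar).
  have E1 : avg s (fun k => phi x0 (k *m g)) = avg s (fun k => p (rotate k (rotate g ebar))).
    by apply: eq_avg => k _; rewrite -rotateM.
  have E2 : avg s (fun k => phi x0 (k *m 1%:M)) = avg s (fun k => p (rotate k ebar)).
    by apply: eq_avg => k _; rewrite mulmx1.
  exact: (dist_eq _ _ _ _ (hs x0 g 1%:M gS (SO1 R n)) E1 E2).
have hsa g : SO g -> `|avg s (fun k => a (k *m g) ^+ n) - avg s (fun k => a k ^+ n)| <= e.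
  move=> gS; have E2 : avg s (fun k => phi None (k *m 1%:M)) = avg s (fun k => a k ^+ n).
    by apply: eq_avg => k _; rewrite mulmx1.
  exact: (dist_eq _ _ _ _ (hs None g 1%:M gS (SO1 R n)) erefl E2).
have := cone_mean_average n2 s0 sS hsp pc p0.
have := section_vol_average s0 sS hsa.
set J := \int[nu]_(P in _) _; set Y := \int[leb R n]_(x in _) _.
set X := avg s (fun k => p (rotate k ebar)); set Z := avg s (fun k => a k ^+ n).
move=> hJ hY.
have [t [t0 tS ht]] := subsphere_mean e0.
have XZ : X <= Z + e + K * e.
  apply: (@le_trans _ _ (avg s (fun g => avg t (fun k => a (g *m k) ^+ n) + K * e))).
    apply: ler_avg => g /sS gS; rewrite /p.
    set b := kappa R i * F _; pose xb := avg t (fun k => a (g *m k)).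
    have ab k : k \in t -> 0 <= a (g *m k) <= M by move=> /tS kS; apply: hM; exact: SOM.
    have xb0 : 0 <= xb.
      by rewrite -[0](@avg_cst R _ t 0 t0); apply: ler_avg => k /ab/andP[].
    have xbM : xb <= M.
      by rewrite -[M](avg_cst M t0); apply: ler_avg => k /ab/andP[].
    have b0 : 0 <= b by rewrite mulr_ge0 ?(ltW k0)// F0//; exact: rotate_sphere.
    have bx : b <= xb + e by have := ht g gS; rewrite ler_norml => /andP[_]; rewrite -/b -/xb; lra.
    have : (xb + e) ^+ n <= xb ^+ n + K * e.
      have h1 : 0 <= xb + e <= M + 1 by rewrite addr_ge0 ?(ltW e0)//= lerD.
      have h2 : 0 <= xb <= M + 1 by rewrite xb0 (le_trans xbM)// lerDl.
      have := pow_lipschitz n.-1 h1 h2; rewrite nS addrAC subrr add0r (gtr0_norm e0).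
      by rewrite ler_norml -/K => /andP[_]; lra.
    have := jensen_avg n.-1 t0 (fun k kt => proj1 (andP (ab k kt))); rewrite nS -/xb.
    have : b ^+ n <= (xb + e) ^+ n by rewrite lerXn2r ?nnegrE// addr_ge0// ltW.
    by lra.
  (* With k outside, [hsa] applies to the average over g of a(g k)^n, since k multiplies on the
     right. *)
  rewrite avgD (avg_cst _ s0) lerD2r exchange_avg.
  rewrite -[leRHS](avg_cst _ t0); apply: ler_avg => k /tS kS.
  by have := hsa k kS; rewrite ler_distl => /andP[_ h]; exact: h.
move: hY hJ; rewrite !ler_norml => /andP[_ hY] /andP[hJ _].
have hXJ : X <= J + (3 + K) * e - e by move: hJ XZ; lra.
have := ler_wpM2l (ltW kn0) hXJ; move: hY eC; rewrite -/Y => hY eC h.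
have -> : kappa R n * J = kappa R n * (J + (3 + K) * e - e) - e * (kappa R n * (3 + K)) + e * kappa R n.
  by ring.
by move: hY h eC; rewrite (mulrC (kappa R n) X); lra.
Qed.

End Frame.

Lemma dual_affine_quermassE (B0 : 'M[R]_(i, n)) : B0 *m B0^T = 1%:M ->
  (dual_affine_quermass i nu L ^+ n)%E =
  ((kappa R n / kappa R i) ^+ n * \int[nu]_(P in @Gr R n i) (section_vol P ^+ n))%:E.
Proof.
move=> BB0; rewrite /dual_affine_quermass.
have fin : (nu (@Gr R n i) < +oo)%E by rewrite [X in (X < _)%E]hnu.1 ltry.
have GE P : Gr i P -> sub_vol i P (L `&` subspace_of P) = (section_vol P)%:E.
  by rewrite (Gr_orbit hin BB0) => -[g gS <-]; rewrite sub_vol_conj// section_vol_conj.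
have J0 : 0 <= \int[nu]_(P in @Gr R n i) (section_vol P ^+ n).
  by apply: Rintegral_ge0 => P GP; rewrite exprn_ge0// (section_vol_ge0 BB0).
have -> : (\int[nu]_(P in @Gr R n i) (sub_vol i P (L `&` subspace_of P)) ^+ n)%E =
    (\int[nu]_(P in @Gr R n i) (section_vol P ^+ n))%:E.
  rewrite -(@int_bmeas _ (borel_mx R n n) R nu _ (Gr_measurable BB0) fin _ (section_vol_bmeas BB0)).
    by apply: eq_integral => P; rewrite inE => /GE ->; rewrite EFin_expe.
  by move=> P GP; rewrite exprn_ge0// (section_vol_ge0 BB0).
rewrite poweR_EFin -EFinM -EFin_expe; congr EFin; rewrite exprMn; congr *%R.
rewrite -powR_mulrn ?powR_ge0// -powRrM mulVf ?powRr1//.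
by rewrite pnatr_eq0 -lt0n ltnW// ltnW.
Qed.

End IntersectionBodies.

(** * Both inequalities for the given bodies *)

Theorem theorem1p5 (R : realType) (n i : nat)
    (hn : (3 <= n)%N) (hi : (1 <= i <= n.-1)%N)
    (ebar : 'rV[R]_n) (hebar : sphere ebar)
    (lam : 'rV[R]_n -> probability (borel_mx R 1 n) R)
    (hlam : forall u, sphere u -> uniform_subsphere u (lam u))
    (nu : probability (borel_mx R n n) R) (hnu : haar_Gr i nu)
    (tau : {finite_measure set (borel_mx R 1 n) -> \bar R})
    (htau_sphere : on_sphere tau)
    (htau_even : even_measure tau) (htau_zonal : zonal ebar tau)
    (htau_mass : tau (@sphere R n) = (kappa R n.-1)%:E)
    (L : set 'rV[R]_n) (hL : star_body L) :
  (vol (Psi ebar lam tau i L) <= vol (intersection_body lam i L)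
     <= (kappa R n.-1 ^+ n / kappa R n ^+ n.-1)%:E
          * dual_affine_quermass i nu L ^+ n)%E.
Proof.
have [i0 ile] := andP hi.
have n0 : (0 < n)%N by exact: leq_trans hn.
have nS : n.-1.+1 = n by rewrite prednK.
have hin : (i < n)%N by rewrite -nS ltnS.
have n1 : (1 < n)%N := ltnW hn.
have ki := (leb_unit_ball R i).2; have kn := (leb_unit_ball R n).2.
have k1 := (leb_unit_ball R n.-1).2.
have rc := radial_pow_cont i hn hL; have r0 := radial_pow_ge0 i hL.
pose F := sconv ebar (radial_pow i L) (lam ebar).
have zl : zonal ebar (lam ebar) := (hlam ebar hebar).2.
have Fc : rot_cont F := rot_cont_sconv n1 (finS (lam ebar)) hebar zl rc.
have F0 : forall x, sphere x -> 0 <= F x := sconv_ge0 hn hebar zl rc r0.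
(* The measures [lam u] are given separately for each u; they enter a convolution with [lam ebar]
   alone through [uniform_rotate]. *)
have IE : intersection_body lam i L = body_of (fun u => kappa R n.-1 * F u).
  apply: body_of_ext => u uS; congr *%R.
  have [g gS ge] := sphere_transitive n1 hebar uS; rewrite -ge /F (sconv_rotate n1 zl rc gS).
  apply: (uniform_rotate hn hebar gS (hlam _ hebar) _ rc r0).
  by apply: hlam; rewrite ge.
have tfin : (tau (@sphere R n) < +oo)%E by rewrite [X in (X < _)%E]htau_mass ltry.
have tE : fine (tau (@sphere R n)) = kappa R n.-1 by rewrite [X in fine X]htau_mass.
apply/andP; split.
  (* The roles are m1 = [lam ebar] and m2 = [tau], whose mass kappa_{n-1} is exactly the factor in
     the intersection body. *)
  have := vol_sconv_le hn hebar (finS (lam ebar)) zl tfin htau_zonal _ rc r0.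
  by rewrite tE IE; apply.
have [B0 [BB0 B0e]] := frame_orth i0 hin hebar.
rewrite IE (dual_affine_quermassE hn i0 hin hL hnu BB0) -EFinM.
rewrite vol_body_rot_cont//; first last.
- by move=> x xS; rewrite mulr_ge0 ?F0// ltW.
- by apply: (rot_contM n1) => //; exact: rot_cont_cst.
rewrite lee_fin.
have := power_mean_le hn i0 hin hL hebar (hlam _ hebar) hnu BB0 B0e; rewrite -/F.
set J := \int[nu]_(P in _) _.
(* The section bound is normalized by kappa_i, the intersection body by kappa_{n-1}; the n-th power
   of their ratio comes out of the integral. *)
have -> : \int[leb R n]_(x in @punctured_ball R n) ((kappa R i * F (hat x)) ^+ n) =
    (kappa R i / kappa R n.-1) ^+ n *
    \int[leb R n]_(x in @punctured_ball R n) ((kappa R n.-1 * F (hat x)) ^+ n).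
  rewrite -RintegralZl.
  - apply: eq_Rintegral => x _; rewrite -exprMn; congr (_ ^+ n).
    by field; rewrite lt0r_neq0.
  - exact: punctured_ball_measurable.
  - have pc : rot_cont (fun x => (kappa R n.-1 * F x) ^+ n).
      by apply: (rot_contX n1); apply: (rot_contM n1) => //; exact: rot_cont_cst.
    apply: (bmeas_integrable (@punctured_ball_measurable R n) (finDi R n0)).
    exact: (comp_hat_bmeas (rot_cont_bmeas n1 pc)).
rewrite mulrC -ler_pdivlMr ?exprn_gt0 ?divr_gt0// => /le_trans; apply.
rewrite le_eqVlt; apply/orP; left; apply/eqP.
(* One of the n factors kappa_n in the n-th power of the quermassintegral is the mass of the ball in
   [power_mean_le]; the other n - 1 cancel the denominator. *)
have knS : kappa R n ^+ n = kappa R n * kappa R n ^+ n.-1 by rewrite -exprS nS.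
rewrite !exprMn !exprVn knS.
by field; rewrite !expf_neq0 ?lt0r_neq0.
Qed.
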